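(* Let $1<p<\infty$ and $q=p/(p-1)$. Let $k\in A^q$, $k\not\equiv0$, and let $F$ be the $A^p$ extremal function for $k$. (i) If $F\in A^{(p-1)q_1}$ for some $1<q_1<\infty$, then $k\in A^{q_1}$. (ii) If $F\in H^\infty$, then $k$ belongs to the Bloch space. (iii) If $F$ extends continuously to the closed disc $\overline{\mathbb{D}}$, then $k$ belongs to the little Bloch space.
   Context: $\mathbb{D}$ is the open unit disc and $\sigma$ is normalized area measure on $\mathbb{D}$. For $1<p<\infty$, $A^p$ is the Bergman space of analytic $f$ on $\mathbb{D}$ with $\|f\|_{A^p}=(\int_{\mathbb{D}}|f|^p\,d\sigma)^{1/p}<\infty$; $H^\infty$ is the space of bounded analytic functions on $\mathbb{D}$. The Bloch space consists of analytic $f$ on $\mathbb{D}$ with $\sup_{z\in\mathbb{D}}(1-|z|^2)|f'(z)|<\infty$, and the little Bloch space of those with $(1-|z|^2)|f'(z)|\to0$ as $|z|\to1$. For $k\in A^q$, $k\not\equiv0$, the functional with kernel $k$ is $\phi(f)=\int_{\mathbb{D}} f\,\overline{k}\,d\sigma$ on $A^p$, with norm $\|\phi\|$ in $(A^p)^*$. The extremal function for $k$ is the unique $F\in A^p$ with $\|F\|_{A^p}=1$ and $\operatorname{Re}\phi(F)=\sup_{\|g\|_{A^p}=1}\operatorname{Re}\phi(g)=\|\phi\|$. *)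

(* Defs.v *)
From HB Require Import structures.
From mathcomp Require Import all_boot all_order all_algebra.
From mathcomp Require Import all_classical all_reals all_analysis.
From mathcomp Require Import complex.
Import Order.TTheory GRing.Theory Num.Theory.
Import numFieldNormedType.Exports.

Set Implicit Arguments.
Unset Strict Implicit.
Unset Printing Implicit Defensive.

Local Open Scope classical_set_scope.
Local Open Scope ring_scope.

(* R[i] as a normed module over itself (so that derivatives on R[i] are
   complex derivatives: the increment h ranges over R[i]). *)
Section ComplexNormed.
Variable R : rcfType.
HB.instance Definition _ := GRing.ComAlgebra.copy R[i] R[i]^o.
HB.instance Definition _ := Vector.copy R[i] R[i]^o.
HB.instance Definition _ := NormedModule.copy R[i] R[i]^o.
End ComplexNormed.

Section Bergman.
Variable R : realType.

Definition cabs (z : R[i]) : R := complex.Re `|z|.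

Definition cplx (xy : R * R) : R[i] := Complex xy.1 xy.2.

Definition Disc : set R[i] := [set z | cabs z < 1].
Definition cDisc : set R[i] := [set z | cabs z <= 1].

Definition DiscR2 : set (R * R) := cplx @^-1` Disc.

Definition leb2 := (@lebesgue_measure R \x @lebesgue_measure R)%E.

(* integral of a nonnegative function against normalized area measure
   d sigma = (1/pi) dx dy on the disc *)
Definition area_int (f : R[i] -> R) : \bar R :=
  ((pi^-1)%:E * \int[leb2]_(xy in DiscR2) (f (cplx xy))%:E)%E.

Definition holo_disc (f : R[i] -> R[i]) : Prop :=
  forall z, Disc z -> derivable f z 1.

Definition in_Bergman (p : R) (f : R[i] -> R[i]) : Prop :=
  holo_disc f /\ (area_int (fun z => powR (cabs (f z)) p) < +oo)%E.

Definition Bergman_norm (p : R) (f : R[i] -> R[i]) : R :=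
  powR (fine (area_int (fun z => powR (cabs (f z)) p))) p^-1.

Definition Re_phi (k f : R[i] -> R[i]) : R :=
  pi^-1 * Rintegral leb2 DiscR2
            (fun xy => complex.Re (f (cplx xy) * conjc (k (cplx xy)))).

Definition extremal_function (p : R) (k F : R[i] -> R[i]) : Prop :=
  [/\ in_Bergman p F, Bergman_norm p F = 1 &
      forall g, in_Bergman p g -> Bergman_norm p g = 1 ->
        Re_phi k g <= Re_phi k F].

Definition in_Hinfty (f : R[i] -> R[i]) : Prop :=
  holo_disc f /\ exists M : R, forall z, Disc z -> cabs (f z) <= M.

Definition in_Bloch (f : R[i] -> R[i]) : Prop :=
  holo_disc f /\
  exists C : R, forall z, Disc z -> (1 - cabs z ^+ 2) * cabs ('D_1 f z) <= C.

Definition in_little_Bloch (f : R[i] -> R[i]) : Prop :=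
  holo_disc f /\
  forall eps : R, 0 < eps -> exists r : R, r < 1 /\
    forall z, Disc z -> r < cabs z -> (1 - cabs z ^+ 2) * cabs ('D_1 f z) <= eps.

Definition extends_continuously_cdisc (f : R[i] -> R[i]) : Prop :=
  exists G : R[i] -> R[i],
    {within cDisc, continuous G} /\ forall z, Disc z -> G z = f z.

End Bergman.

(* Main.v *)
(* Perturbing the extremal function F in a direction h shows that
   int h conj(k) is Re phi(F) times int h |F|^(p-2) conj(F).  Taking for h the
   conjugate of the Bergman kernel and using the reproducing formula for k, one
   finds that k is a constant multiple of the Bergman projection of the function
   f = |F|^(p-2) F, whose modulus is |F|^(p-1).  Part (i) is then the
   boundedness of the Bergman projection on L^q1, by Schur's test with powers of
   1 - |w|^2 as weights.  Parts (ii) and (iii) come from differentiating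
   int f(w) / (1 - z conj w)^2 under the integral and from
   int |1 - z conj w|^(-3) = O(1 / (1 - |z|)); for (iii), f(w) is first replaced
   by f(w) - f(z).

   The reproducing formula is obtained from Green's formula: the quotient
   (k(w) - k(z)) / (w - z) is multiplied by 1 / (1 - z conj w) and by a C^1 cutoff
   of 1 - |w|^2, and the integral of the conj-derivative of the product
   vanishes. *)

(* The variation of the extremal problem is kept one-sided: the subgradient inequality for |.|^p
   replaces differentiation of the norm, and the directions h, -h, ih, -ih turn the resulting
   inequality into an equality. Bounded directions suffice, since for fixed z in the disc the kernel
   is at most (1 - |z|)^(-2).

   Two obstacles shape the reproducing formula. [k] is given as complex differentiable only, so
   Green's formula is proved for functions whose conj-derivative alone is known to be continuous, by
   bisection of squares. And [k] need not have boundary values, so the cutoff must vanish near the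
   circle. The factor 1 / (1 - z conj w) is chosen because, as the cutoff tends to 1 - |w|^2, the
   conj-derivative of their product acquires a factor w - z, which cancels the denominator of the
   quotient and leaves the Bergman kernel.

   The Schur weights come from the test function (1 - |w|^2)^(-1/(q q')) with q' conjugate to q: its
   powers q' and q have exponents -1/q and -1/q', both strictly between -1 and 0, the range in which
   the weighted kernel integral gives the weight back. *)
Require Import Defs.
From HB Require Import structures.
From mathcomp Require Import all_boot all_order all_algebra.
From mathcomp Require Import all_classical all_reals all_analysis.
From mathcomp Require Import complex.
From mathcomp Require Import measurable_realfun ring lra.
Import Order.TTheory GRing.Theory Num.Theory.
Import numFieldNormedType.Exports.
Local Open Scope classical_set_scope.
Local Open Scope ring_scope.

Set Implicit Arguments.
Unset Strict Implicit.
Unset Printing Implicit Defensive.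

Local Notation Re := complex.Re.
Local Notation Im := complex.Im.

Lemma le_of_eq {d} {T : porderType d} (x y : T) : x = y -> (x <= y)%O.
Proof. by move=> ->. Qed.

(** * Complex modulus and complex derivatives *)

Section ComplexModulus.
Context {R : realType}.
Implicit Types z w : R[i].

Lemma cabsE z : cabs z = Num.sqrt (Re z ^+ 2 + Im z ^+ 2).
Proof. by rewrite /cabs normc_def. Qed.

Lemma normC_cabs z : `|z| = (cabs z)%:C%C.
Proof. by rewrite cabsE normc_def. Qed.

Lemma cabs_ge0 z : 0 <= cabs z.
Proof. by rewrite cabsE sqrtr_ge0. Qed.

Lemma sqr_cabs z : cabs z ^+ 2 = Re z ^+ 2 + Im z ^+ 2.
Proof. by rewrite cabsE sqr_sqrtr// addr_ge0// sqr_ge0. Qed.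

Lemma cabsM z w : cabs (z * w) = cabs z * cabs w.
Proof. by apply: complexI; rewrite rmorphM /= -!normC_cabs normrM. Qed.

Lemma cabsD z w : cabs (z + w) <= cabs z + cabs w.
Proof. by rewrite -lecR rmorphD/= -!normC_cabs ler_normD. Qed.

Lemma cabsN z : cabs (- z) = cabs z.
Proof. by rewrite /cabs normrN. Qed.

Lemma cabsB z w : cabs (z - w) <= cabs z + cabs w.
Proof. by rewrite -(cabsN w) cabsD. Qed.

Lemma cabs_distC z w : cabs (z - w) = cabs (w - z).
Proof. by rewrite -cabsN opprB. Qed.

Lemma cabs_real (r : R) : cabs r%:C%C = `|r|.
Proof. by rewrite cabsE /= expr0n addr0 sqrtr_sqr. Qed.

Lemma cabs0 : cabs (0 : R[i]) = 0.
Proof. by rewrite -(rmorph0 (real_complex R)) cabs_real normr0. Qed.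

Lemma cabs1 : cabs (1 : R[i]) = 1.
Proof. by rewrite -(rmorph1 (real_complex R)) cabs_real normr1. Qed.

Lemma cabs2 : cabs (2 : R[i]) = 2.
Proof. by rewrite -[2]/(2%:R) -(rmorph_nat (real_complex R)) cabs_real normr_nat. Qed.

Lemma cabs_eq0 z : (cabs z == 0) = (z == 0).
Proof. by rewrite -(inj_eq (@complexI R)) -normC_cabs normr_eq0. Qed.

Lemma cabs_gt0 z : (0 < cabs z) = (z != 0).
Proof. by rewrite lt_def cabs_ge0 andbT cabs_eq0. Qed.

Lemma cabsV z : cabs z^-1 = (cabs z)^-1.
Proof. by apply: complexI; rewrite fmorphV /= -!normC_cabs normfV. Qed.

Lemma cabsX z n : cabs (z ^+ n) = cabs z ^+ n.
Proof. by apply: complexI; rewrite rmorphXn /= -!normC_cabs normrX. Qed.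

Lemma cabs_conj z : cabs (conjc z) = cabs z.
Proof. by rewrite !cabsE; case: z => a b /=; rewrite sqrrN. Qed.

Lemma mul_conjC z : z * conjc z = (cabs z ^+ 2)%:C%C.
Proof. by rewrite rmorphXn /= -normC_cabs sqr_normc. Qed.

Lemma Re_le_cabs z : `|Re z| <= cabs z.
Proof. by rewrite cabsE -sqrtr_sqr ler_wsqrtr// lerDl sqr_ge0. Qed.

Lemma Im_le_cabs z : `|Im z| <= cabs z.
Proof. by rewrite cabsE -sqrtr_sqr ler_wsqrtr// lerDr sqr_ge0. Qed.

Lemma cabs_le_ReIm z : cabs z <= `|Re z| + `|Im z|.
Proof.
rewrite -(@ler_pXn2r _ 2)// ?nnegrE ?cabs_ge0 ?addr_ge0//.
rewrite sqr_cabs sqrrD !real_normK ?num_real//.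
by rewrite addrAC lerDl mulrn_wge0// mulr_ge0.
Qed.

Lemma lerB_cabs z w : cabs z - cabs w <= cabs (z - w).
Proof. by rewrite lerBlDr (le_trans _ (cabsD _ _))// subrK. Qed.

Lemma Re_dist_le z w : `|Re z - Re w| <= cabs (z - w).
Proof. by case: z w => [a b] [c d]; apply: le_trans (Re_le_cabs _). Qed.

Lemma Im_dist_le z w : `|Im z - Im w| <= cabs (z - w).
Proof. by case: z w => [a b] [c d]; apply: le_trans (Im_le_cabs _). Qed.

Lemma cReD z w : Re (z + w) = Re z + Re w.
Proof. by case: z w => [a b] [c d]. Qed.
Lemma cImD z w : Im (z + w) = Im z + Im w.
Proof. by case: z w => [a b] [c d]. Qed.
Lemma cReN z : Re (- z) = - Re z.
Proof. by case: z. Qed.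
Lemma cImN z : Im (- z) = - Im z.
Proof. by case: z. Qed.
Lemma cReM z w : Re (z * w) =
  Re z * Re w - Im z * Im w.
Proof. by case: z w => [a b] [c d]. Qed.
Lemma cImM z w : Im (z * w) =
  Re z * Im w + Im z * Re w.
Proof. by case: z w => [a b] [c d]. Qed.
Lemma complex_eta z : Complex (Re z) (Im z) = z.
Proof. by case: z. Qed.

End ComplexModulus.

Section Topology.
Context {R : realType}.
Implicit Types (z w : R[i]) (f : R[i] -> R[i]).

(** The norm of [R[i]] takes values in [R[i]], so radii of balls are complex numbers; this brings
    them back to real ones. *)
Lemma gt0C_real (e : R[i]) : 0 < e -> e = (Re e)%:C%C /\ 0 < Re e.
Proof.
case: e => a b; rewrite ltcE/= => /andP[/eqP -> a0]; split => //.
Qed.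

Lemma nbhsCP z (A : set R[i]) :
  nbhs z A <-> exists2 d : R, 0 < d & forall w, cabs (w - z) < d -> A w.
Proof.
split.
  move=> /nbhs_ballP[e /= /gt0C_real[-> e0] eA]; exists (Re e) => // w wz.
  by apply: eA; rewrite /ball/= distrC normC_cabs ltcR.
move=> [d d0 dA]; apply/nbhs_ballP; exists d%:C%C; rewrite /= ?ltcR//.
by move=> w; rewrite /ball/= distrC normC_cabs ltcR; exact: dA.
Qed.

Lemma continuousCP f z : {for z, continuous f} <->
  forall e : R, 0 < e -> exists2 d : R, 0 < d &
    forall w, cabs (w - z) < d -> cabs (f w - f z) < e.
Proof.
split=> [fz e e0|fz].
  have /fz/nbhsCP[d d0 dP] : nbhs (f z) [set y | cabs (y - f z) < e].
    by apply/nbhsCP; exists e.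
  by exists d.
move=> A /nbhsCP[e e0 eA]; have [d d0 dP] := fz _ e0.
by apply/nbhsCP; exists d => // w /dP /eA.
Qed.

Lemma scaleCE (a b : R[i]) : a *: (b : R[i]^o) = a * b.
Proof. by []. Qed.

Lemma derivableCP f z (l : R[i]) :
  (forall e : R, 0 < e -> exists2 d : R, 0 < d &
    forall h, cabs h < d -> cabs (f (z + h) - f z - l * h) <= e * cabs h) ->
  derivable f z 1 /\ 'D_1 f z = l.
Proof.
move=> H.
have L : (fun h => h^-1 *: (f (h *: 1 + z) - f z)) @ 0^' --> l.
  move=> A /nbhsCP[e e0 eA].
  have [d d0 dP] := H (e / 2) (divr_gt0 e0 (ltr0Sn _ 1)).
  apply/nbhsCP; exists d => // h; rewrite subr0 => hd h0; apply: eA.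
  have h0' : 0 < cabs h by rewrite cabs_gt0.
  have -> : h^-1 *: (f (h *: 1 + z) - f z) - l = h^-1 * (f (z + h) - f z - l * h).
    by rewrite !scaleCE mulr1 (addrC h); field.
  rewrite cabsM cabsV mulrC ltr_pdivrMr//.
  apply: le_lt_trans (dP _ hd) _.
  by rewrite ltr_pM2r// ltr_pdivrMr// ltr_pMr// ltr1n.
split; first by apply/cvg_ex; exists l.
exact: cvg_lim L.
Qed.

Lemma derivableC f z : derivable f z 1 ->
  forall e : R, 0 < e -> exists2 d : R, 0 < d &
    forall h, cabs h < d -> cabs (f (z + h) - f z - 'D_1 f z * h) <= e * cabs h.
Proof.
move=> df e e0.
have /df/nbhsCP[d d0 dP] : nbhs ('D_1 f z) [set y | cabs (y - 'D_1 f z) < e].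
  by apply/nbhsCP; exists e.
exists d => // h hd; have [->|h0] := eqVneq h 0.
  by rewrite addr0 mulr0 subrr subr0 cabs0 mulr0.
have /= := dP h; rewrite subr0 => /(_ hd h0).
have h0' : 0 < cabs h by rewrite cabs_gt0.
have -> : h^-1 *: (f (h *: 1 + z) - f z) - 'D_1 f z = h^-1 * (f (z + h) - f z - 'D_1 f z * h).
  by rewrite !scaleCE mulr1 (addrC h); field.
by rewrite cabsM cabsV mulrC ltr_pdivrMr// => /ltW.
Qed.

Lemma derivable_continuousC f z : derivable f z 1 -> {for z, continuous f}.
Proof.
move=> /derivableC df; apply/continuousCP => e e0.
have [d d0 dP] := df 1 ltr01.
set M := cabs ('D_1 f z) + 1; have M0 : 0 < M by rewrite ltr_wpDl// cabs_ge0.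
exists (Num.min d (e / M)); first by rewrite lt_min d0 divr_gt0.
move=> w; rewrite lt_min => /andP[wd we]; have wE : z + (w - z) = w by rewrite addrC subrK.
have {dP}/dP := wd; rewrite wE mul1r => H.
rewrite ltr_pdivlMr// in we; apply: le_lt_trans we.
have -> : f w - f z = (f w - f z - 'D_1 f z * (w - z)) + 'D_1 f z * (w - z) by ring.
apply: le_trans (cabsD _ _) _; rewrite [X in _ + X]cabsM /M; lra.
Qed.

End Topology.

(** * Area measure on the disc *)

Section PlaneMeasure.
Context {R : realType}.
Notation leb2 := (@leb2 R).
Notation T2 := (measurableTypeR R * measurableTypeR R)%type.

(** An open set is the union of the rational boxes that it contains. These are countably many
    measurable rectangles, so the set belongs to the product sigma-algebra. *)
Lemma measurable_box_open (A : set T2) :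
  (forall w, A w -> exists2 d : R, 0 < d &
     forall v, `|v.1 - w.1| < d -> `|v.2 - w.2| < d -> A v) ->
  measurable A.
Proof.
move=> oA.
pose box (q : rat * rat * nat) : set T2 :=
  `](ratr q.1.1 - q.2.+1%:R^-1 : R), ratr q.1.1 + q.2.+1%:R^-1[%classic `*`
  `](ratr q.1.2 - q.2.+1%:R^-1 : R), ratr q.1.2 + q.2.+1%:R^-1[%classic.
have -> : A = \bigcup_q (if `[< box q `<=` A >] then box q else set0).
  apply/seteqP; split => [w Aw|w [q _]]; last by case: asboolP => // + H; exact.
  have [d d0 dP] := oA _ Aw.
  (* A box of radius 1/(n+1) that contains [w] lies within 2/(n+1) < d of [w] in each coordinate. *)
  have [n nd] : exists n, n.+1%:R^-1 < d / 2.
    have [n _ nd] := near_infty_natSinv_lt (PosNum (divr_gt0 d0 (ltr0Sn R 1))).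
    by exists n; apply: nd => /=.
  have n0 : 0 < n.+1%:R^-1 :> R by [].
  have ratP (x : R) : exists q : rat, ratr q \in `]x - n.+1%:R^-1, x + n.+1%:R^-1[.
    by apply: rat_in_itvoo; rewrite ltrBlDr -addrA ltrDl addr_gt0.
  have [[q1 Hq1] [q2 Hq2]] := (ratP w.1, ratP w.2).
  rewrite /box; set e := n.+1%:R^-1 in n0 nd Hq1 Hq2.
  move: Hq1 Hq2; rewrite !in_itv/= => /andP[a1 a2] /andP[b1 b2].
  exists (q1, q2, n) => //=; rewrite -/e; case: asboolP => [_|[]].
    by split; rewrite /= in_itv/=; apply/andP; split; lra.
  move=> v [/=]; rewrite !in_itv/= => /andP[c1 c2] /andP[c3 c4].
  by apply: dP; rewrite ltr_norml; apply/andP; split; lra.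
apply: countable_bigcupT_measurable; first exact: countableP.
move=> q; case: ifP => // _; exact: measurableX.
Qed.

Lemma measurable_fun_continuousR (U : set R[i]) (g : R[i] -> R) :
  (forall w, U w -> exists2 d : R, 0 < d & forall v, cabs (v - w) < d -> U v) ->
  (forall w, U w -> forall e : R, 0 < e -> exists2 d : R, 0 < d &
     forall v, cabs (v - w) < d -> `|g v - g w| < e) ->
  measurable (@cplx R @^-1` U : set T2) /\ measurable_fun (@cplx R @^-1` U : set T2) (g \o @cplx R).
Proof.
move=> oU cg.
have key (P : set R[i]) : (forall w, P w -> exists2 d : R, 0 < d & forall v, cabs (v - w) < d -> P v) ->
    measurable (@cplx R @^-1` P : set T2).
  move=> oP; apply: measurable_box_open => w /oP[d d0 dP].
  exists (d / 2) => [|v v1 v2]; first exact: divr_gt0.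
  apply: dP; apply: le_lt_trans (cabs_le_ReIm _) _ => /=.
  by rewrite [ltRHS](splitr d); exact: ltrD.
split; first exact: key.
move=> mU; apply: (measurability _ (measurable_realfun.RGenOInfty.measurableE R)) => //.
move=> _ [_ [a ->] <-].
have -> : (@cplx R @^-1` U) `&` (g \o @cplx R) @^-1` `]a, +oo[ =
    @cplx R @^-1` (U `&` [set w | a < g w]).
  by apply/seteqP; split => w /= [Uw]; rewrite in_itv/= andbT.
apply: key => w [Uw aw].
have [d1 d10 dP1] := oU _ Uw.
have [d2 d20 dP2] := cg _ Uw _ (ltac:(by rewrite subr_gt0) : 0 < g w - a).
exists (Num.min d1 d2); first by rewrite lt_min d10.
move=> v; rewrite lt_min => /andP[v1 v2]; split; first exact: dP1.
by move: (dP2 _ v2); rewrite /= ltr_norml; lra.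
Qed.

Lemma Disc_open (w : R[i]) : Disc w ->
  exists2 d : R, 0 < d & forall v, cabs (v - w) < d -> Disc v.
Proof.
move=> w1; exists (1 - cabs w); rewrite ?subr_gt0// => v.
by rewrite ltrBrDr => /(le_lt_trans _); apply; rewrite (le_trans _ (cabsD _ _))// subrK.
Qed.

Lemma measurable_DiscR2 : measurable (@DiscR2 R : set T2).
Proof.
have [] // := @measurable_fun_continuousR (@Disc R) (fun=> 0) (@Disc_open) _.
by move=> w _ e e0; exists 1 => // v _; rewrite subrr normr0.
Qed.

Lemma measurable_DiscR (g : R[i] -> R) :
  (forall w, Disc w -> forall e : R, 0 < e -> exists2 d : R, 0 < d &
     forall v, cabs (v - w) < d -> `|g v - g w| < e) ->
  measurable_fun (@DiscR2 R : set T2) (g \o @cplx R).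
Proof. by move=> cg; have [] := measurable_fun_continuousR (@Disc_open) cg. Qed.

Lemma leb2_square (a b s : R) : 0 <= s ->
  leb2 (`[a, a + s[ `*` `[b, b + s[) = (s * s)%:E.
Proof.
move=> s0; rewrite /leb2/= product_measure1E//= !lebesgue_measure_itv/= !lte_fin !ltrDl.
rewrite lt_def s0 andbT; have [->|s1] := eqVneq s 0 => /=.
  by rewrite !mul0r mule0.
by rewrite -EFinB -EFinM; congr (_%:E); ring.
Qed.

Lemma DiscR2_square : @DiscR2 R `<=` `[-1, -1 + 2[ `*` `[-1, -1 + 2[.
Proof.
move=> [x y]; rewrite /DiscR2/Disc/= => xy; split; rewrite /= in_itv/=.
  by have := le_lt_trans (Re_le_cabs _) xy; rewrite /= ltr_norml; lra.
by have := le_lt_trans (Im_le_cabs _) xy; rewrite /= ltr_norml; lra.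
Qed.

Lemma leb2_DiscR2_lty : (leb2 (@DiscR2 R) < +oo)%E.
Proof.
apply: (@le_lt_trans _ _ (leb2 (`[-1, -1 + 2[ `*` `[-1, -1 + 2[))).
  apply: le_measure => /=; rewrite ?inE; last exact: DiscR2_square.
    exact: measurable_DiscR2.
  exact: measurableX.
by rewrite leb2_square// ltry.
Qed.

Lemma leb2_DiscR2_gt0 : (0 < leb2 (@DiscR2 R))%E.
Proof.
have sub : `[0, 0 + 2^-1[ `*` `[0, 0 + 2^-1[ `<=` @DiscR2 R.
  move=> [x y] [/=]; rewrite !in_itv/= => /andP[x0 x1] /andP[y0 y1].
  rewrite /DiscR2/Disc/=; apply: le_lt_trans (cabs_le_ReIm _) _.
  by rewrite /= !ger0_norm//; lra.
apply: (@lt_le_trans _ _ (leb2 (`[0, 0 + 2^-1[ `*` `[0, 0 + 2^-1[))).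
  by rewrite leb2_square// lte_fin mulr_gt0.
apply: le_measure => /=; rewrite ?inE//; first exact: measurableX.
exact: measurable_DiscR2.
Qed.

End PlaneMeasure.

(** * Compactness of squares by bisection *)

Section Cousin.
Context {R : realType}.
Variable P : R -> R -> R -> Prop.

(** The first bad quarter of the square with lower left corner [(x, y)] and side [s]. The last
    quarter is the default; it is bad by elimination when the whole square is. *)
Let next (q : R * R * R) : R * R * R :=
  let: (x, y, s) := q in
  if `[< ~ P x y (s / 2) >] then (x, y, s / 2) else
  if `[< ~ P (x + s / 2) y (s / 2) >] then (x + s / 2, y, s / 2) else
  if `[< ~ P x (y + s / 2) (s / 2) >] then (x, y + s / 2, s / 2) else
  (x + s / 2, y + s / 2, s / 2).

(** If [P] failed, it would fail on one quarter of each bad square in turn. The nested bad squares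
    shrink to a point, where the local hypothesis contradicts them. *)
Lemma cousin_square (a b S : R) : 0 < S ->
  (forall x y s, 0 < s -> P x y (s / 2) -> P (x + s / 2) y (s / 2) ->
    P x (y + s / 2) (s / 2) -> P (x + s / 2) (y + s / 2) (s / 2) -> P x y s) ->
  (forall x0 y0, a <= x0 <= a + S -> b <= y0 <= b + S ->
    exists2 d : R, 0 < d & forall x y s, 0 < s < d ->
      x <= x0 <= x + s -> y <= y0 <= y + s -> P x y s) ->
  P a b S.
Proof.
move=> S0 Psub Ploc; apply: contrapT => NP.
pose q n := iter n next (a, b, S).
pose X n := (q n).1.1; pose Y n := (q n).1.2; pose s n := (q n).2.
have qS n : q n.+1 = next (q n) by [].
have sE n : s n.+1 = s n / 2.
  by rewrite /s qS /next; case: (q n) => -[u v] t; do ?case: ifP => ? //.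
have XS n : X n.+1 = X n \/ X n.+1 = X n + s n / 2.
  by rewrite /X /s qS /next; case: (q n) => -[u v] t; do ?case: ifP => ?; auto.
have YS n : Y n.+1 = Y n \/ Y n.+1 = Y n + s n / 2.
  by rewrite /Y /s qS /next; case: (q n) => -[u v] t; do ?case: ifP => ?; auto.
have s0 n : 0 < s n by elim: n => // n IH; rewrite sE divr_gt0.
have bad n : ~ P (X n) (Y n) (s n).
  elim: n => // n IH; move: (s0 n) IH; rewrite /X /Y /s qS /next.
  case: (q n) => -[x y] t /= t0 IH; do ?(case: asboolP => // /contrapT ?).
  by move=> ?; apply: IH; exact: Psub.
(* One coordinate at a time: lower ends increase, upper ends decrease, and the supremum of the lower
   ends lies in all the intervals. *)
have corner (Z : nat -> R) (c : R) : Z 0%N = c ->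
    (forall n, Z n.+1 = Z n \/ Z n.+1 = Z n + s n / 2) ->
    exists2 z, c <= z <= c + S & forall n, Z n <= z <= Z n + s n.
  move=> Z0 ZS.
  have Zle n k : Z n <= Z (n + k)%N /\ Z (n + k)%N + s (n + k)%N <= Z n + s n.
    elim: k => [|k [IH1 IH2]]; first by rewrite addn0.
    have := s0 (n + k)%N; rewrite addnS sE; case: (ZS (n + k)%N) => ->; lra.
  have Zub n m : Z n <= Z m + s m.
    have [nm|/ltnW mn] := leqP n m.
      by have [+ _] := Zle n (m - n)%N; rewrite subnKC// => /le_trans; apply; rewrite lerDl ltW.
    have [_] := Zle m (n - m)%N; rewrite subnKC// => h.
    by apply: le_trans h; rewrite lerDl ltW.
  have hs : has_sup (range Z).
    by split; [exists (Z 0%N), 0%N|exists (Z 0%N + s 0%N) => _ [n _ <-]].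
  have zP n : Z n <= sup (range Z) <= Z n + s n.
    apply/andP; split; first by apply: ub_le_sup; [case: hs|exists n].
    by apply: ge_sup; [case: hs|move=> _ [m _ <-]].
  by exists (sup (range Z)) => //; move: (zP 0%N); rewrite Z0.
have [x0 x0S x0P] := corner X a erefl XS.
have [y0 y0S y0P] := corner Y b erefl YS.
have [d d0 dP] := Ploc _ _ x0S y0S.
(* From 2^n >= n + 1; this weak decay is enough to make the side smaller than [d]. *)
have sn n : s n * n.+1%:R <= S.
  elim: n => [|n IH]; first by rewrite mulr1.
  apply: le_trans IH; rewrite sE -mulrA ler_pM2l// ler_pdivrMl// -natrM ler_nat.
  by rewrite mul2n -addnn addSn addnS !ltnS leq_addl.
have [n _ nd] := near_infty_natSinv_lt (PosNum (divr_gt0 d0 S0)).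
apply: (bad n); apply: dP; rewrite ?x0P ?y0P// s0/=.
have n1 : 0 < n.+1%:R :> R by [].
have := nd n (leqnn n); rewrite /= ltr_pdivlMr// ltr_pdivrMl// => Sd.
by rewrite -(ltr_pM2r n1) (le_lt_trans (sn n))// mulrC.
Qed.

End Cousin.

(** * Green's formula on squares *)

Section Divergence.
Context {R : realType}.
Notation mu := (@lebesgue_measure R).
Notation leb2 := (@leb2 R).
Notation T1 := (measurableTypeR R).
Notation T2 := (measurableTypeR R * measurableTypeR R)%type.
Implicit Types P Q v : R * R -> R.

Definition box_continuous P := forall w, forall e : R, 0 < e ->
  exists2 d : R, 0 < d & forall u, `|u.1 - w.1| < d -> `|u.2 - w.2| < d ->
    `|P u - P w| < e.

Definition has_gradient P (w : R * R) (al be : R) := forall e : R, 0 < e ->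
  exists2 d : R, 0 < d & forall u, `|u.1 - w.1| < d -> `|u.2 - w.2| < d ->
    `|P u - P w - al * (u.1 - w.1) - be * (u.2 - w.2)|
      <= e * (`|u.1 - w.1| + `|u.2 - w.2|).

Lemma box_continuous_measurable P : box_continuous P ->
  measurable_fun (setT : set T2) P.
Proof.
move=> cP mU; apply: (measurability _ (measurable_realfun.RGenOInfty.measurableE R)) => //.
move=> _ [_ [a ->] <-]; rewrite setTI.
apply: measurable_box_open => w; rewrite /preimage/= in_itv/= andbT => aw.
have [d d0 dP] := cP w _ (ltac:(by rewrite subr_gt0) : 0 < P w - a).
exists d => // u u1 u2; rewrite /preimage/= in_itv/= andbT.
by have := dP _ u1 u2; rewrite ltr_norml; lra.
Qed.

(** Boundedness passes from the four quarters to the square by taking the maximum of the bounds, and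
    holds near each point by continuity. *)
Lemma box_continuous_bounded P a b s : box_continuous P -> 0 < s ->
  exists M, forall x y, a <= x <= a + s -> b <= y <= b + s -> `|P (x, y)| <= M.
Proof.
move=> cP s0.
apply: (@cousin_square R (fun a b s => exists M, forall x y,
   a <= x <= a + s -> b <= y <= b + s -> `|P (x, y)| <= M)) => //.
- move=> x y t t0 [M1 H1] [M2 H2] [M3 H3] [M4 H4].
  exists (Num.max (Num.max M1 M2) (Num.max M3 M4)) => u w xu yw.
  rewrite !le_max; have [xu'|xu'] := leP u (x + t / 2).
    have [yw'|yw'] := leP w (y + t / 2).
      by rewrite H1//; lra.
    by rewrite H3 ?orbT//; lra.
  have [yw'|yw'] := leP w (y + t / 2).
    by rewrite H2 ?orbT//; lra.
  by rewrite H4 ?orbT//; lra.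
- move=> x0 y0 _ _; have [d d0 dP] := cP (x0, y0) _ ltr01.
  exists d => // x y t /andP[t0 td] xx yy; exists (`|P (x0, y0)| + 1) => u w xu yw.
  have /= := dP (u, w); rewrite !ltr_norml => /(_ ltac:(lra) ltac:(lra)).
  by have := ler_norm (P (x0, y0)); have := ler_norm (- P (x0, y0)); rewrite normrN ler_norml; lra.
Qed.

(** Edges and squares are half-open so that bisection produces disjoint pieces. *)
Definition edge_int (f : R -> R) (a s : R) : R :=
  Rintegral mu (`[a, a + s[ : set T1) f.
Definition square_int v (x y s : R) : R :=
  Rintegral leb2 (`[x, x + s[ `*` `[y, y + s[ : set T2) v.

Lemma integrable_edge (f : R -> R) a s M : 0 < s -> measurable_fun (setT : set T1) f ->
  (forall t, a <= t <= a + s -> `|f t| <= M) ->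
  mu.-integrable (`[a, a + s[ : set T1) (EFin \o f).
Proof.
move=> s0 mf fM; apply: measurable_bounded_integrable => //=.
- by rewrite lebesgue_measure_itv/=; case: ifP => // _; rewrite -EFinB ltry.
- exact: measurable_funTS.
- exists M; split; first exact: num_real.
  move=> x Mx t /=; rewrite in_itv/= => /andP[t0 t1].
  by apply: le_trans (ltW Mx); apply: fM; rewrite t0 ltW.
Qed.

Lemma integrable_square v x y s M : 0 < s -> measurable_fun (setT : set T2) v ->
  (forall t u, x <= t <= x + s -> y <= u <= y + s -> `|v (t, u)| <= M) ->
  leb2.-integrable (`[x, x + s[ `*` `[y, y + s[ : set T2) (EFin \o v).
Proof.
move=> s0 mf fM; apply: measurable_bounded_integrable => //.
- exact: measurableX.
- rewrite [X in (X < _)%E](leb2_square x y (ltW s0)) ltry //.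
- exact: measurable_funTS.
- exists M; split; first exact: num_real.
  move=> z Mx [t u] [/=]; rewrite !in_itv/= => /andP[t0 t1] /andP[u0 u1].
  by apply: le_trans (ltW Mx); apply: fM; rewrite ?t0 ?u0 ltW.
Qed.

Lemma edge_int_split (f : R -> R) a s : 0 < s ->
  mu.-integrable (`[a, a + s[ : set T1) (EFin \o f) ->
  edge_int f a s = edge_int f a (s / 2) + edge_int f (a + s / 2) (s / 2).
Proof.
move=> s0; rewrite /edge_int.
have -> : `[a, a + s[%classic = `[a, a + s / 2[ `|` `[a + s / 2, a + s / 2 + s / 2[ :> set T1.
  apply/seteqP; split => t /=; rewrite !in_itv/=.
    by have [] := leP (a + s / 2) t; [right|left]; lra.
  by case; lra.
move=> H; apply: Rintegral_setU => //.
apply/disj_setPS => t [/=]; rewrite !in_itv/=; lra.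
Qed.

Lemma square_int_split v x y s : 0 < s ->
  leb2.-integrable (`[x, x + s[ `*` `[y, y + s[ : set T2) (EFin \o v) ->
  square_int v x y s = square_int v x y (s / 2) + square_int v (x + s / 2) y (s / 2)
   + (square_int v x (y + s / 2) (s / 2) + square_int v (x + s / 2) (y + s / 2) (s / 2)).
Proof.
move=> s0; rewrite /square_int.
have -> : `[x, x + s[ `*` `[y, y + s[ =
  (`[x, x + s / 2[ `*` `[y, y + s / 2[ `|` `[x + s / 2, x + s / 2 + s / 2[ `*` `[y, y + s / 2[)
  `|` (`[x, x + s / 2[ `*` `[y + s / 2, y + s / 2 + s / 2[ `|`
       `[x + s / 2, x + s / 2 + s / 2[ `*` `[y + s / 2, y + s / 2 + s / 2[) :> set T2.
  apply/seteqP; split => -[t u] /=; rewrite !in_itv/=; last lra.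
  by have [] := leP (x + s / 2) t; have [] := leP (y + s / 2) u; lra.
move=> H; have mX a b c d : measurable (`[a, b[ `*` `[c, d[ : set T2) by exact: measurableX.
rewrite Rintegral_setU//; [| exact: measurableU | exact: measurableU |].
  congr (_ + _); apply: Rintegral_setU => //.
  - by apply: integrableS H; [repeat apply: measurableU|exact: measurableU|by move=> *; left].
  - by apply/disj_setPS => -[t u] [/=]; rewrite !in_itv/=; lra.
  - by apply: integrableS H; [repeat apply: measurableU|exact: measurableU|by move=> *; right].
  - by apply/disj_setPS => -[t u] [/=]; rewrite !in_itv/=; lra.
by apply/disj_setPS => -[t u] [/=]; rewrite !in_itv/=; lra.
Qed.

(** Meant for two opposite sides of a small square: there [f - g] is close to a constant, the normal
    derivative times the side. *)
Lemma edge_int_near (f g : R -> R) a s c e : 0 < s ->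
  mu.-integrable (`[a, a + s[ : set T1) (EFin \o f) ->
  mu.-integrable (`[a, a + s[ : set T1) (EFin \o g) ->
  (forall t, a <= t <= a + s -> `|f t - g t - c| <= e) ->
  `|edge_int f a s - edge_int g a s - c * s| <= e * s.
Proof.
move=> s0 fi gi H.
have cst r : Rintegral mu (`[a, a + s[ : set T1) (fun=> r) = r * s.
  rewrite Rintegral_cst//= lebesgue_measure_itv/= lte_fin ltrDl s0/=; congr (_ * _); ring.
have icst r : mu.-integrable (`[a, a + s[ : set T1) (EFin \o (fun=> r)).
  by apply: (@integrable_edge _ _ _ `|r|).
have ifg : mu.-integrable (`[a, a + s[ : set T1) (EFin \o (fun t => f t - g t)).
  by have := integrableB _ fi gi; apply.
have ifgc : mu.-integrable (`[a, a + s[ : set T1) (EFin \o (fun t => f t - g t - c)).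
  by have := integrableB _ ifg (icst c); apply.
rewrite /edge_int -[c * s]cst -RintegralB// -RintegralB//.
apply: le_trans (le_normr_Rintegral _ ifgc) _ => //.
rewrite -[e * s]cst; apply: le_Rintegral => //; first exact: (integrable_norm ifgc).
by move=> t /=; rewrite in_itv/= => /andP[t0 t1]; apply: H; rewrite t0 ltW.
Qed.

Lemma square_int_near v x y s c e : 0 < s ->
  leb2.-integrable (`[x, x + s[ `*` `[y, y + s[ : set T2) (EFin \o v) ->
  (forall t u, x <= t <= x + s -> y <= u <= y + s -> `|v (t, u) - c| <= e) ->
  `|square_int v x y s - c * (s * s)| <= e * (s * s).
Proof.
move=> s0 vi H.
have mX : measurable (`[x, x + s[ `*` `[y, y + s[ : set T2) by exact: measurableX.
have cst r : Rintegral leb2 (`[x, x + s[ `*` `[y, y + s[ : set T2) (fun=> r) = r * (s * s).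
  by rewrite Rintegral_cst// [X in fine X](leb2_square x y (ltW s0)).
have icst r : leb2.-integrable (`[x, x + s[ `*` `[y, y + s[ : set T2) (EFin \o (fun=> r)).
  by apply: (@integrable_square _ _ _ _ `|r|).
have ivc : leb2.-integrable (`[x, x + s[ `*` `[y, y + s[ : set T2) (EFin \o (fun t => v t - c)).
  by have := integrableB _ vi (icst c); apply.
rewrite /square_int -[c * _]cst -RintegralB//.
apply: le_trans (le_normr_Rintegral _ ivc) _ => //.
rewrite -[e * _]cst; apply: le_Rintegral => //; first exact: (integrable_norm ivc).
move=> [t u] [/=]; rewrite !in_itv/= => /andP[t0 t1] /andP[u0 u1].
by apply: H; rewrite ?t0 ?u0 ltW.
Qed.

(* No continuity of the partial derivatives is assumed, only that of the
   divergence [v]: the flux through small squares is compared with [v] as in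
   Goursat's lemma. *)
Lemma divergence_square P Q v (al be : R * R -> R) (a b S : R) : 0 < S ->
  box_continuous P -> box_continuous Q -> box_continuous v ->
  (forall w, exists be', has_gradient P w (al w) be') ->
  (forall w, exists al', has_gradient Q w al' (be w)) ->
  (forall w, al w + be w = v w) ->
  edge_int (fun t => P (a + S, t)) b S - edge_int (fun t => P (a, t)) b S
  + (edge_int (fun t => Q (t, b + S)) a S - edge_int (fun t => Q (t, b)) a S)
  = square_int v a b S.
Proof.
move=> S0 cP cQ cv dP dQ dv.
have mP := box_continuous_measurable cP; have mQ := box_continuous_measurable cQ.
have mv := box_continuous_measurable cv.
have iP x y s : 0 < s -> mu.-integrable (`[y, y + s[ : set T1) (EFin \o (fun t => P (x, t))).
  move=> s0; have [M PM] := box_continuous_bounded x y cP s0.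
  apply: (integrable_edge (M := M)) => //; first exact: measurable_fun_pair2.
  by move=> t yt; apply: PM => //; lra.
have iQ x y s : 0 < s -> mu.-integrable (`[x, x + s[ : set T1) (EFin \o (fun t => Q (t, y))).
  move=> s0; have [M QM] := box_continuous_bounded x y cQ s0.
  apply: (integrable_edge (M := M)) => //; first exact: measurable_fun_pair1.
  by move=> t yt; apply: QM => //; lra.
have iv x y s : 0 < s -> leb2.-integrable (`[x, x + s[ `*` `[y, y + s[ : set T2) (EFin \o v).
  move=> s0; have [M vM] := box_continuous_bounded x y cv s0.
  exact: (integrable_square (M := M)).
(* The defect of the formula is additive under subdivision, because the fluxes through inner edges
   cancel. It therefore suffices to bound it by [e] times the area on small squares. *)
pose Phi x y s := edge_int (fun t => P (x + s, t)) y s - edge_int (fun t => P (x, t)) y s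
  + (edge_int (fun t => Q (t, y + s)) x s - edge_int (fun t => Q (t, y)) x s)
  - square_int v x y s.
suff small e : 0 < e -> `|Phi a b S| <= e * (S * S).
  apply/eqP; rewrite -subr_eq0 -normr_eq0 -/(Phi a b S); apply/eqP.
  apply/le_anti; rewrite normr_ge0 andbT; apply/ler_addgt0Pr => e e0.
  have SS0 : 0 < S * S by rewrite mulr_gt0.
  have := small (e / (S * S)) (divr_gt0 e0 SS0).
  by rewrite divfK ?gt_eqF// add0r.
move=> e0; apply: (@cousin_square R (fun x y s => `|Phi x y s| <= e * (s * s))) => //.
  move=> x y s s0; have s20 : 0 < s / 2 by rewrite divr_gt0.
  have -> : Phi x y s = Phi x y (s / 2) + Phi (x + s / 2) y (s / 2)
     + Phi x (y + s / 2) (s / 2) + Phi (x + s / 2) (y + s / 2) (s / 2).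
    rewrite /Phi (@square_int_split v)//; last exact: iv.
    rewrite [edge_int (fun t => P (x + s, t)) _ _]edge_int_split//; last exact: iP.
    rewrite [edge_int (fun t => P (x, t)) y s]edge_int_split//; last exact: iP.
    rewrite [edge_int (fun t => Q (t, y + s)) _ _]edge_int_split//; last exact: iQ.
    rewrite [edge_int (fun t => Q (t, y)) x s]edge_int_split//; last exact: iQ.
    have -> : x + s / 2 + s / 2 = x + s by rewrite -addrA -splitr.
    have -> : y + s / 2 + s / 2 = y + s by rewrite -addrA -splitr.
    ring.
  move=> H1 H2 H3 H4.
  apply: le_trans (ler_normD _ _) _; apply: le_trans (lerD (ler_normD _ _) (lexx _)) _.
  apply: le_trans (lerD (lerD (ler_normD _ _) (lexx _)) (lexx _)) _; lra.
move=> x0 y0 _ _.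
(* In units of [e / 9] times the area, each pair of opposite sides contributes an error 4 and the
   divergence an error 1. *)
have e90 : 0 < e / 9 by rewrite divr_gt0.
have [be' /(_ _ e90)[d1 d10 H1]] := dP (x0, y0).
have [al' /(_ _ e90)[d2 d20 H2]] := dQ (x0, y0).
have [d3 d30 H3] := cv (x0, y0) _ e90.
exists (Num.min d1 (Num.min d2 d3)); first by rewrite !lt_min d10 d20.
move=> x y s /andP[s0]; rewrite !lt_min => /andP[sd1 /andP[sd2 sd3]] xx yy.
have near (f : R * R -> R) (p q : R) d :
    (forall u, `|u.1 - x0| < d -> `|u.2 - y0| < d ->
      `|f u - f (x0, y0) - p * (u.1 - x0) - q * (u.2 - y0)| <= e / 9 * (`|u.1 - x0| + `|u.2 - y0|)) ->
    s < d -> forall t r, x <= t <= x + s -> y <= r <= y + s ->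
    `|f (t, r) - f (x0, y0) - p * (t - x0) - q * (r - y0)| <= e / 9 * (2 * s).
  move=> H sd t r tx ry.
  have n1 : `|t - x0| <= s by rewrite ler_norml; lra.
  have n2 : `|r - y0| <= s by rewrite ler_norml; lra.
  apply: le_trans (H (t, r) _ _) _ => /=; [exact: le_lt_trans n1 _|exact: le_lt_trans n2 _|].
  by rewrite ler_pM2l//; lra.
have B1 : `|edge_int (fun t => P (x + s, t)) y s - edge_int (fun t => P (x, t)) y s
     - (al (x0, y0) * s) * s| <= (e / 9 * (4 * s)) * s.
  apply: edge_int_near => //; try exact: iP.
  move=> t yt.
  (* Subtracting the expansions on the two sides cancels the tangential term, so the derivative
     [be'] drops out. *)
  have := near _ _ _ _ H1 sd1 (x + s) t ltac:(lra) yt.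
  have := near _ _ _ _ H1 sd1 x t ltac:(lra) yt.
  rewrite !ler_norml; lra.
have B2 : `|edge_int (fun t => Q (t, y + s)) x s - edge_int (fun t => Q (t, y)) x s
     - (be (x0, y0) * s) * s| <= (e / 9 * (4 * s)) * s.
  apply: edge_int_near => //; try exact: iQ.
  move=> t xt.
  have := near _ _ _ _ H2 sd2 t (y + s) xt ltac:(lra).
  have := near _ _ _ _ H2 sd2 t y xt ltac:(lra).
  rewrite !ler_norml; lra.
have B3 : `|square_int v x y s - v (x0, y0) * (s * s)| <= e / 9 * (s * s).
  apply: square_int_near => //; first exact: iv.
  move=> t u tx uy; apply/ltW/H3 => /=; rewrite ltr_norml; lra.
have vE : v (x0, y0) * (s * s) = al (x0, y0) * s * s + be (x0, y0) * s * s.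
  rewrite -dv; ring.
have es : e / 9 * (4 * s) * s = 4 * (e / 9 * (s * s)) by ring.
have es' : e * (s * s) = 9 * (e / 9 * (s * s)) by field.
move: B1 B2 B3; rewrite /Phi !ler_norml es es' vE; lra.
Qed.

End Divergence.

(** * Wirtinger derivatives *)

Section Wirtinger.
Context {R : realType}.
Implicit Types (u v : R[i] -> R[i]) (w z A B : R[i]).

(* [A] and [B] are the Wirtinger derivatives of [u] at [w] with respect to
   [w] and to its conjugate. *)
Definition wirtinger u w A B := forall e : R, 0 < e -> exists2 d : R, 0 < d &
  forall h, cabs h < d ->
    cabs (u (w + h) - u w - A * h - B * conjc h) <= e * cabs h.

Lemma wirtinger_bound u w A B : wirtinger u w A B -> exists2 d : R, 0 < d &
  forall h, cabs h < d -> cabs (u (w + h) - u w) <= (1 + cabs A + cabs B) * cabs h.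
Proof.
move=> /(_ _ ltr01)[d d0 dP]; exists d => // h /dP H.
have -> : u (w + h) - u w = (u (w + h) - u w - A * h - B * conjc h) + A * h + B * conjc h by ring.
apply: le_trans (cabsD _ _) _; apply: le_trans (lerD (cabsD _ _) (lexx _)) _.
by move: H; rewrite !cabsM cabs_conj; lra.
Qed.

Lemma wirtinger_continuous u w A B : wirtinger u w A B -> {for w, continuous u}.
Proof.
move=> /wirtinger_bound[d d0 dP]; apply/continuousCP => e e0.
have c0 : 0 < 1 + cabs A + cabs B by have := cabs_ge0 A; have := cabs_ge0 B; lra.
exists (Num.min d (e / (1 + cabs A + cabs B))); first by rewrite lt_min d0 divr_gt0.
move=> x; rewrite lt_min => /andP[/dP + xe]; rewrite subrKC => /le_lt_trans; apply.
by rewrite mulrC -ltr_pdivlMr.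
Qed.

Lemma wirtinger_near u v w A B (d : R) : 0 < d ->
  (forall x, cabs (x - w) < d -> u x = v x) -> wirtinger u w A B -> wirtinger v w A B.
Proof.
move=> d0 uv H e /H[d1 d10 dP]; exists (Num.min d d1); first by rewrite lt_min d0.
move=> h; rewrite lt_min => /andP[hd hd1]; rewrite -!uv ?subrr ?cabs0//; first exact: dP.
by rewrite addrC addKr.
Qed.

Lemma wirtinger_derivable u w : derivable u w 1 -> wirtinger u w ('D_1 u w) 0.
Proof.
by move=> /derivableC H e /H[d d0 dP]; exists d => // h /dP; rewrite mul0r subr0.
Qed.

Lemma wirtinger_cst c w : wirtinger (fun=> c) w 0 0.
Proof.
move=> e e0; exists 1 => // h _.
by rewrite subrr !mul0r !subr0 cabs0 mulr_ge0// ?cabs_ge0// ltW.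
Qed.

Lemma wirtingerB u v w A B A' B' : wirtinger u w A B -> wirtinger v w A' B' ->
  wirtinger (fun x => u x - v x) w (A - A') (B - B').
Proof.
move=> Hu Hv e e0; have e20 : 0 < e / 2 by rewrite divr_gt0.
have [d1 d10 H1] := Hu _ e20; have [d2 d20 H2] := Hv _ e20.
exists (Num.min d1 d2); first by rewrite lt_min d10.
move=> h; rewrite lt_min => /andP[/H1 {}H1 /H2 {}H2].
have -> : u (w + h) - v (w + h) - (u w - v w) - (A - A') * h - (B - B') * conjc h =
  (u (w + h) - u w - A * h - B * conjc h) - (v (w + h) - v w - A' * h - B' * conjc h) by ring.
apply: le_trans (cabsB _ _) _; lra.
Qed.

Lemma wirtinger_conj u w A B : wirtinger u w A B ->
  wirtinger (fun x => conjc (u x)) w (conjc B) (conjc A).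
Proof.
move=> H e /H[d d0 dP]; exists d => // h /dP; rewrite -cabs_conj.
rewrite !rmorphB !rmorphM /= conjcK.
by congr (cabs _ <= _); ring.
Qed.

Lemma wirtingerM u v w A B A' B' : wirtinger u w A B -> wirtinger v w A' B' ->
  wirtinger (fun x => u x * v x) w (A * v w + u w * A') (B * v w + u w * B').
Proof.
move=> Hu Hv e e0.
set K := 1 + cabs (u w) + cabs (v w).
have K0 : 0 < K by have := cabs_ge0 (u w); have := cabs_ge0 (v w); rewrite /K; lra.
have eK : 0 < e / (3 * K) by rewrite divr_gt0// mulr_gt0.
have [d1 d10 H1] := Hu _ eK; have [d2 d20 H2] := Hv _ eK.
have [d3 d30 H3] := wirtinger_bound Hu; have [d4 d40 H4] := wirtinger_bound Hv.
set a := 1 + cabs A + cabs B in H3; set b := 1 + cabs A' + cabs B' in H4.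
have a0 : 0 < a by have := cabs_ge0 A; have := cabs_ge0 B; rewrite /a; lra.
have b0 : 0 < b by have := cabs_ge0 A'; have := cabs_ge0 B'; rewrite /b; lra.
(* The last bound makes the product of the two increments, at most [a * b] times |h|^2, cost a third
   of the allowed error. *)
exists (Num.min (Num.min d1 d2) (Num.min (Num.min d3 d4) (e / (3 * (a * b))))).
  by rewrite !lt_min d10 d20 d30 d40 divr_gt0// !mulr_gt0.
move=> h; rewrite !lt_min => /andP[/andP[/H1 {}H1 /H2 {}H2] /andP[/andP[/H3 {}H3 /H4 {}H4] he]].
have -> : u (w + h) * v (w + h) - u w * v w - (A * v w + u w * A') * h
    - (B * v w + u w * B') * conjc h =
  (u (w + h) - u w - A * h - B * conjc h) * v w
  + u w * (v (w + h) - v w - A' * h - B' * conjc h)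
  + (u (w + h) - u w) * (v (w + h) - v w) by ring.
apply: le_trans (cabsD _ _) _; apply: le_trans (lerD (cabsD _ _) (lexx _)) _.
have h0 := cabs_ge0 h.
have T (X : R[i]) (c : R[i]) : cabs X <= e / (3 * K) * cabs h -> cabs c <= K ->
    cabs X * cabs c <= e / 3 * cabs h.
  move=> X1 c1; apply: le_trans (ler_pM (cabs_ge0 _) (cabs_ge0 _) X1 c1) _.
  apply: le_of_eq; field; rewrite gt_eqF//.
rewrite !cabsM.
have -> : e * cabs h = e / 3 * cabs h + e / 3 * cabs h + e / 3 * cabs h by field.
apply: lerD; first apply: lerD.
- apply: T => //; rewrite /K; have := cabs_ge0 (u w); lra.
- rewrite mulrC; apply: T => //; rewrite /K; have := cabs_ge0 (v w); lra.
- apply: le_trans (ler_pM (cabs_ge0 _) (cabs_ge0 _) H3 H4) _.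
  rewrite mulrACA mulrA; apply: ler_wpM2r => //.
  rewrite ltr_pdivlMr ?mulr_gt0// in he.
  rewrite ler_pdivlMr//; lra.
Qed.

(** Chain rule for the cutoffs and regularizations, which are real functions of |w|^2 or |w - z|^2;
    the real number [g'] multiplies both Wirtinger derivatives. *)
Lemma wirtinger_real_comp (g : R -> R) (T : R[i] -> R) (g' : R) w A B :
  (forall e : R, 0 < e -> exists2 d : R, 0 < d & forall t, `|t - T w| < d ->
     `|g t - g (T w) - g' * (t - T w)| <= e * `|t - T w|) ->
  wirtinger (fun x => (T x)%:C%C) w A B ->
  wirtinger (fun x => (g (T x))%:C%C) w (g'%:C%C * A) (g'%:C%C * B).
Proof.
move=> Hg HT e e0.
have [d1 d10 H1] := wirtinger_bound HT.
set a := 1 + cabs A + cabs B in H1.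
have a0 : 0 < a by have := cabs_ge0 A; have := cabs_ge0 B; rewrite /a; lra.
have [d2 d20 H2] := Hg (e / (2 * a)) ltac:(by rewrite divr_gt0// mulr_gt0).
have g10 : 0 < 1 + `|g'| by have := normr_ge0 g'; lra.
have [d3 d30 H3] := HT (e / (2 * (1 + `|g'|))) ltac:(by rewrite divr_gt0// mulr_gt0).
exists (Num.min d1 (Num.min d3 (d2 / a))); first by rewrite !lt_min d10 d30 divr_gt0.
move=> h; rewrite !lt_min => /andP[/H1 {}H1 /andP[/H3 {}H3]].
rewrite ltr_pdivlMr// => hd.
have Th : `|T (w + h) - T w| <= a * cabs h by move: H1; rewrite -rmorphB/= cabs_real.
have {}H2 := H2 (T (w + h)) ltac:(by apply: le_lt_trans Th _; rewrite mulrC).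
have -> : (g (T (w + h)))%:C%C - (g (T w))%:C%C - g'%:C%C * A * h - g'%:C%C * B * conjc h =
  (g (T (w + h)) - g (T w) - g' * (T (w + h) - T w))%:C%C
  + g'%:C%C * ((T (w + h))%:C%C - (T w)%:C%C - A * h - B * conjc h).
  rewrite !(rmorphB, rmorphM)/=; ring.
apply: le_trans (cabsD _ _) _; rewrite cabsM !cabs_real.
have h0 := cabs_ge0 h.
have -> : e * cabs h = e / (2 * a) * (a * cabs h) + (1 + `|g'|) * (e / (2 * (1 + `|g'|)) * cabs h).
  by field; rewrite !gt_eqF.
apply: lerD.
  apply: le_trans H2 _; apply: ler_wpM2l => //.
  by rewrite ltW// divr_gt0// mulr_gt0.
by apply: ler_pM => //; rewrite ?cabs_ge0// lerDr.
Qed.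

Lemma wirtinger_sqr_dist z w :
  wirtinger (fun x => (cabs (x - z) ^+ 2)%:C%C) w (conjc (w - z)) (w - z).
Proof.
move=> e e0; exists e => // h he; rewrite -!mul_conjC.
have -> : w + h - z = (w - z) + h by ring.
rewrite [conjc (_ + h)]rmorphD/=.
have -> : (w - z + h) * (conjc (w - z) + conjc h) - (w - z) * conjc (w - z)
   - conjc (w - z) * h - (w - z) * conjc h = h * conjc h by ring.
by rewrite cabsM cabs_conj ler_wpM2r ?cabs_ge0// ltW.
Qed.

End Wirtinger.

(** * Integrals over the disc *)

Section AreaIntegral.
Context {R : realType}.
Notation leb2 := (@leb2 R).
Notation T2 := (measurableTypeR R * measurableTypeR R)%type.
Implicit Types (u v f g : R[i] -> R[i]).

(** Complex integrals are taken componentwise and against dx dy, without the factor 1/pi. *)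
Definition cint f : R[i] :=
  Complex (Rintegral leb2 (@DiscR2 R) (fun w => Re (f (cplx w))))
          (Rintegral leb2 (@DiscR2 R) (fun w => Im (f (cplx w)))).

Lemma edge_int0 (f : R -> R) (a s : R) : (forall t, f t = 0) -> edge_int f a s = 0.
Proof.
move=> f0; rewrite /edge_int (_ : f = cst 0); last by apply/funext => t; exact: f0.
by rewrite Rintegral_cst//= mul0r.
Qed.

Lemma square_int_Disc (v : R * R -> R) : (forall w, ~ DiscR2 w -> v w = 0) ->
  square_int v (-1) (-1) 2 = Rintegral leb2 (@DiscR2 R) v.
Proof.
move=> v0; rewrite /square_int [LHS]Rintegral_mkcond [RHS]Rintegral_mkcond; congr Rintegral.
apply/funext => w; rewrite /patch; case: ifPn => [_|w1].
  by case: ifPn => // /negP w1; rewrite v0// => w2; apply: w1; rewrite inE.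
case: ifPn => //; rewrite inE => /DiscR2_square w2.
by move: w1; rewrite notin_setE => /(_ w2).
Qed.

Lemma box_continuousC u : (forall w, {for w, continuous u}) ->
  box_continuous (fun x => Re (u (cplx x))) /\
  box_continuous (fun x => Im (u (cplx x))).
Proof.
move=> cu; split=> w e e0; have /continuousCP/(_ e e0)[d d0 dP] := cu (cplx w).
  exists (d / 2) => [|x x1 x2]; first exact: divr_gt0.
  apply: le_lt_trans (Re_dist_le _ _) _; apply: dP.
  by apply: le_lt_trans (cabs_le_ReIm _) _ => /=; rewrite [ltRHS]splitr; exact: ltrD.
exists (d / 2) => [|x x1 x2]; first exact: divr_gt0.
apply: le_lt_trans (Im_dist_le _ _) _; apply: dP.
by apply: le_lt_trans (cabs_le_ReIm _) _ => /=; rewrite [ltRHS]splitr; exact: ltrD.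
Qed.

Lemma box_continuousM (c : R) (P : R * R -> R) : box_continuous P ->
  box_continuous (fun x => c * P x).
Proof.
move=> cP w e e0; have c0 : 0 < 1 + `|c| by rewrite ltr_pwDl.
have [d d0 dP] := cP w (e / (1 + `|c|)) ltac:(by rewrite divr_gt0).
exists d => // u u1 u2; have := dP _ u1 u2.
rewrite -mulrBr normrM ltr_pdivlMr// => H; apply: le_lt_trans H.
by rewrite mulrC ler_wpM2l// lerDr.
Qed.

(** This is u_x = A + B and u_y = i (A - B), read in components. The factors 1/2 are those of the
    conj-derivative (u_x + i u_y) / 2. *)
Lemma wirtinger_gradient u w A B : wirtinger u (cplx w) A B ->
  has_gradient (fun x => 2^-1 * Re (u (cplx x))) w
    (2^-1 * (Re A + Re B)) (2^-1 * (Im B - Im A)) /\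
  has_gradient (fun x => 2^-1 * Im (u (cplx x))) w
    (2^-1 * (Im A + Im B)) (2^-1 * (Re A - Re B)).
Proof.
move=> H.
have key e : 0 < e -> exists2 d : R, 0 < d & forall x : R * R,
   `|x.1 - w.1| < d -> `|x.2 - w.2| < d ->
   cabs (u (cplx x) - u (cplx w) - A * cplx (x.1 - w.1, x.2 - w.2)
     - B * conjc (cplx (x.1 - w.1, x.2 - w.2))) <= e * (`|x.1 - w.1| + `|x.2 - w.2|).
  move=> e0; have [d d0 dP] := H _ e0; exists (d / 2); first exact: divr_gt0.
  move=> x x1 x2; set h := cplx (_ - _, _); have hle : cabs h <= `|x.1 - w.1| + `|x.2 - w.2| by exact: cabs_le_ReIm.
  have -> : cplx x = cplx w + h.
    by rewrite /h /cplx/=; apply/eqP; rewrite eq_complex/= !subrKC !eqxx.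
  apply: le_trans (dP h _) _; last by rewrite ler_wpM2l// ltW.
  by apply: le_lt_trans hle _; rewrite [ltRHS]splitr; exact: ltrD.
split=> e e0.
  have [d d0 dP] := key _ e0; exists d => // x x1 x2.
  have /= := dP x x1 x2; set h := cplx (_ - _, _); set U := (X in cabs X <= _) => HU.
  have : `|Re U| <= e * (`|x.1 - w.1| + `|x.2 - w.2|) by apply: le_trans (Re_le_cabs _) HU.
  have -> : Re U = Re (u (cplx x)) - Re (u (cplx w))
    - (Re A + Re B) * (x.1 - w.1) - (Im B - Im A) * (x.2 - w.2).
    rewrite /U /h !(cReD, cReN, cReM) /cplx /=; ring.
  by rewrite !ler_norml => HH; have := normr_ge0 (x.1 - w.1); have := normr_ge0 (x.2 - w.2); lra.
have [d d0 dP] := key _ e0; exists d => // x x1 x2.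
have /= := dP x x1 x2; set h := cplx (_ - _, _); set U := (X in cabs X <= _) => HU.
have : `|Im U| <= e * (`|x.1 - w.1| + `|x.2 - w.2|) by apply: le_trans (Im_le_cabs _) HU.
have -> : Im U = Im (u (cplx x)) - Im (u (cplx w))
  - (Im A + Im B) * (x.1 - w.1) - (Re A - Re B) * (x.2 - w.2).
  rewrite /U /h !(cImD, cImN, cImM) /cplx /=; ring.
by rewrite !ler_norml => HH; have := normr_ge0 (x.1 - w.1); have := normr_ge0 (x.2 - w.2); lra.
Qed.

(** The flux through the boundary of the square [-1, 1]^2 vanishes, because its points have modulus
    at least 1. The derivative [A] is arbitrary, so a holomorphic factor may enter without
    continuity of its derivative. *)
Lemma cint_dbar u v : (forall w, exists A, wirtinger u w A (v w)) ->
  (forall w, {for w, continuous v}) ->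
  (forall w, 1 <= cabs w -> u w = 0 /\ v w = 0) -> cint v = 0.
Proof.
move=> /choice[A HA] cv uv0.
have cu w : {for w, continuous u} := wirtinger_continuous (HA w).
have [cRu cIu] := box_continuousC cu; have [cRv cIv] := box_continuousC cv.
have HG w := wirtinger_gradient (HA (cplx w)).
have out (w : R * R) : ~ DiscR2 w -> u (cplx w) = 0 /\ v (cplx w) = 0.
  by rewrite /DiscR2/Disc/= => /negP; rewrite -leNgt => /uv0.
have out1 (x y : R) : 1 <= `|x| \/ 1 <= `|y| -> u (cplx (x, y)) = 0.
  move=> xy; apply: (uv0 _ _).1; case: xy => xy; apply: le_trans xy _.
    exact: (Re_le_cabs (cplx (x, y))).
  exact: (Im_le_cabs (cplx (x, y))).
have n1 : 1 <= `|-1 + 2 : R|.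
  by rewrite (_ : -1 + 2 = 1 :> R) ?normr1//; ring.
have n2 : 1 <= `|-1 : R| by rewrite normrN normr1.
rewrite /cint; apply/eqP; rewrite eq_complex/=; apply/andP; split; apply/eqP.
  rewrite -square_int_Disc; last by move=> w /out[_ ->].
  (* Re v is the divergence of (Re u, - Im u) / 2; below, Im v is that of (Im u, Re u) / 2. *)
  have <- := @divergence_square R (fun x => 2^-1 * Re (u (cplx x)))
    (fun x => - 2^-1 * Im (u (cplx x))) _
    (fun w => 2^-1 * (Re (A (cplx w)) + Re (v (cplx w))))
    (fun w => - (2^-1 * (Re (A (cplx w)) - Re (v (cplx w)))))
    (-1) (-1) 2.
  - by rewrite !edge_int0 ?subrr ?addr0// => t; rewrite out1 ?mulr0//; auto.
  - by [].
  - exact: box_continuousM.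
  - exact: box_continuousM.
  - exact: cRv.
  - by move=> w; have [+ _] := HG w; eexists; eassumption.
  - move=> w; have [_ p] := HG w.
    exists (- (2^-1 * (Im (A (cplx w)) + Im (v (cplx w))))).
    move=> e e0; have [d d0 dP] := p e e0; exists d => // x x1 x2.
    by apply: le_trans (dP _ x1 x2); rewrite -normrN; apply: le_of_eq; congr `|_|; ring.
  - by move=> w /=; field.
rewrite -square_int_Disc; last by move=> w /out[_ ->].
have <- := @divergence_square R (fun x => 2^-1 * Im (u (cplx x)))
  (fun x => 2^-1 * Re (u (cplx x))) _
  (fun w => 2^-1 * (Im (A (cplx w)) + Im (v (cplx w))))
  (fun w => (2^-1 * (Im (v (cplx w)) - Im (A (cplx w)))))
  (-1) (-1) 2.
- by rewrite !edge_int0 ?subrr ?addr0// => t; rewrite out1 ?mulr0//; auto.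
- by [].
- exact: box_continuousM.
- exact: box_continuousM.
- exact: cIv.
- by move=> w; have [_ +] := HG w; eexists; eassumption.
- by move=> w; have [+ _] := HG w; eexists; eassumption.
- by move=> w /=; field.
Qed.

End AreaIntegral.

Section AreaIntegralTheory.
Context {R : realType}.
Notation leb2 := (@leb2 R).
Notation D := (@DiscR2 R).
Notation T2 := (measurableTypeR R * measurableTypeR R)%type.
Implicit Types (f h : R[i] -> R[i]) (g : R[i] -> R).

Definition disc_measurable g := measurable_fun (D : set T2) (g \o @cplx R).
Definition disc_integrable g := leb2.-integrable (D : set T2) (EFin \o (g \o @cplx R)).
Definition disc_int g := Rintegral leb2 (D : set T2) (g \o @cplx R).

Definition cmeasurable f :=
  disc_measurable (fun w => Re (f w)) /\ disc_measurable (fun w => Im (f w)).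
Definition cintegrable f :=
  disc_integrable (fun w => Re (f w)) /\ disc_integrable (fun w => Im (f w)).

Lemma disc_integrable_measurable g : disc_integrable g -> disc_measurable g.
Proof. by move=> /measurable_int/measurable_EFinP. Qed.

Lemma disc_integrable_le g1 g2 : disc_measurable g1 -> disc_integrable g2 ->
  (forall w, Disc w -> `|g1 w| <= g2 w) -> disc_integrable g1.
Proof.
move=> m1 i2 g12; apply: (le_integrable _ _ _ i2) => //.
- exact: measurable_DiscR2.
- exact/measurable_EFinP.
- move=> w Dw /=; rewrite lee_fin; apply: le_trans (g12 _ _) _ => //.
  exact: ler_norm.
Qed.

Lemma disc_integrable_cst (c : R) : disc_integrable (fun=> c).
Proof.
apply: measurable_bounded_integrable.
- exact: measurable_DiscR2.
- exact: leb2_DiscR2_lty.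
- exact: measurable_cst.
- by exists `|c|; split; [exact: num_real|move=> x /ltW + y _].
Qed.

Lemma disc_integrable_bounded g (M : R) : disc_measurable g ->
  (forall w, Disc w -> `|g w| <= M) -> disc_integrable g.
Proof. by move=> mg; apply: disc_integrable_le mg (disc_integrable_cst M). Qed.

Lemma disc_integrableD g1 g2 : disc_integrable g1 -> disc_integrable g2 ->
  disc_integrable (fun w => g1 w + g2 w).
Proof. by move=> i1 i2; have := integrableD measurable_DiscR2 i1 i2; apply. Qed.

Lemma disc_integrableB g1 g2 : disc_integrable g1 -> disc_integrable g2 ->
  disc_integrable (fun w => g1 w - g2 w).
Proof. by move=> i1 i2; have := integrableB measurable_DiscR2 i1 i2; apply. Qed.

Lemma disc_integrableZ (c : R) g : disc_integrable g -> disc_integrable (fun w => c * g w).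
Proof. by move=> i1; have := @integrableZl _ _ _ leb2 _ measurable_DiscR2 c _ i1; apply. Qed.

Lemma disc_intD g1 g2 : disc_integrable g1 -> disc_integrable g2 ->
  disc_int (fun w => g1 w + g2 w) = disc_int g1 + disc_int g2.
Proof. by move=> i1 i2; apply: RintegralD => //; exact: measurable_DiscR2. Qed.

Lemma disc_intB g1 g2 : disc_integrable g1 -> disc_integrable g2 ->
  disc_int (fun w => g1 w - g2 w) = disc_int g1 - disc_int g2.
Proof. by move=> i1 i2; apply: RintegralB => //; exact: measurable_DiscR2. Qed.

Lemma disc_intZ (c : R) g : disc_integrable g ->
  disc_int (fun w => c * g w) = c * disc_int g.
Proof. by move=> i1; apply: RintegralZl => //; exact: measurable_DiscR2. Qed.

Lemma eq_disc_int g1 g2 : (forall w, Disc w -> g1 w = g2 w) -> disc_int g1 = disc_int g2.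
Proof. by move=> H; apply: eq_Rintegral => w /set_mem; exact: H. Qed.

Lemma le_disc_int g1 g2 : disc_integrable g1 -> disc_integrable g2 ->
  (forall w, Disc w -> g1 w <= g2 w) -> disc_int g1 <= disc_int g2.
Proof. by move=> i1 i2 H; apply: le_Rintegral => //; [exact: measurable_DiscR2|move=> w /H]. Qed.

Lemma disc_int_ge0 g : (forall w, Disc w -> 0 <= g w) -> 0 <= disc_int g.
Proof. by move=> H; apply: Rintegral_ge0 => w /H. Qed.

Lemma disc_int_norm_le g1 g2 : disc_integrable g1 -> disc_integrable g2 ->
  (forall w, Disc w -> `|g1 w| <= g2 w) -> `|disc_int g1| <= disc_int g2.
Proof.
move=> i1 i2 H; apply: le_trans (le_normr_Rintegral measurable_DiscR2 i1) _.
apply: le_Rintegral => //; first exact: measurable_DiscR2.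
  exact: (integrable_norm i1).
by move=> w /H.
Qed.

(** This is pi, kept as the positive constant by which [cint] differs from the mean over the
    disc. *)
Definition disc_area : R := fine (leb2 D).

Lemma disc_area_gt0 : 0 < disc_area.
Proof. by rewrite fine_gt0// leb2_DiscR2_gt0 leb2_DiscR2_lty. Qed.

Lemma disc_int_cst (c : R) : disc_int (fun=> c) = c * disc_area.
Proof. exact: (Rintegral_cst _ measurable_DiscR2). Qed.

Lemma disc_dominated_convergence (g_ : nat -> R[i] -> R) (g G : R[i] -> R) :
  (forall n, disc_measurable (g_ n)) -> disc_integrable G ->
  (forall w, Disc w -> g_ ^~ w @ \oo --> g w) ->
  (forall n w, Disc w -> `|g_ n w| <= G w) ->
  disc_integrable g /\ (fun n => disc_int (g_ n)) @ \oo --> disc_int g.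
Proof.
move=> mg iG cg gG.
have mg' : measurable_fun (D : set T2) (EFin \o (g \o @cplx R)).
  apply: (@emeasurable_fun_cvg _ _ _ D (fun n => EFin \o (g_ n \o @cplx R))).
    by move=> n; apply/measurable_EFinP; exact: mg.
  by move=> w Dw /=; apply: cvg_EFin; [exact: nearW|exact: cg].
have [ig _ cvgi] := @dominated_convergence _ _ _ leb2 D measurable_DiscR2
  (fun n => EFin \o (g_ n \o @cplx R)) _ (EFin \o (G \o @cplx R))
  (fun n => (measurable_EFinP _ _).2 (mg n)) mg'
  (ltac:(by apply: aeW => w Dw /=; apply: cvg_EFin; [exact: nearW|exact: cg]))
  iG (ltac:(by apply: aeW => w n Dw /=; rewrite lee_fin; exact: gG)).
split=> //; apply: fine_cvg; rewrite fineK//.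
by apply: integrable_fin_num ig; exact: measurable_DiscR2.
Qed.

Lemma disc_measurable_continuous f : (forall w, Disc w -> {for w, continuous f}) ->
  cmeasurable f.
Proof.
move=> cf; split; apply: measurable_DiscR => w /cf/continuousCP H e /H[d d0 dP];
  exists d => // v /dP; apply: le_lt_trans; [exact: Re_dist_le|exact: Im_dist_le].
Qed.

Lemma cmeasurableM f h : cmeasurable f -> cmeasurable h -> cmeasurable (fun w => f w * h w).
Proof.
move=> [fR fI] [hR hI]; split.
  rewrite /disc_measurable (_ : _ \o _ = (fun w => Re (f (cplx w)) * Re (h (cplx w))
    - Im (f (cplx w)) * Im (h (cplx w)))).
    by apply: measurable_funB; exact: measurable_funM.
  by apply/funext => w; rewrite /= cReM.
rewrite /disc_measurable (_ : _ \o _ = (fun w => Re (f (cplx w)) * Im (h (cplx w))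
  + Im (f (cplx w)) * Re (h (cplx w)))).
  by apply: measurable_funD; exact: measurable_funM.
by apply/funext => w; rewrite /= cImM.
Qed.

Lemma disc_measurable_cabs f : cmeasurable f -> disc_measurable (fun w => cabs (f w)).
Proof.
move=> [mR mI]; rewrite /disc_measurable.
rewrite (_ : _ \o _ = (@Num.sqrt R) \o ((fun w => Re (f (cplx w)) ^+ 2 + Im (f (cplx w)) ^+ 2))).
  apply: measurableT_comp; last by apply: measurable_funD; exact: measurable_funX.
  by apply: continuous_measurable_fun; exact: sqrt_continuous.
by apply/funext => w /=; rewrite cabsE.
Qed.

Lemma cintegrable_le f g : cmeasurable f -> disc_integrable g ->
  (forall w, Disc w -> cabs (f w) <= g w) -> cintegrable f.
Proof.
move=> [mR mI] ig fg; split; apply: disc_integrable_le ig _ => // w /fg; apply: le_trans.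
  exact: Re_le_cabs.
exact: Im_le_cabs.
Qed.

Lemma cintegrable_cmeasurable f : cintegrable f -> cmeasurable f.
Proof. by move=> [/disc_integrable_measurable ? /disc_integrable_measurable]. Qed.

Lemma cintegrable_cabs f : cintegrable f -> disc_integrable (fun w => cabs (f w)).
Proof.
move=> if_; have [iR iI] := if_.
apply: (@disc_integrable_le _ (fun w => `|Re (f w)| + `|Im (f w)|)).
- by apply: disc_measurable_cabs; split; exact: disc_integrable_measurable.
- apply: disc_integrableD; [exact: (integrable_norm iR)|exact: (integrable_norm iI)].
- by move=> w _; rewrite ger0_norm ?cabs_ge0// cabs_le_ReIm.
Qed.

Lemma cintegrableMr f h (M : R) : cmeasurable f -> (forall w, Disc w -> cabs (f w) <= M) ->
  cintegrable h -> cintegrable (fun w => f w * h w).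
Proof.
move=> mf fM ih; have mh := cintegrable_cmeasurable ih.
apply: (cintegrable_le (cmeasurableM mf mh) (disc_integrableZ M (cintegrable_cabs ih))).
by move=> w Dw; rewrite cabsM ler_wpM2r ?cabs_ge0// fM.
Qed.

Lemma cintE f : cint f = Complex (disc_int (fun w => Re (f w))) (disc_int (fun w => Im (f w))).
Proof. by []. Qed.

Lemma eq_cint f h : (forall w, Disc w -> f w = h w) -> cint f = cint h.
Proof.
by move=> H; rewrite !cintE; congr Complex; apply: eq_disc_int => w /H ->.
Qed.

Lemma eq_cintegrable f h : (forall w, Disc w -> f w = h w) -> cintegrable f -> cintegrable h.
Proof.
move=> H [iR iI]; split; [move: iR|move: iI]; apply: eq_integrable => //.
- exact: measurable_DiscR2.
- by move=> w /set_mem Dw /=; rewrite H.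
- exact: measurable_DiscR2.
- by move=> w /set_mem Dw /=; rewrite H.
Qed.

Lemma cintegrableD f h : cintegrable f -> cintegrable h -> cintegrable (fun w => f w + h w).
Proof.
move=> [fR fI] [hR hI]; split.
  by have := disc_integrableD fR hR; congr disc_integrable; apply/funext => w; rewrite cReD.
by have := disc_integrableD fI hI; congr disc_integrable; apply/funext => w; rewrite cImD.
Qed.

Lemma cintegrableZ (c : R[i]) f : cintegrable f -> cintegrable (fun w => c * f w).
Proof.
move=> [fR fI]; split.
  have := disc_integrableB (disc_integrableZ (Re c) fR) (disc_integrableZ (Im c) fI).
  by congr disc_integrable; apply/funext => w; rewrite cReM.
have := disc_integrableD (disc_integrableZ (Re c) fI) (disc_integrableZ (Im c) fR).
by congr disc_integrable; apply/funext => w; rewrite cImM.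
Qed.

Lemma cintZ (c : R[i]) f : cintegrable f -> cint (fun w => c * f w) = c * cint f.
Proof.
move=> [fR fI]; rewrite -[RHS]complex_eta cReM cImM !cintE /=.
rewrite -!disc_intZ// -disc_intB -?disc_intD; try exact: disc_integrableZ.
by congr Complex; congr disc_int; apply/funext => w; rewrite ?cReM ?cImM.
Qed.

Lemma cintD f h : cintegrable f -> cintegrable h ->
  cint (fun w => f w + h w) = cint f + cint h.
Proof.
move=> [fR fI] [hR hI]; rewrite -[RHS]complex_eta cReD cImD !cintE /= -!disc_intD//.
by congr Complex; congr disc_int; apply/funext => w; rewrite ?cReD ?cImD.
Qed.

Lemma cintB f h : cintegrable f -> cintegrable h ->
  cint (fun w => f w - h w) = cint f - cint h.
Proof.
move=> iff ih; rewrite -[- cint h]mulN1r -cintZ// -cintD//; last exact: cintegrableZ.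
by apply: eq_cint => w _; rewrite mulN1r.
Qed.

Lemma cintegrableB f h : cintegrable f -> cintegrable h -> cintegrable (fun w => f w - h w).
Proof.
move=> iff /(cintegrableZ (-1)) ih; have := cintegrableD iff ih.
by apply: eq_cintegrable => w _; rewrite mulN1r.
Qed.

(** The factor 2 comes from bounding the real and imaginary parts separately; it reappears in all
    later constants. *)
Lemma cabs_cint_le f g : cintegrable f -> disc_integrable g ->
  (forall w, Disc w -> cabs (f w) <= g w) -> cabs (cint f) <= 2 * disc_int g.
Proof.
move=> [fR fI] ig fg; apply: le_trans (cabs_le_ReIm _) _.
rewrite cintE /= mulr2n mulrDl mul1r; apply: lerD; apply: disc_int_norm_le => // w /fg;
  apply: le_trans; [exact: Re_le_cabs|exact: Im_le_cabs].
Qed.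

Lemma cint_conj f : cintegrable f -> cint (fun w => conjc (f w)) = conjc (cint f).
Proof.
move=> [fR fI]; rewrite !cintE /= -mulN1r -disc_intZ//.
by congr Complex; apply: eq_disc_int => w _; case: (f w) => a b //=; rewrite mulN1r.
Qed.

Lemma cintegrable_conj f : cintegrable f -> cintegrable (fun w => conjc (f w)).
Proof.
move=> [fR fI]; split.
  by move: fR; congr disc_integrable; apply/funext => w; case: (f w).
have := disc_integrableZ (-1) fI.
by congr disc_integrable; apply/funext => w; case: (f w) => a b; rewrite mulN1r.
Qed.

Lemma cint_real_cst (c : R) : cint (fun=> c%:C%C) = (c * disc_area)%:C%C.
Proof. by rewrite cintE /= !disc_int_cst mul0r. Qed.

Lemma cint_cvg_eq0 (f_ : nat -> R[i] -> R[i]) f g :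
  (forall n, cmeasurable (f_ n)) -> disc_integrable g ->
  (forall w, Disc w -> (fun n => cabs (f_ n w - f w)) @ \oo --> (0 : R)) ->
  (forall n w, Disc w -> cabs (f_ n w) <= g w) ->
  (forall n, cint (f_ n) = 0) -> cint f = 0.
Proof.
move=> mf ig cf fg f0.
have cvgP (p : R[i] -> R) : (forall a b, `|p a - p b| <= cabs (a - b)) ->
    forall w, Disc w -> (fun n => p (f_ n w)) @ \oo --> p (f w).
  move=> pP w Dw; apply/cvgrPdist_le => e e0.
  have /cvgrPdist_le/(_ e e0) := cf w Dw; apply: filterS => n.
  by rewrite sub0r normrN ger0_norm ?cabs_ge0// => H; rewrite distrC (le_trans _ H).
have [_ cR] := disc_dominated_convergence (fun n => (mf n).1) ig (cvgP _ (@Re_dist_le R))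
  (fun n w Dw => le_trans (Re_le_cabs _) (fg n w Dw)).
have [_ cI] := disc_dominated_convergence (fun n => (mf n).2) ig (cvgP _ (@Im_dist_le R))
  (fun n w Dw => le_trans (Im_le_cabs _) (fg n w Dw)).
have zR : (fun n => disc_int (fun w => Re (f_ n w))) = cst 0.
  by apply/funext => n; have := f0 n; rewrite cintE => -[-> _].
have zI : (fun n => disc_int (fun w => Im (f_ n w))) = cst 0.
  by apply/funext => n; have := f0 n; rewrite cintE => -[_ ->].
rewrite zR in cR; rewrite zI in cI; rewrite cintE.
by congr Complex; apply/esym; [exact: (cvg_unique _ (cvg_cst _) cR)|exact: (cvg_unique _ (cvg_cst _) cI)].
Qed.

End AreaIntegralTheory.

(** * Pointwise continuity of real and complex functions on the plane *)

Section ContinuityWrappers.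
Context {R : realType}.
Implicit Types (w : R[i]) (f h : R[i] -> R[i]) (g : R[i] -> R).

Lemma ccontD f h w : {for w, continuous f} -> {for w, continuous h} ->
  {for w, continuous (fun x => f x + h x)}.
Proof. exact: continuousD. Qed.

Lemma ccontN f w : {for w, continuous f} -> {for w, continuous (fun x => - f x)}.
Proof. exact: continuousN. Qed.

Lemma ccontB f h w : {for w, continuous f} -> {for w, continuous h} ->
  {for w, continuous (fun x => f x - h x)}.
Proof. by move=> cf ch; exact: ccontD cf (ccontN ch). Qed.

Lemma ccontM f h w : {for w, continuous f} -> {for w, continuous h} ->
  {for w, continuous (fun x => f x * h x)}.
Proof.
move=> /continuousCP cf /continuousCP ch; apply/continuousCP => e e0.
have f0 := cabs_ge0 (f w); have h0 := cabs_ge0 (h w).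
set K := 1 + cabs (f w) + cabs (h w); have K0 : 0 < K by rewrite /K; lra.
have eK : 0 < e / (2 * K) by rewrite divr_gt0// mulr_gt0.
have [d1 d10 H1] := cf (Num.min 1 (e / (2 * K))) ltac:(by rewrite lt_min ltr01).
have [d2 d20 H2] := ch _ eK.
exists (Num.min d1 d2); first by rewrite lt_min d10.
move=> v; rewrite lt_min => /andP[/H1 + /H2 {}H2]; rewrite lt_min => /andP[{}H1 H3].
have -> : f v * h v - f w * h w = (f v - f w) * h w + f v * (h v - h w) by ring.
have fv : cabs (f v) <= K.
  by have := lerB_cabs (f v) (f w); rewrite /K; lra.
apply: le_lt_trans (cabsD _ _) _; rewrite !cabsM.
have -> : e = e / (2 * K) * K + K * (e / (2 * K)) by field; rewrite gt_eqF.
apply: ler_ltD; last first.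
  by apply: le_lt_trans (ler_wpM2r (cabs_ge0 _) fv) _; rewrite ltr_pM2l.
by apply: ler_pM; rewrite ?cabs_ge0 ?ltW// /K; lra.
Qed.

Lemma ccontV f w : f w != 0 -> {for w, continuous f} ->
  {for w, continuous (fun x => (f x)^-1)}.
Proof.
rewrite -cabs_gt0 => f0 /continuousCP cf; apply/continuousCP => e e0.
have m0 : 0 < Num.min (cabs (f w) / 2) (e * cabs (f w) ^+ 2 / 2).
  by rewrite lt_min !divr_gt0// mulr_gt0// exprn_gt0.
have [d d0 H] := cf _ m0; exists d => // v /H; rewrite lt_min => /andP[H1 H2].
have fv : cabs (f w) / 2 <= cabs (f v).
  by have := lerB_cabs (f w) (f v); rewrite cabs_distC; lra.
have fv0 : 0 < cabs (f v) by apply: lt_le_trans fv; rewrite divr_gt0.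
have -> : (f v)^-1 - (f w)^-1 = (f w - f v) / (f v * f w).
  by field; rewrite -!cabs_gt0 f0 fv0.
rewrite !(cabsM, cabsV) ltr_pdivrMr ?mulr_gt0// cabs_distC; apply: lt_le_trans H2 _.
rewrite -mulrA ler_wpM2l ?(ltW e0)// expr2 mulrAC; apply: ler_wpM2r => //.
exact: ltW.
Qed.

Lemma ccont_cst (c : R[i]) w : {for w, continuous (fun=> c)}.
Proof. exact: cst_continuous. Qed.

Lemma ccont_id w : {for w, continuous (fun x : R[i] => x)}.
Proof. by apply/continuousCP => e e0; exists e. Qed.

Lemma ccont_conj f w : {for w, continuous f} -> {for w, continuous (fun x => conjc (f x))}.
Proof.
move=> /continuousCP H; apply/continuousCP => e /H[d d0 dP]; exists d => // v /dP.
by rewrite -cabs_conj rmorphB.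
Qed.

Lemma ccont_near f h w (d : R) : 0 < d -> (forall x, cabs (x - w) < d -> f x = h x) ->
  {for w, continuous f} -> {for w, continuous h}.
Proof.
move=> d0 fh /continuousCP H; apply/continuousCP => e /H[d1 d10 dP].
exists (Num.min d d1); rewrite ?lt_min ?d0// => v; rewrite lt_min => /andP[vd vd1].
by rewrite -!fh ?subrr ?cabs0//; exact: dP.
Qed.

Lemma rcontCP g w : {for w, continuous g} <->
  forall e : R, 0 < e -> exists2 d : R, 0 < d &
    forall v, cabs (v - w) < d -> `|g v - g w| < e.
Proof.
split=> [gw e e0|H].
  have /nbhsCP[d d0 dP] : nbhs w (g @^-1` ball (g w) e) := gw _ (nbhsx_ballx _ _ e0).
  by exists d => // v /dP; rewrite distrC.
move=> A /nbhs_ballP[e /= /H[d d0 dP] eA]; apply/nbhsCP; exists d => // v /dP.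
by rewrite distrC => /eA.
Qed.

Lemma rcont_cabs f w : {for w, continuous f} -> {for w, continuous (fun x => cabs (f x))}.
Proof.
move=> /continuousCP H; apply/rcontCP => e /H[d d0 dP]; exists d => // v /dP.
apply: le_lt_trans; rewrite ler_norml lerB_cabs andbT lerNl opprB cabs_distC.
exact: lerB_cabs.
Qed.

Lemma rcont_cst (c : R) w : {for w, continuous (fun=> c)}.
Proof. exact: cst_continuous. Qed.

Lemma rcontD g1 g2 w : {for w, continuous g1} -> {for w, continuous g2} ->
  {for w, continuous (fun x => g1 x + g2 x)}.
Proof. exact: continuousD. Qed.

Lemma rcontB g1 g2 w : {for w, continuous g1} -> {for w, continuous g2} ->
  {for w, continuous (fun x => g1 x - g2 x)}.
Proof. exact: continuousB. Qed.

Lemma rcontM g1 g2 w : {for w, continuous g1} -> {for w, continuous g2} ->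
  {for w, continuous (fun x => g1 x * g2 x)}.
Proof. by move=> c1 c2; exact: (@continuousM R R[i] g1 g2 w). Qed.

Lemma rcontX g n w : {for w, continuous g} -> {for w, continuous (fun x => g x ^+ n)}.
Proof. 
move=> cg; elim: n => [|n IH]; first exact: rcont_cst.
have -> : (fun x => g x ^+ n.+1) = (fun x => g x * g x ^+ n) by apply/funext => x; rewrite exprS.
exact: rcontM.
Qed.

Lemma rcontV g w : g w != 0 -> {for w, continuous g} ->
  {for w, continuous (fun x => (g x)^-1)}.
Proof. by move=> g0 cg; exact: (@continuousV R R[i] g w). Qed.

Lemma rcont_max g1 g2 w : {for w, continuous g1} -> {for w, continuous g2} ->
  {for w, continuous (fun x => Num.max (g1 x) (g2 x))}.
Proof. by move=> c1 c2; exact: (@continuous_max _ _ g1 g2 w). Qed.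

Lemma ccont_real g w : {for w, continuous g} -> {for w, continuous (fun x => (g x)%:C%C)}.
Proof.
move=> /rcontCP H; apply/continuousCP => e /H[d d0 dP]; exists d => // v /dP.
by rewrite -rmorphB/= cabs_real.
Qed.

Lemma rcont_comp (k : R -> R) g w : {for w, continuous g} -> {for g w, continuous k} ->
  {for w, continuous (fun x => k (g x))}.
Proof. by move=> cg ck; exact: continuous_comp. Qed.

End ContinuityWrappers.

(** * The Bergman kernel and its reproducing formula *)

Section Cutoffs.
Context {R : realType}.
Implicit Types e t s d : R.

(** Equal to (t - e)^2 / t for t >= e and to 0 below: the double zero at [e] makes it C^1, and it
    tends to t, with derivative tending to 1, as e tends to 0. The maximum joins both branches in
    one formula, from which continuity is immediate. *)
Definition cutoff e t : R := Num.max t e - 2 * e + e ^+ 2 / Num.max t e.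
Definition cutoff' e t : R := 1 - e ^+ 2 / Num.max t e ^+ 2.

Lemma quadratic_derivative (g : R -> R) (g' C t : R) : 0 < C ->
  (forall s, `|g s - g t - g' * (s - t)| <= C * (s - t) ^+ 2) ->
  forall e : R, 0 < e -> exists2 d : R, 0 < d & forall s, `|s - t| < d ->
     `|g s - g t - g' * (s - t)| <= e * `|s - t|.
Proof.
move=> C0 H e e0; exists (e / C); first by rewrite divr_gt0.
move=> s sd; apply: le_trans (H s) _.
rewrite -(real_normK (num_real (s - t))) expr2 mulrA ler_wpM2r// mulrC -ler_pdivlMr//.
exact: ltW.
Qed.

Lemma cutoff0 e t : 0 < e -> t <= e -> cutoff e t = 0.
Proof. by move=> e0 te; rewrite /cutoff max_r//; field; rewrite gt_eqF. Qed.

Lemma cutoff'0 e t : 0 < e -> t <= e -> cutoff' e t = 0.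
Proof. by move=> e0 te; rewrite /cutoff' max_r//; field; rewrite gt_eqF. Qed.

Lemma cutoff_ge0 e t : 0 < e -> e <= t -> cutoff e t = (t - e) ^+ 2 / t.
Proof.
move=> e0 te; rewrite /cutoff max_l//; field; rewrite gt_eqF//.
exact: lt_le_trans te.
Qed.

Lemma cutoff'_bound e t : 0 < e -> `|cutoff' e t| <= 1.
Proof.
move=> e0; rewrite /cutoff'; set m := Num.max t e.
have em : e <= m by rewrite le_max lexx orbT.
have m0 : 0 < m := lt_le_trans e0 em.
have H1 : e ^+ 2 / m ^+ 2 <= 1 by rewrite ler_pdivrMr ?exprn_gt0// mul1r ler_sqr ?nnegrE ?(ltW e0) ?(ltW m0).
have H2 : 0 <= e ^+ 2 / m ^+ 2 by rewrite divr_ge0// exprn_ge0// ltW.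
rewrite ler_norml; lra.
Qed.

Lemma cutoff_bound e t : 0 < e -> t <= 1 -> `|cutoff e t| <= 1.
Proof.
move=> e0 t1; have [te|/ltW te] := leP t e; first by rewrite cutoff0// normr0.
have t0 : 0 < t := lt_le_trans e0 te.
rewrite cutoff_ge0// ger0_norm; last by rewrite divr_ge0 ?sqr_ge0// ltW.
rewrite ler_pdivrMr// mul1r; nra.
Qed.

(** The second derivative is 0 below [e] and 2 e^2 / t^3 <= 2 / e above. It jumps at [e], so the
    four positions of [s] and [t] are treated by explicit algebra. *)
Lemma cutoff_quad e t s : 0 < e ->
  `|cutoff e s - cutoff e t - cutoff' e t * (s - t)| <= 2 / e * (s - t) ^+ 2.
Proof.
move=> e0; have b0 : 0 <= (s - t) ^+ 2 by exact: sqr_ge0.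
have [te|/ltW te] := leP t e; have [se|/ltW se] := leP s e.
- rewrite !cutoff0// cutoff'0// mul0r !subr0 normr0 mulr_ge0// divr_ge0// ltW//.
- have s0 : 0 < s := lt_le_trans e0 se.
  rewrite (cutoff0 e0 te) cutoff'0// mul0r !subr0 cutoff_ge0//.
  rewrite ger0_norm; last by rewrite divr_ge0 ?sqr_ge0// ltW.
  apply: (@le_trans _ _ ((s - t) ^+ 2 / e)).
    apply: ler_pM; rewrite ?sqr_ge0 ?invr_ge0 ?(ltW s0)//; first by rewrite !expr2; nra.
    by rewrite lef_pV2.
  by rewrite mulrC; apply: ler_wpM2r => //; rewrite -[leLHS]mul1r ler_pM2r ?invr_gt0//; lra.
- have t0 : 0 < t := lt_le_trans e0 te.
  rewrite (cutoff0 e0 se) cutoff_ge0// /cutoff' max_l//.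
  have -> : 0 - (t - e) ^+ 2 / t - (1 - e ^+ 2 / t ^+ 2) * (s - t) =
     ((t - e) * (t + e) * (t - s) - (t - e) ^+ 2 * t) / t ^+ 2 by field; rewrite gt_eqF.
  rewrite normrM normfV (ger0_norm (sqr_ge0 t)) ler_pdivrMr ?exprn_gt0//.
  have -> : 2 / e * (s - t) ^+ 2 * t ^+ 2 = (s - t) ^+ 2 * (2 * t ^+ 2) / e by ring.
  rewrite ler_pdivlMr//.
  have H1 : 0 <= t - e by lra.
  have H2 : t - e <= t - s by lra.
  have P1 : (t - e) * (t + e) * (t - s) * e <= (t - s) ^+ 2 * (2 * t ^+ 2).
    have : (t - e) * (t - s) <= (t - s) * (t - s) by rewrite ler_wpM2r//; lra.
    have : (t + e) * e <= 2 * t ^+ 2 by nra.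
    move=> K1 K2; have := ler_pM _ _ K2 K1; rewrite !expr2 => KK.
    have := KK ltac:(by rewrite mulr_ge0//; lra) ltac:(by rewrite mulr_ge0//; lra); lra.
  have P2 : 0 <= (t - e) * (t + e) * (t - s) * e by rewrite !mulr_ge0//; lra.
  have P3 : (t - e) ^+ 2 * t * e <= (t - s) ^+ 2 * (2 * t ^+ 2).
    have : (t - e) ^+ 2 <= (t - s) ^+ 2 by rewrite !expr2; nra.
    have : t * e <= 2 * t ^+ 2 by nra.
    move=> K1 K2; have := ler_pM _ _ K2 K1 => KK.
    have := KK (sqr_ge0 _) ltac:(by rewrite mulr_ge0//; lra); lra.
  have P4 : 0 <= (t - e) ^+ 2 * t * e by rewrite !mulr_ge0 ?sqr_ge0//; lra.
  have -> : `|(t - e) * (t + e) * (t - s) - (t - e) ^+ 2 * t| * e =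
    `|(t - e) * (t + e) * (t - s) * e - (t - e) ^+ 2 * t * e|.
    by rewrite -mulrBl normrM (gtr0_norm e0).
  rewrite ler_norml -[(s - t) ^+ 2]sqrrN opprB; lra.
- have t0 : 0 < t := lt_le_trans e0 te; have s0 : 0 < s := lt_le_trans e0 se.
  rewrite !cutoff_ge0// /cutoff' max_l//.
  have -> : (s - e) ^+ 2 / s - (t - e) ^+ 2 / t - (1 - e ^+ 2 / t ^+ 2) * (s - t) =
     e ^+ 2 / (t ^+ 2 * s) * (s - t) ^+ 2 by field; rewrite !gt_eqF.
  have k0 : 0 < t ^+ 2 * s by rewrite mulr_gt0// exprn_gt0.
  rewrite ger0_norm; last by rewrite mulr_ge0// divr_ge0// ?sqr_ge0// ltW.
  apply: ler_wpM2r => //; rewrite ler_pdivrMr// mulrAC ler_pdivlMr//.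
  have : e * e <= t ^+ 2 by rewrite expr2; nra.
  move=> K; have := ler_pM _ _ K se; rewrite (mulr_ge0 (ltW e0) (ltW e0)) (ltW e0) => /(_ isT isT).
  rewrite expr2; lra.
Qed.

(* [conj w * cauchy_reg d (|w|^2)] is a C^1 regularization of the kernel [1/w],
   equal to it as soon as [d <= |w|^2]. *)
Definition cauchy_reg d s : R := (Num.max s d)^-1 + (Num.max s d - s) / d ^+ 2.
Definition cauchy_reg' d s : R := - (Num.max s d ^+ 2)^-1.

(** Below [d] the function [cauchy_reg d] is the tangent line at [d] of 1/s, so its second
    derivative is 0 there and 2 / s^3 <= 2 / d^3 beyond. *)
Lemma cauchy_reg_quad d t s : 0 < d ->
  `|cauchy_reg d s - cauchy_reg d t - cauchy_reg' d t * (s - t)| <= 2 / d ^+ 3 * (s - t) ^+ 2.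
Proof.
move=> d0; have b0 : 0 <= (s - t) ^+ 2 by exact: sqr_ge0.
have dn : d != 0 by rewrite gt_eqF.
have d30 : 0 < d ^+ 3 by rewrite exprn_gt0.
rewrite /cauchy_reg /cauchy_reg' mulrAC ler_pdivlMr//.
have [td|/ltW td] := leP t d; have [sd|/ltW sd] := leP s d.
- have -> : d^-1 + (d - s) / d ^+ 2 - (d^-1 + (d - t) / d ^+ 2) - - (d ^+ 2)^-1 * (s - t) = 0.
    by field.
  by rewrite normr0 mul0r mulr_ge0.
- have s0 : 0 < s := lt_le_trans d0 sd.
  have -> : s^-1 + (s - s) / d ^+ 2 - (d^-1 + (d - t) / d ^+ 2) - - (d ^+ 2)^-1 * (s - t) =
     (s - d) ^+ 2 / (s * d ^+ 2) by field; rewrite dn gt_eqF.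
  have sd0 : 0 < s * d ^+ 2 by rewrite mulr_gt0// exprn_gt0.
  rewrite ger0_norm; last by rewrite divr_ge0 ?sqr_ge0// ltW.
  have -> : (s - d) ^+ 2 / (s * d ^+ 2) * d ^+ 3 = (s - d) ^+ 2 * (d / s).
    by field; rewrite dn gt_eqF.
  have H : d / s <= 1 by rewrite ler_pdivrMr// mul1r.
  have : (s - d) ^+ 2 <= (s - t) ^+ 2 by rewrite !expr2; nra.
  move=> K; have := ler_pM (sqr_ge0 _) _ K H; rewrite divr_ge0 ?(ltW d0) ?(ltW s0)// => /(_ isT).
  lra.
- have t0 : 0 < t := lt_le_trans d0 td.
  have -> : d^-1 + (d - s) / d ^+ 2 - (t^-1 + (t - t) / d ^+ 2) - - (t ^+ 2)^-1 * (s - t) =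
    (t - d) * ((d - s) / (d ^+ 2 * t) + (t - s) / (d * t ^+ 2)) by field; rewrite dn gt_eqF.
  have dt0 : 0 < d / t by rewrite divr_gt0.
  have H : d / t <= 1 by rewrite ler_pdivrMr// mul1r.
  have ge1 : 0 <= (d - s) / (d ^+ 2 * t) by rewrite divr_ge0 ?mulr_ge0 ?exprn_ge0 ?(ltW d0) ?(ltW t0)//; lra.
  have ge2 : 0 <= (t - s) / (d * t ^+ 2) by rewrite divr_ge0 ?mulr_ge0 ?exprn_ge0 ?(ltW d0) ?(ltW t0)//; lra.
  rewrite ger0_norm; last by apply: mulr_ge0; [lra|exact: addr_ge0].
  have -> : (t - d) * ((d - s) / (d ^+ 2 * t) + (t - s) / (d * t ^+ 2)) * d ^+ 3 =
     (t - d) * ((d - s) * (d / t) + (t - s) * (d / t) * (d / t)) by field; rewrite dn gt_eqF.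
  have K1 : (d - s) * (d / t) <= t - s by nra.
  have K0 : (t - s) * (d / t) <= t - s by nra.
  have K2 : (t - s) * (d / t) * (d / t) <= t - s.
    by apply: le_trans K0; rewrite -[leRHS]mulr1; apply: ler_wpM2l => //; apply: mulr_ge0; lra.
  have : (t - d) * ((d - s) * (d / t) + (t - s) * (d / t) * (d / t)) <= (t - s) * (2 * (t - s)).
    apply: ler_pM; try lra.
    by apply: addr_ge0; [apply: mulr_ge0; lra|apply: mulr_ge0; [apply: mulr_ge0; lra|lra]].
  rewrite expr2; lra.
- have t0 : 0 < t := lt_le_trans d0 td; have s0 : 0 < s := lt_le_trans d0 sd.
  have -> : s^-1 + (s - s) / d ^+ 2 - (t^-1 + (t - t) / d ^+ 2) - - (t ^+ 2)^-1 * (s - t) =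
    (s - t) ^+ 2 / (t ^+ 2 * s) by field; rewrite dn !gt_eqF.
  have ts0 : 0 < t ^+ 2 * s by rewrite mulr_gt0// exprn_gt0.
  rewrite ger0_norm; last by rewrite divr_ge0// ltW.
  rewrite mulrAC ler_pdivrMr//.
  have -> : 2 * (s - t) ^+ 2 * (t ^+ 2 * s) = (s - t) ^+ 2 * (2 * (t ^+ 2 * s)) by ring.
  apply: ler_wpM2l => //.
  have : d ^+ 2 <= t ^+ 2 by rewrite !expr2; nra.
  move=> K; have := ler_pM (sqr_ge0 _) (ltW d0) K sd; rewrite -exprSr; lra.
Qed.

End Cutoffs.

Section BergmanKernel.
Context {R : realType}.
Implicit Types a z h : R[i].

(** With p = 1 - a z and q = p - a h the remainder is exactly (a h)^2 (p^-2 q^-2 + 2 p^-3 q^-1).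
    Since |p| >= c and |q| >= c/2, each of the two terms in the bracket is at most 4 / c^4. The
    bound is uniform in [a], which allows differentiation under the integral. *)
Lemma kernel_taylor a z h (c : R) : 0 < c -> cabs a <= 1 -> c <= cabs (1 - a * z) ->
  cabs h <= c / 2 ->
  cabs ((1 - a * (z + h)) ^- 2 - (1 - a * z) ^- 2 - 2 * a / (1 - a * z) ^+ 3 * h)
    <= 8 / c ^+ 4 * cabs h ^+ 2.
Proof.
move=> c0 a1 cz hc; set p := 1 - a * z; set q := 1 - a * (z + h).
have qE : q = p - a * h by rewrite /p /q; ring.
have p0 : 0 < cabs p := lt_le_trans c0 cz.
have ah : cabs (a * h) <= cabs h by rewrite cabsM ler_piMl ?cabs_ge0.
have cq : c / 2 <= cabs q.
  by rewrite qE; have := lerB_cabs p (a * h); move: cz ah hc; rewrite -/p; lra.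
have q0 : 0 < cabs q by apply: lt_le_trans cq; rewrite divr_gt0.
have p0' : p != 0 by rewrite -cabs_gt0.
have q0' : q != 0 by rewrite -cabs_gt0.
have -> : q ^- 2 - p ^- 2 - 2 * a / p ^+ 3 * h =
  (a * h) ^+ 2 * (p ^- 2 * q ^- 2 + 2 * (p ^- 3 * q^-1)).
  have hE : a * h = p - q by rewrite qE; ring.
  rewrite -mulrA [_^-1 * h]mulrC !mulrA -[2 * a * h]mulrA hE; field.
  by rewrite p0' q0'.
rewrite cabsM mulrC cabsX; apply: ler_pM; rewrite ?cabs_ge0 ?exprn_ge0 ?cabs_ge0//; last first.
  by rewrite ler_sqr ?nnegrE ?cabs_ge0.
have ip : (cabs p)^-1 <= c^-1 by rewrite lef_pV2.
have iq : (cabs q)^-1 <= 2 / c by rewrite -[2 / c]invf_div lef_pV2// posrE divr_gt0.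
have ip0 : 0 <= (cabs p)^-1 by rewrite invr_ge0 cabs_ge0.
have iq0 : 0 <= (cabs q)^-1 by rewrite invr_ge0 cabs_ge0.
have ic0 : 0 <= c^-1 by rewrite invr_ge0 ltW.
apply: le_trans (cabsD _ _) _; rewrite !cabsM cabs2 -!exprVn !cabsX !cabsV.
have P2 n : (cabs p)^-1 ^+ n <= c^-1 ^+ n by apply: lerXn2r; rewrite ?nnegrE.
have Q2 : (cabs q)^-1 ^+ 2 <= (2 / c) ^+ 2 by apply: lerXn2r; rewrite ?nnegrE ?divr_ge0// ltW.
have -> : 8 * c^-1 ^+ 4 = c^-1 ^+ 2 * (2 / c) ^+ 2 + 2 * (c^-1 ^+ 3 * (2 / c)).
  by field; rewrite gt_eqF.
apply: lerD; first by apply: ler_pM; rewrite ?exprn_ge0.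
by rewrite ler_pM2l//; apply: ler_pM; rewrite ?exprn_ge0.
Qed.

End BergmanKernel.

Section KernelFactor.
Context {R : realType}.
Implicit Types a z w h : R[i].

Lemma sub1M_lower a w : cabs a <= 1 -> 1 - cabs w <= cabs (1 - a * w).
Proof.
move=> a1; have := lerB_cabs 1 (a * w); rewrite cabs1 cabsM.
have : cabs a * cabs w <= cabs w by rewrite ler_piMl ?cabs_ge0.
lra.
Qed.

Lemma conj_kernelE z w : 1 - conjc z * w = conjc (1 - z * conjc w).
Proof. by rewrite rmorphB rmorphM rmorph1 /= conjcK. Qed.

Lemma kernel_lower_l z w : Disc w -> 1 - cabs z <= cabs (1 - z * conjc w).
Proof.
move=> /ltW w1; rewrite [z * _]mulrC; apply: sub1M_lower.
by rewrite cabs_conj.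
Qed.

Lemma kernel_lower_r z w : Disc z -> 1 - cabs w <= cabs (1 - z * conjc w).
Proof. by move=> /ltW z1; rewrite -(cabs_conj w); apply: sub1M_lower. Qed.

Lemma kernel_neq0 z w : Disc z -> Disc w -> 1 - z * conjc w != 0.
Proof.
move=> z1 w1; rewrite -cabs_gt0; apply: lt_le_trans (kernel_lower_l z w1).
by rewrite subr_gt0.
Qed.

Lemma wirtinger_quad (u : R[i] -> R[i]) w A B (c C : R) : 0 < c -> 0 < C ->
  (forall h, cabs h <= c -> cabs (u (w + h) - u w - A * h - B * conjc h) <= C * cabs h ^+ 2) ->
  wirtinger u w A B.
Proof.
move=> c0 C0 H e e0; exists (Num.min c (e / C)); first by rewrite lt_min c0 divr_gt0.
move=> h; rewrite lt_min ltr_pdivlMr// => /andP[/ltW/H hc he]; apply: le_trans hc _.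
by rewrite expr2 mulrA ler_wpM2r ?cabs_ge0// mulrC ltW.
Qed.

Lemma wirtinger_inv_kernel a w (c : R) : 0 < c -> cabs a <= 1 -> c <= cabs (1 - a * w) ->
  wirtinger (fun x => (1 - a * x)^-1) w (a / (1 - a * w) ^+ 2) 0.
Proof.
move=> c0 a1 cz.
apply: (@wirtinger_quad _ _ _ _ (c / 2) (2 / c ^+ 3)); rewrite ?divr_gt0 ?exprn_gt0// => h hc.
set p := 1 - a * w; set q := 1 - a * (w + h).
have qE : q = p - a * h by rewrite /p /q; ring.
have p0 : 0 < cabs p := lt_le_trans c0 cz.
have ah : cabs (a * h) <= cabs h by rewrite cabsM ler_piMl ?cabs_ge0.
have cq : c / 2 <= cabs q.
  by rewrite qE; have := lerB_cabs p (a * h); move: cz ah hc; rewrite -/p; lra.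
have q0 : 0 < cabs q by apply: lt_le_trans cq; rewrite divr_gt0.
have p0' : p != 0 by rewrite -cabs_gt0.
have q0' : q != 0 by rewrite -cabs_gt0.
have -> : q^-1 - p^-1 - a / p ^+ 2 * h - 0 * conjc h = (a * h) ^+ 2 * (p ^- 2 * q^-1).
  have hE : a * h = p - q by rewrite qE; ring.
  rewrite -mulrA [_^-1 * h]mulrC !mulrA hE; field.
  by rewrite p0' q0'.
rewrite cabsM mulrC cabsX; apply: ler_pM; rewrite ?cabs_ge0 ?exprn_ge0 ?cabs_ge0//; last first.
  by rewrite ler_sqr ?nnegrE ?cabs_ge0.
have ip : (cabs p)^-1 <= c^-1 by rewrite lef_pV2.
have iq : (cabs q)^-1 <= 2 / c by rewrite -[2 / c]invf_div lef_pV2// posrE divr_gt0.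
rewrite !cabsM -!exprVn !cabsX !cabsV.
have -> : 2 * c^-1 ^+ 3 = c^-1 ^+ 2 * (2 / c) by field; rewrite gt_eqF.
apply: ler_pM; rewrite ?exprn_ge0 ?invr_ge0 ?cabs_ge0//.
by apply: lerXn2r; rewrite ?nnegrE ?invr_ge0 ?cabs_ge0// ltW.
Qed.

Lemma derivable_kernel a w (c : R) : 0 < c -> cabs a <= 1 -> c <= cabs (1 - a * w) ->
  derivable (fun x => (1 - a * x) ^- 2) w 1 /\
  'D_1 (fun x => (1 - a * x) ^- 2) w = 2 * a / (1 - a * w) ^+ 3.
Proof.
move=> c0 a1 cz; apply: derivableCP.
have H : wirtinger (fun x => (1 - a * x) ^- 2) w (2 * a / (1 - a * w) ^+ 3) 0.
  apply: (@wirtinger_quad _ _ _ _ (c / 2) (8 / c ^+ 4)); rewrite ?divr_gt0 ?exprn_gt0// => h hc.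
  by rewrite mul0r subr0; exact: kernel_taylor.
by move=> e /H[d d0 dP]; exists d => // h /dP; rewrite mul0r subr0.
Qed.

Definition boundary_defect (w : R[i]) : R := 1 - cabs w ^+ 2.
(** Its square is the Bergman kernel for the normalized area measure. *)
Definition inv_kernel (z w : R[i]) : R[i] := (1 - z * conjc w)^-1.
Definition diff_quotient (k : R[i] -> R[i]) (z w : R[i]) : R[i] :=
  if w == z then 'D_1 k z else (k w - k z) / (w - z).

(* The product of [cut_kernel z e] with a function holomorphic off [z] has
   [cut_kernel_dbar z e] as its conj-derivative factor; as [e] tends to [0] the
   latter tends to [- (w - z) / (1 - z * conj w) ^ 2]. *)
Definition cut_kernel (z : R[i]) (e : R) (w : R[i]) : R[i] :=
  (cutoff e (boundary_defect w))%:C%C * inv_kernel z w.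
Definition cut_kernel_dbar (z : R[i]) (e : R) (w : R[i]) : R[i] :=
  (cutoff' e (boundary_defect w))%:C%C * (- w) * inv_kernel z w
  + (cutoff e (boundary_defect w))%:C%C * (z * inv_kernel z w ^+ 2).

End KernelFactor.

(** * Reproducing formula by Green's formula with a cutoff and a regularized pole *)

Section Reproducing.
Context {R : realType}.
Variables (k : R[i] -> R[i]) (z : R[i]).
Hypotheses (hk : holo_disc k) (ik : disc_integrable (fun w => cabs (k w))) (Dz : Disc z).
Implicit Types w : R[i].

Notation psi := (inv_kernel z).
Notation T := boundary_defect.
Notation kappa := (diff_quotient k z).
Let M0 : R := (1 - cabs z)^-1.

Let M0_gt0 : 0 < M0. Proof. by rewrite invr_gt0 subr_gt0. Qed.

Let psi_bound w : Disc w -> cabs (psi w) <= M0.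
Proof.
move=> Dw; rewrite cabsV lef_pV2 ?posrE ?subr_gt0//; first exact: kernel_lower_l.
by rewrite cabs_gt0 kernel_neq0.
Qed.

(** As a function of [w], [psi] is the conjugate of the holomorphic function 1 / (1 - conj z * w),
    so only its conj-derivative survives. *)
Let wirtinger_psi w : Disc w -> wirtinger psi w 0 (z * psi w ^+ 2).
Proof.
move=> Dw.
have c0 : 0 < 1 - cabs z by rewrite subr_gt0.
have H : wirtinger (fun x => (1 - conjc z * x)^-1) w (conjc z / (1 - conjc z * w) ^+ 2) 0.
  apply: (wirtinger_inv_kernel c0); rewrite ?cabs_conj ?(ltW Dz)//.
  by rewrite conj_kernelE cabs_conj kernel_lower_l.
have := wirtinger_conj H; rewrite conjc0.
have -> : conjc (conjc z / (1 - conjc z * w) ^+ 2) = z * psi w ^+ 2.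
  by rewrite conj_kernelE rmorphM fmorphV rmorphXn /= !conjcK /inv_kernel exprVn.
apply: (@wirtinger_near _ _ _ _ _ _ 1) => // x _.
by rewrite conj_kernelE fmorphV /= conjcK.
Qed.

Let wirtinger_T w : wirtinger (fun x => (T x)%:C%C) w (- conjc w) (- w).
Proof.
have := wirtingerB (wirtinger_cst 1 w) (wirtinger_sqr_dist 0 w).
rewrite subr0 !sub0r; apply: (@wirtinger_near _ _ _ _ _ _ 1) => // x _.
by rewrite subr0 /boundary_defect rmorphB rmorph1.
Qed.

Let cont_T w : {for w, continuous T}.
Proof.
by apply: rcontB; [exact: rcont_cst|apply: rcontX; apply: rcont_cabs; exact: ccont_id].
Qed.

Let kappaE w : k w - k z = kappa w * (w - z).
Proof.
by rewrite /diff_quotient; case: eqVneq => [->|wz]; rewrite ?subrr ?mulr0// divfK// subr_eq0.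
Qed.

Let cont_psi w : Disc w -> {for w, continuous psi}.
Proof. by move=> Dw; exact: wirtinger_continuous (wirtinger_psi Dw). Qed.

Let cont_k w : Disc w -> {for w, continuous k}.
Proof. by move=> Dw; exact: derivable_continuousC (hk Dw). Qed.

Let max_neq0 (t d : R) : 0 < d -> Num.max t d != 0.
Proof. by move=> d0; rewrite gt_eqF// lt_max d0 orbT. Qed.

Let cont_kappa w : Disc w -> {for w, continuous kappa}.
Proof.
move=> Dw; have [->|wz] := eqVneq w z.
  apply/continuousCP => eps eps0; rewrite {2}/diff_quotient eqxx.
  have [d d0 dP] := derivableC (hk Dz) (divr_gt0 eps0 (ltr0Sn _ 1)).
  exists d => // v vd; rewrite /diff_quotient; case: eqVneq => [_|vz]; first by rewrite subrr cabs0.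
  have vz0 : v - z != 0 by rewrite subr_eq0.
  have -> : (k v - k z) / (v - z) - 'D_1 k z = (k v - k z - 'D_1 k z * (v - z)) / (v - z) by field.
  rewrite cabsM cabsV ltr_pdivrMr ?cabs_gt0//.
  have := dP _ vd; rewrite subrKC => /le_lt_trans; apply.
  by rewrite ltr_pM2r ?cabs_gt0//; lra.
have d0 : 0 < cabs (w - z) by rewrite cabs_gt0 subr_eq0.
have wz0 : w - z != 0 by rewrite subr_eq0.
have H : {for w, continuous (fun x => (k x - k z) / (x - z))}.
  apply: ccontM; first by apply: ccontB; [exact: cont_k|exact: ccont_cst].
  by apply: ccontV => //; apply: ccontB; [exact: ccont_id|exact: ccont_cst].
apply: ccont_near d0 _ H => x xw; rewrite /diff_quotient; case: eqVneq => // xz.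
by move: xw; rewrite xz cabs_distC ltxx.
Qed.

(** Near [z] the quotient is bounded by differentiability of [k]; at distance [dl] or more the
    denominator is bounded below. Hence the quotient is integrable when [k] is. *)
Lemma diff_quotient_bound : exists L dl : R, [/\ 0 < dl,
  (forall w, cabs (w - z) < dl -> cabs (kappa w) <= L) &
  (forall w, cabs (kappa w) <= L + (cabs (k w) + cabs (k z)) / dl)].
Proof.
have [dl dl0 H] := wirtinger_bound (wirtinger_derivable (hk Dz)).
set L := 1 + cabs _ + _ in H; exists L, dl.
have L0 : 0 <= L by rewrite /L !addr_ge0 ?cabs_ge0.
have near w : cabs (w - z) < dl -> cabs (kappa w) <= L.
  move=> wz; rewrite /diff_quotient; case: eqVneq => [_|].
    by rewrite /L; have := cabs_ge0 (0 : R[i]); lra.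
  rewrite -subr_eq0 -cabs_gt0 => wz0; rewrite cabsM cabsV ler_pdivrMr//.
  by have := H _ wz; rewrite subrKC.
split=> // w; have [/near wz|far] := ltP (cabs (w - z)) dl.
  by apply: le_trans wz _; rewrite lerDl divr_ge0 ?addr_ge0 ?cabs_ge0// ltW.
rewrite /diff_quotient; case: eqVneq => [wz|wz].
  by move: far; rewrite wz subrr cabs0 leNgt dl0.
have wz0 : 0 < cabs (w - z) := lt_le_trans dl0 far.
rewrite cabsM cabsV; apply: (@le_trans _ _ ((cabs (k w) + cabs (k z)) / dl)); last by rewrite lerDr.
apply: ler_pM; rewrite ?invr_ge0 ?cabs_ge0//; first exact: cabsB.
by rewrite lef_pV2.
Qed.

Lemma integrable_diff_quotient : disc_integrable (fun w => cabs (kappa w)).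
Proof.
have [L [dl [dl0 _ H]]] := diff_quotient_bound.
have i1 : disc_integrable (fun w => L + dl^-1 * (cabs (k w) + cabs (k z))).
  apply: disc_integrableD; first exact: disc_integrable_cst.
  by apply: disc_integrableZ; apply: disc_integrableD => //; exact: disc_integrable_cst.
apply: disc_integrable_le i1 _.
  apply: (@disc_measurable_cabs _ kappa); apply: disc_measurable_continuous.
  by move=> w; exact: cont_kappa.
by move=> w _; rewrite ger0_norm ?cabs_ge0// mulrC.
Qed.

Section Cut.
Variable e : R.
Hypotheses (e0 : 0 < e) (e1 : e <= 1).

Notation cut := (cut_kernel z e).
Notation Bcut := (cut_kernel_dbar z e).

Let wirtinger_cut w : Disc w -> exists A, wirtinger cut w A (Bcut w).
Proof.
move=> Dw; eexists.
have H := wirtinger_real_comp (quadratic_derivative (divr_gt0 (ltr0Sn _ 1) e0)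
  (fun s => cutoff_quad (T w) s e0)) (wirtinger_T w).
exact: (wirtingerM H (wirtinger_psi Dw)).
Qed.

Let Tle1 w : T w <= 1. Proof. by rewrite /boundary_defect gerBl sqr_ge0. Qed.

Let cut_bound w : Disc w -> cabs (cut w) <= M0.
Proof.
move=> Dw; rewrite cabsM cabs_real -[M0]mul1r; apply: ler_pM; rewrite ?cabs_ge0//.
  exact: cutoff_bound.
exact: psi_bound.
Qed.

(** Independent of [e]: this gives the dominating function when the cutoff is removed. *)
Lemma cut_kernel_dbar_bound w : Disc w -> cabs (Bcut w) <= M0 + M0 ^+ 2.
Proof.
move=> Dw; apply: le_trans (cabsD _ _) _.
have pb := psi_bound Dw; have pn := cabs_ge0 (psi w).
have pp : cabs (psi w ^+ 2) <= M0 ^+ 2 by rewrite cabsX ler_sqr ?nnegrE ?(ltW M0_gt0).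
apply: lerD; rewrite cabsM.
  rewrite cabsM cabs_real cabsN -[M0]mul1r; apply: ler_pM => //; rewrite ?mulr_ge0 ?cabs_ge0//.
  by rewrite -[1]mulr1; apply: ler_pM; rewrite ?cabs_ge0 ?cutoff'_bound ?(ltW Dw).
rewrite cabs_real -[leRHS]mul1r; apply: ler_pM; rewrite ?cabs_ge0//; first exact: cutoff_bound.
by rewrite cabsM -[leRHS]mul1r; apply: ler_pM; rewrite ?cabs_ge0 ?(ltW Dz).
Qed.

(** Here |x| > 1 - e/2, hence 1 - |x|^2 < e and the cutoff vanishes: products with it extend by zero
    across the circle. *)
Let near_boundary w : 1 <= cabs w -> forall x, cabs (x - w) < e / 2 -> T x <= e.
Proof.
move=> w1 x xw; have := lerB_cabs w x; rewrite cabs_distC => H.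
rewrite /boundary_defect; have := cabs_ge0 x; nra.
Qed.

Let cont_Bcut w : Disc w -> {for w, continuous Bcut}.
Proof.
move=> Dw; have cm : {for w, continuous (fun x => Num.max (T x) e)}.
  by apply: rcont_max; [exact: cont_T|exact: rcont_cst].
apply: ccontD; apply: ccontM.
- apply: ccontM; last exact: (@ccontN _ (fun x => x) _ (@ccont_id _ _)).
  apply: ccont_real; apply: rcontB; first exact: rcont_cst.
  apply: rcontM; first exact: rcont_cst.
  by apply: rcontV; [rewrite expf_neq0// max_neq0|exact: rcontX].
- exact: cont_psi.
- apply: ccont_real; apply: rcontD; first by apply: rcontB; [exact: cm|exact: rcont_cst].
  by apply: rcontM; [exact: rcont_cst|apply: rcontV; [exact: max_neq0|exact: cm]].
- by apply: ccontM; [exact: ccont_cst|apply: ccontM; exact: cont_psi].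
Qed.

Let cont_cut w : Disc w -> {for w, continuous cut}.
Proof. by move=> /wirtinger_cut[A]; exact: wirtinger_continuous. Qed.

Section Regularized.
Variable dl : R.
Hypothesis (dl0 : 0 < dl).
Let d : R := dl ^+ 2.
Let d0 : 0 < d. Proof. exact: exprn_gt0. Qed.

Let s w : R := cabs (w - z) ^+ 2.
(** [E] regularizes 1 / (w - z) inside the disc of radius [dl] about [z]; [G] is its
    conj-derivative, zero outside that disc; [v0] is the conj-derivative of
    [cut w * ((k w - k z) * E w)]. *)
Let E w : R[i] := conjc (w - z) * (cauchy_reg d (s w))%:C%C.
Let G w : R[i] := (cauchy_reg d (s w) + s w * cauchy_reg' d (s w))%:C%C.
Let v0 w : R[i] := Bcut w * ((k w - k z) * E w) + cut w * ((k w - k z) * G w).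

Let wirtinger_E w : exists A, wirtinger E w A (G w).
Proof.
eexists.
have H1 : wirtinger (fun x => conjc (x - z)) w 0 1.
  apply: (@wirtinger_quad _ _ _ _ _ 1 1) => // h _.
  have -> : conjc (w + h - z) - conjc (w - z) - 0 * h - 1 * conjc h = 0.
    by rewrite !(rmorphB, rmorphD)/=; ring.
  by rewrite cabs0 mul1r exprn_ge0// cabs_ge0.
have c0 : 0 < 2 / d ^+ 3 by rewrite divr_gt0// exprn_gt0.
have H2 := wirtinger_real_comp (quadratic_derivative c0 (fun t => cauchy_reg_quad (s w) t d0))
  (wirtinger_sqr_dist z w).
have := wirtingerM H1 H2.
have -> : 1 * (cauchy_reg d (s w))%:C%C + conjc (w - z) * ((cauchy_reg' d (s w))%:C%C * (w - z)) = G w.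
  have sE : (s w)%:C%C = (w - z) * conjc (w - z) by rewrite mul_conjC.
  have -> : G w = (cauchy_reg d (s w))%:C%C + (s w)%:C%C * (cauchy_reg' d (s w))%:C%C.
    by rewrite -rmorphM -rmorphD.
  by rewrite sE; ring.
exact.
Qed.

Let cont_E w : {for w, continuous E}.
Proof. by have [A] := wirtinger_E w; exact: wirtinger_continuous. Qed.

Let cont_G w : {for w, continuous G}.
Proof.
have cs : {for w, continuous s}.
  apply: rcontX; apply: rcont_cabs.
  by apply: ccontB; [exact: ccont_id|exact: ccont_cst].
have cm : {for w, continuous (fun x => Num.max (s x) d)}.
  by apply: rcont_max; [exact: cs|exact: rcont_cst].
apply: ccont_real; apply: rcontD.
  apply: rcontD; first by apply: rcontV; [exact: max_neq0|exact: cm].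
  by apply: rcontM; [apply: rcontB; [exact: cm|exact: cs]|exact: rcont_cst].
apply: rcontM; first exact: cs.
have -> : (fun x => cauchy_reg' d (s x)) = (fun x => 0 - (Num.max (s x) d ^+ 2)^-1).
  by apply/funext => x; rewrite sub0r.
apply: rcontB; first exact: rcont_cst.
by apply: rcontV; [rewrite expf_neq0// max_neq0|exact: rcontX].
Qed.

Let cint_v0 : cint v0 = 0.
Proof.
pose u w : R[i] := if cabs w < 1 then cut w * ((k w - k z) * E w) else 0.
pose v w : R[i] := if cabs w < 1 then v0 w else 0.
have e20 : 0 < e / 2 by rewrite divr_gt0.
rewrite (@eq_cint _ _ v); last by move=> w Dw; rewrite /v ifT.
have T0 w x : 1 <= cabs w -> cabs (x - w) < e / 2 -> u x = 0 /\ v x = 0.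
  move=> w1 /(near_boundary w1) Tx; rewrite /u /v; case: ifP => // _.
  by rewrite /v0 /cut_kernel /cut_kernel_dbar cutoff0// cutoff'0// rmorph0 !(mul0r, addr0).
apply: (@cint_dbar _ u).
- move=> w; have [Dw|w1] := ltP (cabs w) 1.
    have [A1 H1] := wirtinger_cut Dw; have [A2 H2] := wirtinger_E w.
    have H3 := wirtingerB (wirtinger_derivable (hk Dw)) (wirtinger_cst (k z) w).
    have H4 := wirtingerM H1 (wirtingerM H3 H2).
    rewrite subrr mul0r add0r in H4.
    have [r r0 rP] := Disc_open Dw.
    eexists; rewrite /v Dw; apply: wirtinger_near r0 _ H4 => x /rP.
    by rewrite /Disc/= /u => ->.
  exists 0; rewrite (T0 w w w1 _).2 ?subrr ?cabs0//.
  by apply: wirtinger_near e20 _ (wirtinger_cst 0 w) => x /(T0 _ _ w1)[-> _].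
- move=> w; have [Dw|w1] := ltP (cabs w) 1.
    have [r r0 rP] := Disc_open Dw.
    have H : {for w, continuous v0}.
      apply: ccontD; apply: ccontM.
      + exact: cont_Bcut.
      + apply: ccontM; [apply: ccontB|exact: cont_E]; [exact: cont_k|exact: ccont_cst].
      + exact: cont_cut.
      + apply: ccontM; [apply: ccontB|exact: cont_G]; [exact: cont_k|exact: ccont_cst].
    by apply: ccont_near r0 _ H => x /rP; rewrite /Disc/= /v => ->.
  by apply: ccont_near e20 _ (@ccont_cst _ 0 w) => x /(T0 _ _ w1)[_ ->].
- by move=> w w1; apply: (T0 w w w1); rewrite subrr cabs0.
Qed.

Let v0_far w : dl <= cabs (w - z) -> v0 w = Bcut w * kappa w.
Proof.
move=> far; have ds : d <= s w by rewrite ler_sqr ?nnegrE ?cabs_ge0// ltW.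
have s0 : 0 < s w := lt_le_trans d0 ds.
have wz : w - z != 0 by rewrite -cabs_gt0; exact: lt_le_trans far.
have G0 : G w = 0.
  rewrite /G (_ : _ + _ = 0) ?rmorph0// /cauchy_reg /cauchy_reg' max_l//.
  by field; rewrite !gt_eqF.
rewrite /v0 G0 !mulr0 addr0 kappaE -mulrA; congr (_ * _).
suff -> : (w - z) * E w = 1 by rewrite mulr1.
rewrite /E mulrA mul_conjC -rmorphM /= -/(s w) /cauchy_reg max_l// subrr mul0r addr0 mulfV ?gt_eqF//.
Qed.

(** Here |(w - z) E| <= 2 and |(w - z) G| <= dl * 2 / dl^2, so the regularization changes the
    integrand by O(1 / dl) only, on a set of area O(dl^2). *)
Let v0_near w (L : R) : dl <= 1 -> Disc w -> cabs (w - z) < dl -> cabs (kappa w) <= L ->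
  cabs (v0 w - Bcut w * kappa w) <= (3 * (M0 + M0 ^+ 2) * L + 2 * M0 * L) / dl.
Proof.
move=> dl1 Dw near kL.
have n0 := cabs_ge0 (w - z).
have sd : s w < d by rewrite ltr_sqr ?nnegrE ?cabs_ge0// ltW.
have s0 : 0 <= s w by exact: sqr_ge0.
have L0 : 0 <= L by apply: le_trans kL; exact: cabs_ge0.
have d0' := d0; have M00 := M0_gt0.
set b := M0 + M0 ^+ 2; have b0 : 0 <= b by rewrite addr_ge0 ?exprn_ge0// ltW.
have regE : cauchy_reg d (s w) = (2 * d - s w) / d ^+ 2.
  by rewrite /cauchy_reg max_r ?ltW//; field; rewrite gt_eqF.
have E1 : cabs ((w - z) * E w) <= 2.
  rewrite /E mulrA mul_conjC -rmorphM /= cabs_real -/(s w) regE.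
  rewrite ger0_norm; last by apply: mulr_ge0 => //; apply: divr_ge0; [lra|exact: sqr_ge0].
  rewrite mulrA ler_pdivrMr ?exprn_gt0//; nra.
have G1 : cabs (G w) <= 2 / d.
  have -> : G w = (2 * (d - s w) / d ^+ 2)%:C%C.
    by rewrite /G /cauchy_reg /cauchy_reg' max_r ?ltW//; congr _%:C%C; field; rewrite gt_eqF.
  rewrite cabs_real ger0_norm; last by apply: divr_ge0; [lra|exact: sqr_ge0].
  rewrite ler_pdivrMr ?exprn_gt0// expr2 mulrA divfK ?gt_eqF//; lra.
have -> : v0 w - Bcut w * kappa w =
   Bcut w * (kappa w * ((w - z) * E w)) + cut w * (kappa w * ((w - z) * G w)) - Bcut w * kappa w.
  by rewrite /v0 kappaE; ring.
apply: le_trans (cabsB _ _) _; apply: le_trans (lerD (cabsD _ _) (lexx _)) _.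
have X1 : cabs (Bcut w * (kappa w * ((w - z) * E w))) <= b * (L * 2).
  rewrite cabsM [cabs (kappa w * _)]cabsM; apply: ler_pM; rewrite ?mulr_ge0 ?cabs_ge0//.
    exact: cut_kernel_dbar_bound.
  by apply: ler_pM; rewrite ?cabs_ge0.
have X2 : cabs (cut w * (kappa w * ((w - z) * G w))) <= M0 * (L * (dl * (2 / d))).
  rewrite cabsM [cabs (kappa w * _)]cabsM [cabs ((w - z) * _)]cabsM.
  apply: ler_pM; rewrite ?mulr_ge0 ?cabs_ge0//; first exact: cut_bound.
  apply: ler_pM; rewrite ?mulr_ge0 ?cabs_ge0//.
  by apply: ler_pM; rewrite ?cabs_ge0 ?(ltW near).
have X3 : cabs (Bcut w * kappa w) <= b * L.
  by rewrite cabsM; apply: ler_pM; rewrite ?cabs_ge0//; exact: cut_kernel_dbar_bound.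
have -> : (3 * b * L + 2 * M0 * L) / dl = 3 * b * L / dl + M0 * (L * (dl * (2 / d))).
  by rewrite /d; field; rewrite gt_eqF.
have : 3 * b * L <= 3 * b * L / dl.
  rewrite ler_pdivlMr// ler_piMr// !mulr_ge0//.
lra.
Qed.

Let cmeasurable_v0 : cmeasurable v0.
Proof.
apply: disc_measurable_continuous => w Dw; apply: ccontD; apply: ccontM.
+ exact: cont_Bcut.
+ apply: ccontM; [apply: ccontB|exact: cont_E]; [exact: cont_k|exact: ccont_cst].
+ exact: cont_cut.
+ apply: ccontM; [apply: ccontB|exact: cont_G]; [exact: cont_k|exact: ccont_cst].
Qed.

(** The regularized integrand has integral zero and differs from the true one only near [z]. The 8
    is 2 from [cabs_cint_le] times 4 from the area of a square of side [2 * dl]. *)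
Lemma cint_near (L : R) : dl <= 1 ->
  (forall w, Disc w -> cabs (w - z) < dl -> cabs (kappa w) <= L) ->
  cintegrable (fun w => Bcut w * kappa w) ->
  cabs (cint (fun w => Bcut w * kappa w)) <=
    8 * (3 * (M0 + M0 ^+ 2) * L + 2 * M0 * L) * dl.
Proof.
move=> dl1 kL iB.
set C := 3 * (M0 + M0 ^+ 2) * L + 2 * M0 * L.
(* A square around the small disc, because areas of squares are available from [leb2_square]. *)
pose sq : set (measurableTypeR R * measurableTypeR R) :=
  `[Re z - dl, Re z - dl + 2 * dl[ `*` `[Im z - dl, Im z - dl + 2 * dl[.
have msq : measurable sq by exact: measurableX.
have sqP w : cabs (w - z) < dl -> sq (Re w, Im w).
  move=> wz; split; rewrite /= in_itv/=.
    by have := le_lt_trans (Re_dist_le w z) wz; rewrite ltr_norml; lra.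
  by have := le_lt_trans (Im_dist_le w z) wz; rewrite ltr_norml; lra.
pose g w : R := C / dl * \1_sq (Re w, Im w).
have C0 : 0 <= C.
  have L0 : 0 <= L by apply: le_trans (kL z Dz _); rewrite ?cabs_ge0// subrr cabs0.
  have M00 := ltW M0_gt0.
  by rewrite /C addr_ge0 ?mulr_ge0 ?addr_ge0 ?exprn_ge0.
have Cd0 : 0 <= C / dl by rewrite divr_ge0// ltW.
have mg : disc_measurable g.
  apply: measurable_funM; first exact: measurable_cst.
  rewrite (_ : (fun _ => _) = \1_sq) ; last by apply/funext => -[x y].
  exact: measurable_indic.
have ig : disc_integrable g.
  apply: (disc_integrable_bounded (M := C / dl)) mg _ => w _.
  rewrite /g normrM (ger0_norm Cd0) ler_piMr// indicE; case: (_ \in _); by rewrite ?normr1 ?normr0.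
have diff w : Disc w -> cabs (v0 w - Bcut w * kappa w) <= g w.
  move=> Dw; have [near|far] := ltP (cabs (w - z)) dl.
    rewrite /g indicE mem_set ?mulr1; last exact: sqP.
    exact: v0_near dl1 Dw near (kL _ Dw near).
  by rewrite v0_far// subrr cabs0 /g mulr_ge0// indicE.
have iv : cintegrable v0.
  apply: (cintegrable_le cmeasurable_v0 (disc_integrableD ig (cintegrable_cabs iB))) => w Dw.
  have -> : v0 w = (v0 w - Bcut w * kappa w) + Bcut w * kappa w by ring.
  by apply: le_trans (cabsD _ _) _; rewrite lerD2r diff.
have := cabs_cint_le (cintegrableB iv iB) ig diff.
rewrite cintB// cint_v0 sub0r cabsN => /le_trans; apply.
have -> : 8 * C * dl = 2 * (C / dl * (2 * dl * (2 * dl))) by field; rewrite gt_eqF.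
rewrite ler_pM2l// /g disc_intZ; last first.
  apply: (disc_integrable_bounded (M := 1)).
    rewrite /disc_measurable (_ : _ \o _ = \1_sq) ; last by apply/funext => -[x y].
    exact: measurable_indic.
  by move=> w _; rewrite indicE; case: (_ \in _); rewrite ?normr1 ?normr0.
apply: ler_wpM2l => //.
rewrite /disc_int (_ : _ \o _ = \1_sq); last by apply/funext => -[x y].
rewrite /Rintegral integral_indic//; last exact: measurable_DiscR2.
have sqE : leb2 sq = (2 * dl * (2 * dl))%:E by rewrite leb2_square// mulr_ge0// ltW.
rewrite -lee_fin fineK; last first.
  rewrite ge0_fin_numE//; apply: (@le_lt_trans _ _ (leb2 sq)); last by rewrite sqE ltry.
  by apply: le_measure; rewrite ?inE//; [apply: measurableI => //; exact: measurable_DiscR2].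
rewrite -sqE; apply: le_measure; rewrite ?inE//; apply: measurableI => //; exact: measurable_DiscR2.
Qed.

End Regularized.

Lemma cintegrable_cut_kernel_dbar : cintegrable (fun w => Bcut w * kappa w).
Proof.
apply: (cintegrable_le _ (disc_integrableZ (M0 + M0 ^+ 2) integrable_diff_quotient)).
  apply: disc_measurable_continuous => w Dw.
  by apply: ccontM; [exact: cont_Bcut|exact: cont_kappa].
by move=> w Dw; rewrite cabsM ler_wpM2r ?cabs_ge0// cut_kernel_dbar_bound.
Qed.

Lemma cint_cut_kernel_dbar : cint (fun w => Bcut w * kappa w) = 0.
Proof.
have [L [dl [dl0 near _]]] := diff_quotient_bound.
set C := 8 * (3 * (M0 + M0 ^+ 2) * L + 2 * M0 * L).
have H d : 0 < d -> d <= 1 -> d <= dl -> cabs (cint (fun w => Bcut w * kappa w)) <= C * d.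
  move=> d0 d1 ddl; apply: cint_near => //; last exact: cintegrable_cut_kernel_dbar.
  by move=> w _ wd; apply: near; exact: lt_le_trans ddl.
apply/eqP; rewrite -cabs_eq0 eq_le cabs_ge0 andbT.
apply/ler_addgt0Pr => eps eps0; rewrite add0r.
have C1 : 0 < 1 + `|C| by rewrite ltr_pwDl.
have dm : 0 < Num.min (Num.min 1 dl) (eps / (1 + `|C|)) by rewrite !lt_min ltr01 dl0 divr_gt0.
apply: le_trans (H _ dm _ _) _; rewrite ?ge_min ?lexx ?orbT//.
set d := Num.min _ _; have d0 : 0 < d := dm.
have : d <= eps / (1 + `|C|) by rewrite ge_min lexx orbT.
rewrite ler_pdivlMr// mulrC; apply: le_trans; apply: ler_wpM2r; first exact: ltW.
by apply: le_trans (ler_norm _) _; rewrite lerDr.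
Qed.

End Cut.

(** A pointwise rate, not uniform up to the circle: the constant blows up as [T w] tends to 0, so
    dominated convergence has to follow. *)
Lemma cut_kernel_dbar_limit w e : 0 < e -> e <= 1 -> Disc w ->
  cabs (cut_kernel_dbar z e w + psi w ^+ 2 * (w - z)) <=
  (M0 / T w ^+ 2 + M0 ^+ 2 * (3 + (T w)^-1)) * e.
Proof.
move=> e0 e1 Dw.
have T0 : 0 < T w by rewrite /T subr_gt0 expr_lt1// cabs_ge0.
have K0 := kernel_neq0 Dz Dw.
set m := Num.max (T w) e.
have m0 : 0 < m by rewrite lt_max T0.
have Tm : T w <= m by rewrite le_max lexx.
have mT : m <= T w + e by rewrite /m; have [_|_] := leP e (T w); lra.
have -> : cut_kernel_dbar z e w + psi w ^+ 2 * (w - z) =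
   ((e ^+ 2 / m ^+ 2)%:C%C * w) * psi w + (m - T w - 2 * e + e ^+ 2 / m)%:C%C * (z * psi w ^+ 2).
  (* From w - z = w (1 - z conj w) - z (1 - |w|^2). This identity dictates the factor [psi] in
     [cut_kernel]. *)
  have -> : psi w ^+ 2 * (w - z) = w * psi w - (T w)%:C%C * (z * psi w ^+ 2).
    rewrite /boundary_defect rmorphB rmorph1 /= -mul_conjC /inv_kernel; field.
    exact: K0.
  rewrite /cut_kernel_dbar /cutoff /cutoff' -/m !(rmorphB, rmorphD, rmorphM) rmorph1 /=; ring.
apply: le_trans (cabsD _ _) _.
have pb := psi_bound Dw.
have pp : cabs (psi w ^+ 2) <= M0 ^+ 2 by rewrite cabsX ler_sqr ?nnegrE ?(ltW M0_gt0) ?cabs_ge0.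
have ee : e ^+ 2 <= e by rewrite expr2 ler_piMl// ltW.
have Q0 : 0 <= e ^+ 2 / m ^+ 2 by rewrite divr_ge0 ?sqr_ge0.
have Q1 : e ^+ 2 / m ^+ 2 <= e / T w ^+ 2.
  apply: ler_pM; rewrite ?invr_ge0 ?sqr_ge0//.
  by rewrite lef_pV2 ?posrE ?exprn_gt0// ler_sqr ?nnegrE// ltW.
have P0 : 0 <= e ^+ 2 / m by rewrite divr_ge0 ?sqr_ge0// ltW.
have P1 : e ^+ 2 / m <= e / T w.
  by apply: ler_pM; rewrite ?sqr_ge0 ?invr_ge0 ?(ltW m0)// lef_pV2.
rewrite [leRHS]mulrDl; apply: lerD; rewrite cabsM.
  rewrite cabsM cabs_real ger0_norm//.
  have -> : M0 / T w ^+ 2 * e = e / T w ^+ 2 * 1 * M0 by ring.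
  apply: ler_pM => //; [exact: mulr_ge0 Q0 (cabs_ge0 _)|exact: cabs_ge0|].
  by apply: ler_pM => //; [exact: cabs_ge0|exact: ltW].
rewrite cabs_real [cabs (z * _)]cabsM.
have -> : M0 ^+ 2 * (3 + (T w)^-1) * e = (3 * e + e / T w) * (1 * M0 ^+ 2) by ring.
apply: ler_pM => //; first exact: mulr_ge0 (cabs_ge0 _) (cabs_ge0 _).
  by rewrite ler_norml; lra.
by apply: ler_pM => //; [exact: cabs_ge0|exact: cabs_ge0|exact: ltW].
Qed.

(** Dominated convergence along e = 1/(n+1): the cut kernels tend to - psi^2 (w - z), and (w - z)
    times the quotient is k w - k z. *)
Lemma cint_kernel_diff : cint (fun w => psi w ^+ 2 * (k w - k z)) = 0.
Proof.
pose f_ n w := cut_kernel_dbar z n.+1%:R^-1 w * kappa w.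
have n0 n : 0 < n.+1%:R^-1 :> R by rewrite invr_gt0.
have n1 n : n.+1%:R^-1 <= 1 :> R by rewrite invf_le1// ler1n.
have fi n : cintegrable (f_ n) by exact: cintegrable_cut_kernel_dbar.
have : cint (fun w => - (psi w ^+ 2 * (k w - k z))) = 0.
  apply: (cint_cvg_eq0 (f_ := f_) (g := fun w => (M0 + M0 ^+ 2) * cabs (kappa w))).
  - by move=> n; exact: cintegrable_cmeasurable.
  - by apply: disc_integrableZ; exact: integrable_diff_quotient.
  - move=> w Dw; pose K := (M0 / T w ^+ 2 + M0 ^+ 2 * (3 + (T w)^-1)) * cabs (kappa w).
    apply: (@squeeze_cvgr _ _ _ _ (fun=> 0) (fun n => K * n.+1%:R^-1)).
    + apply: nearW => n; rewrite cabs_ge0 /f_ /=.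
      have -> : cut_kernel_dbar z n.+1%:R^-1 w * kappa w - - (psi w ^+ 2 * (k w - k z)) =
        (cut_kernel_dbar z n.+1%:R^-1 w + psi w ^+ 2 * (w - z)) * kappa w by rewrite kappaE; ring.
      rewrite cabsM /K [leRHS]mulrAC; apply: ler_wpM2r; first exact: cabs_ge0.
      exact: cut_kernel_dbar_limit.
    + exact: cvg_cst.
    + rewrite -[X in _ --> X](mulr0 K); apply: cvgM; first exact: cvg_cst.
      exact: cvg_harmonic.
  - by move=> n w Dw; rewrite cabsM ler_wpM2r ?cabs_ge0// cut_kernel_dbar_bound.
  - by move=> n; exact: cint_cut_kernel_dbar.
rewrite /= => H; apply/eqP; rewrite -oppr_eq0 -H; apply/eqP.
rewrite -mulN1r -cintZ; first by apply: eq_cint => w _; rewrite mulN1r.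
apply: (cintegrable_le _ (disc_integrableZ (M0 ^+ 2)
   (disc_integrableD ik (disc_integrable_cst (cabs (k z)))))).
  apply: disc_measurable_continuous => w Dw; apply: ccontM.
    by apply: (@ccontM _ psi psi w); exact: cont_psi.
  by apply: ccontB; [exact: cont_k|exact: ccont_cst].
move=> w Dw; rewrite cabsM; apply: ler_pM; rewrite ?cabs_ge0 ?cabsB//.
by rewrite cabsX ler_sqr ?nnegrE ?(ltW M0_gt0) ?cabs_ge0// psi_bound.
Qed.

End Reproducing.

Section ReproducingFormula.
Context {R : realType}.
Implicit Types (k f : R[i] -> R[i]) (z w : R[i]).

Lemma inv_kernel_bound z w : Disc z -> Disc w -> cabs (inv_kernel z w) <= (1 - cabs z)^-1.
Proof.
move=> Dz Dw; rewrite cabsV lef_pV2 ?posrE ?subr_gt0//; first exact: kernel_lower_l.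
by rewrite cabs_gt0 kernel_neq0.
Qed.

Lemma inv_kernel_continuous z w : Disc z -> Disc w -> {for w, continuous (inv_kernel z)}.
Proof.
move=> Dz Dw; apply: ccontV; first exact: kernel_neq0.
apply: ccontB; first exact: ccont_cst.
by apply: ccontM; [exact: ccont_cst|apply: ccont_conj; exact: ccont_id].
Qed.

Lemma cmeasurable_inv_kernelX z n : Disc z -> cmeasurable (fun w => inv_kernel z w ^+ n).
Proof.
move=> Dz; apply: disc_measurable_continuous => w Dw.
elim: n => [|n IH]; first exact: ccont_cst.
have -> : (fun w => inv_kernel z w ^+ n.+1) = (fun w => inv_kernel z w * inv_kernel z w ^+ n).
  by apply/funext => v; rewrite exprS.
by apply: ccontM IH; exact: inv_kernel_continuous.
Qed.

Lemma inv_kernelX_bound z n w : Disc z -> Disc w ->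
  cabs (inv_kernel z w ^+ n) <= (1 - cabs z)^-1 ^+ n.
Proof.
move=> Dz Dw; rewrite cabsX; apply: lerXn2r; rewrite ?nnegrE ?cabs_ge0//.
  by rewrite invr_ge0 subr_ge0 ltW.
exact: inv_kernel_bound.
Qed.

Lemma cintegrable_kernelX z n f : Disc z -> cintegrable f ->
  cintegrable (fun w => inv_kernel z w ^+ n * f w).
Proof.
move=> Dz; apply: cintegrableMr (cmeasurable_inv_kernelX n Dz) _ => w.
exact: inv_kernelX_bound.
Qed.

Lemma cintegrable_holo k : holo_disc k -> disc_integrable (fun w => cabs (k w)) -> cintegrable k.
Proof.
move=> hk ik; apply: cintegrable_le ik _ => //.
by apply: disc_measurable_continuous => w /hk; exact: derivable_continuousC.
Qed.

Lemma conj_kernel2E z w : (1 - conjc z * w) ^- 2 = conjc (inv_kernel z w ^+ 2).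
Proof. by rewrite conj_kernelE /inv_kernel exprVn fmorphV rmorphXn. Qed.

Lemma derivable_conj_kernel z w : Disc z -> Disc w ->
  derivable (fun x => (1 - conjc z * x) ^- 2) w 1.
Proof.
move=> Dz Dw; have c0 : 0 < 1 - cabs z by rewrite subr_gt0.
apply: (derivable_kernel c0 _ _).1; rewrite ?cabs_conj ?(ltW Dz)//.
by rewrite conj_kernelE cabs_conj kernel_lower_l.
Qed.

Lemma cintegrable_cst (c : R[i]) : cintegrable (fun=> c).
Proof. by split; exact: disc_integrable_cst. Qed.

Lemma cintegrable_kernel z n : Disc z -> cintegrable (fun w => inv_kernel z w ^+ n).
Proof.
move=> Dz; have := cintegrable_kernelX n Dz (cintegrable_cst 1).
by apply: eq_cintegrable => w _; rewrite mulr1.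
Qed.

(** The conjugate of the kernel is holomorphic in [w] with value 1 at the origin, so
    [cint_kernel_diff] at the point 0 is its mean value property. *)
Lemma cint_kernel z : Disc z -> cint (fun w => inv_kernel z w ^+ 2) = disc_area%:C%C.
Proof.
move=> Dz; pose k2 w : R[i] := (1 - conjc z * w) ^- 2.
have D0 : Disc (0 : R[i]) by rewrite /Disc/= cabs0.
have k2E w : k2 w = conjc (inv_kernel z w ^+ 2) by exact: conj_kernel2E.
have ik2 : cintegrable k2.
  by apply: eq_cintegrable (cintegrable_conj (cintegrable_kernel 2 Dz)) => w _; rewrite k2E.
have hk2 : holo_disc k2 by move=> w; exact: derivable_conj_kernel.
have := cint_kernel_diff hk2 (cintegrable_cabs ik2) D0.
rewrite (_ : (fun w => _) = (fun w => k2 w - 1)); last first.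
  have k20 : k2 0 = 1 by rewrite /k2 mulr0 subr0 expr1n invr1.
  by apply/funext => w; rewrite {1}/inv_kernel mul0r subr0 invr1 expr1n mul1r k20.
rewrite cintB//; last exact: cintegrable_cst.
have -> : cint (fun=> 1 : R[i]) = (@disc_area R)%:C%C.
  by have := @cint_real_cst R 1; rewrite mul1r => <-; apply: eq_cint => w _; rewrite rmorph1.
move=> /eqP; rewrite subr_eq0 => /eqP H.
rewrite -[LHS]conjcK -cint_conj; last exact: cintegrable_kernel.
rewrite -(conjc_real disc_area) -H; congr conjc.
by apply: eq_cint => w _; rewrite k2E.
Qed.

Lemma reproducing k z : holo_disc k -> disc_integrable (fun w => cabs (k w)) -> Disc z ->
  cint (fun w => inv_kernel z w ^+ 2 * k w) = disc_area%:C%C * k z.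
Proof.
move=> hk ik Dz; have ck := cintegrable_holo hk ik.
have := cint_kernel_diff hk ik Dz.
rewrite (_ : (fun w => _) = (fun w => inv_kernel z w ^+ 2 * k w - k z * inv_kernel z w ^+ 2)); last first.
  by apply/funext => w; ring.
rewrite cintB; [|exact: cintegrable_kernelX|apply: cintegrableZ; exact: cintegrable_kernel].
rewrite cintZ; last exact: cintegrable_kernel.
by rewrite cint_kernel// => /eqP; rewrite subr_eq0 => /eqP ->; rewrite mulrC.
Qed.

End ReproducingFormula.

(** * The representation of the kernel of an extremal function *)

Section DualPower.
Context {R : realType}.
Implicit Types (a b : R[i]) (p x y : R).

(* [x |-> dual_power p F] represents the derivative of [|F| ^ p / p]. *)
Definition dual_power p b : R[i] := (powR (cabs b) (p - 2))%:C%C * b.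

(** For p <= 2 the factor [powR (cabs b) (p - 2)] at b = 0 is the default or a trivial value of
    [powR]; multiplication by [b] makes the product 0 in every case. *)
Lemma cabs_dual_power p b : 1 < p -> cabs (dual_power p b) = powR (cabs b) (p - 1).
Proof.
move=> p1; have [->|b0] := eqVneq b 0.
  by rewrite /dual_power mulr0 cabs0 powR0// gt_eqF// subr_gt0.
rewrite /dual_power cabsM cabs_real ger0_norm ?powR_ge0//.
have -> : p - 1 = (p - 2) + 1 by ring.
by rewrite [RHS]powRD ?cabs_eq0 ?b0 ?implybT// powRr1 ?cabs_ge0.
Qed.

Lemma conjcM a b : conjc (a * b) = conjc a * conjc b.
Proof. exact: rmorphM. Qed.

Lemma mul_conj_dual_power p b : 1 < p -> b * conjc (dual_power p b) = (powR (cabs b) p)%:C%C.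
Proof.
move=> p1; rewrite /dual_power conjcM conjc_real mulrCA mul_conjC -rmorphM /=.
congr _%:C%C; have [->|b0] := eqVneq b 0.
  by rewrite cabs0 expr0n mulr0 powR0// gt_eqF// (lt_trans ltr01).
rewrite -powR_mulrn ?cabs_ge0// -powRD ?cabs_eq0 ?b0 ?implybT//.
by congr powR; ring.
Qed.

(** Young's inequality for x and y^(p-1), that is, convexity of x^p at the point y. It yields the
    subgradient bound, the tangent bound on the p-th root and the Schur estimate. *)
Lemma young_power p x y : 1 < p -> 0 <= x -> 0 <= y ->
  p * (x * powR y (p - 1)) <= powR x p + (p - 1) * powR y p.
Proof.
move=> p1 x0 y0; have p0 : 0 < p := lt_trans ltr01 p1.
have q0 : 0 < p / (p - 1) by rewrite divr_gt0// subr_gt0.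
have pn : p - 1 != 0 by rewrite gt_eqF// subr_gt0.
have pn0 : p != 0 by rewrite gt_eqF.
have := conjugate_powR x0 (powR_ge0 y (p - 1)) p0 q0.
rewrite -powRrM.
have -> : (p - 1) * (p / (p - 1)) = p by field.
have -> : p^-1 + (p / (p - 1))^-1 = 1 by field; rewrite ?pn0 ?pn.
move=> /(_ erefl) H; rewrite -ler_pdivlMl//; apply: le_trans H _.
by apply: le_of_eq; field; rewrite ?pn0 ?pn.
Qed.

(** Convexity of |.|^p on the plane: Re (a conj ([dual_power p b])) is at most |a| |b|^(p-1), and
    Young's inequality concludes. *)
Lemma dual_power_subgradient p a b : 1 < p ->
  powR (cabs b) p + p * Re ((a - b) * conjc (dual_power p b)) <= powR (cabs a) p.
Proof.
move=> p1; have p0 : 0 < p := lt_trans ltr01 p1.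
rewrite mulrBl mul_conj_dual_power// cReD cReN /=.
have H : Re (a * conjc (dual_power p b)) <= cabs a * powR (cabs b) (p - 1).
  apply: le_trans (ler_norm _) _; apply: le_trans (Re_le_cabs _) _.
  by rewrite cabsM cabs_conj cabs_dual_power.
have := young_power p1 (cabs_ge0 a) (cabs_ge0 b).
have := ler_wpM2l (ltW p0) H; lra.
Qed.

Lemma dual_power_continuous p b : 1 < p -> {for b, continuous (dual_power p)}.
Proof.
move=> p1; have [->|b0] := eqVneq b 0.
  apply/continuousCP => e e0; exists (powR e (p - 1)^-1); first exact: powR_gt0.
  have pn : 0 < p - 1 by rewrite subr_gt0.
  move=> w; rewrite subr0 {2}/dual_power mulr0 subr0 cabs_dual_power// => we.
  have -> : e = powR (powR e (p - 1)^-1) (p - 1).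
    by rewrite -powRrM mulVf ?gt_eqF// powRr1// ltW.
  by rewrite gt0_ltr_powR// nnegrE ?cabs_ge0 ?powR_ge0.
apply: ccontM; last exact: ccont_id.
apply: ccont_real; apply: (@rcont_comp _ (fun x => powR x (p - 2))).
  by apply: rcont_cabs; exact: ccont_id.
have bb : 0 < cabs b by rewrite cabs_gt0.
apply: differentiable_continuous; apply/derivable1_diffP.
by apply: derivable_powR; rewrite in_itv/= bb.
Qed.

End DualPower.

(** * Bergman spaces in terms of integrability on the disc *)

Section BergmanBridge.
Context {R : realType}.
Notation leb2 := (@leb2 R).
Implicit Types (f k F h : R[i] -> R[i]) (g : R[i] -> R).

Lemma holo_cmeasurable f : holo_disc f -> cmeasurable f.
Proof. by move=> hf; apply: disc_measurable_continuous => w /hf; exact: derivable_continuousC. Qed.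

Lemma disc_measurable_powR g p : disc_measurable g -> disc_measurable (fun w => powR (g w) p).
Proof. by move=> mg; exact: (measurableT_comp (measurable_powR p) mg). Qed.

Lemma area_int_integrable g : disc_measurable g -> (forall w, 0 <= g w) ->
  (area_int g < +oo)%E -> disc_integrable g.
Proof.
move=> mg g0 fin; apply/integrableP; split; first exact/measurable_EFinP.
have -> : (\int[leb2]_(x in @DiscR2 R) `|(EFin \o (g \o @cplx R)) x| =
   \int[leb2]_(x in @DiscR2 R) (g (cplx x))%:E)%E.
  by apply: eq_integral => x _ /=; rewrite ger0_norm.
move: fin; rewrite /area_int; case: (\int[leb2]_(xy in @DiscR2 R) _)%E => [r||] //.
- by move=> _; rewrite ltry.
- by rewrite mulry gtr0_sg ?invr_gt0 ?pi_gt0// mul1e.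
Qed.

Lemma area_intE g : disc_integrable g -> area_int g = (pi^-1 * disc_int g)%:E.
Proof.
move=> ig; rewrite /area_int EFinM /disc_int /Rintegral fineK//.
by apply: integrable_fin_num ig; exact: measurable_DiscR2.
Qed.

Definition Lp_integrable p f := disc_integrable (fun w => powR (cabs (f w)) p).

Lemma Bergman_integrable p f : in_Bergman p f -> Lp_integrable p f.
Proof.
move=> [hf fin]; apply: area_int_integrable fin.
  by apply: disc_measurable_powR; apply: disc_measurable_cabs; exact: holo_cmeasurable.
by move=> w; exact: powR_ge0.
Qed.

Lemma in_BergmanP p f : holo_disc f -> Lp_integrable p f -> in_Bergman p f.
Proof. by move=> hf ig; split=> //; rewrite area_intE// ltry. Qed.

Lemma Bergman_normE p f : Lp_integrable p f ->
  Bergman_norm p f = powR (pi^-1 * disc_int (fun w => powR (cabs (f w)) p)) p^-1.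
Proof. by move=> ig; rewrite /Bergman_norm area_intE. Qed.

Lemma Re_phiE k f : Re_phi k f = pi^-1 * Re (cint (fun w => f w * conjc (k w))).
Proof. by []. Qed.

Lemma Lp_integrable1 p f : 1 <= p -> cmeasurable f -> Lp_integrable p f ->
  disc_integrable (fun w => cabs (f w)).
Proof.
move=> p1 mf ig; apply: disc_integrable_le (disc_integrableD (disc_integrable_cst 1) ig) _.
  exact: disc_measurable_cabs.
move=> w _; rewrite ger0_norm ?cabs_ge0//; have [f1|/ltW f1] := leP (cabs (f w)) 1.
  by apply: le_trans f1 _; rewrite lerDl powR_ge0.
by apply: le_trans (le1r_powR f1 p1) _; rewrite lerDr.
Qed.

(** Integrability follows pointwise from Young's inequality with the conjugate exponents p and p /
    (p - 1). *)
Lemma cintegrable_mulconj p F k : 1 < p -> cmeasurable F -> cmeasurable k ->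
  Lp_integrable p F -> Lp_integrable (p / (p - 1)) k ->
  cintegrable (fun w => F w * conjc (k w)).
Proof.
move=> p1 mF mk iF ik; have p0 : 0 < p := lt_trans ltr01 p1.
have q0 : 0 < p / (p - 1) by rewrite divr_gt0// subr_gt0.
have pn : p - 1 != 0 by rewrite gt_eqF// subr_gt0.
have pq : p^-1 + (p / (p - 1))^-1 = 1 by field; rewrite ?pn ?gt_eqF.
have mk' : cmeasurable (fun w => conjc (k w)).
  have [kR kI] := mk; split.
    by move: kR; congr disc_measurable; apply/funext => w; case: (k w).
  rewrite /disc_measurable (_ : _ \o _ = (fun w => -1 * Im (k (cplx w)))).
    by apply: measurable_funM; [exact: measurable_cst|exact: kI].
  by apply/funext => w /=; case: (k (cplx w)) => a b /=; rewrite mulN1r.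
apply: (cintegrable_le (cmeasurableM mF mk')
  (disc_integrableD (disc_integrableZ p^-1 iF) (disc_integrableZ (p / (p - 1))^-1 ik))).
move=> w _; rewrite cabsM cabs_conj ![_^-1 * powR _ _]mulrC.
exact: conjugate_powR (cabs_ge0 _) (cabs_ge0 _) p0 q0 pq.
Qed.

Lemma powRD_le x y p : 0 <= x -> 0 <= y -> 0 <= p ->
  powR (x + y) p <= powR (2 : R) p * (powR x p + powR y p).
Proof.
move=> x0 y0 p0; have m0 : 0 <= Num.max x y by rewrite le_max x0.
have : x + y <= 2 * Num.max x y.
  by rewrite mulr2n mulrDl mul1r; apply: lerD; rewrite le_max lexx ?orbT.
move=> /(ge0_ler_powR p0) H.
have {}H := H ltac:(by rewrite nnegrE addr_ge0) ltac:(by rewrite nnegrE mulr_ge0).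
apply: le_trans H _; rewrite powRM// ler_wpM2l ?powR_ge0//.
by rewrite /Num.max; case: ifP => _; rewrite ?lerDr ?lerDl powR_ge0.
Qed.

Lemma Lp_integrableD p f h (M : R) : 0 <= p -> cmeasurable f -> cmeasurable h -> Lp_integrable p f ->
  (forall w, Disc w -> cabs (h w) <= M) -> Lp_integrable p (fun w => f w + h w).
Proof.
move=> p0 mf mh ig hM.
have i2 := disc_integrableZ (powR (2 : R) p) (disc_integrableD ig (disc_integrable_cst (powR M p))).
apply: disc_integrable_le i2 _.
  apply: disc_measurable_powR; apply: (@disc_measurable_cabs _ (fun w => f w + h w)).
  have [fR fI] := mf; have [hR hI] := mh; split.
    rewrite /disc_measurable (_ : _ \o _ = (fun w => Re (f (cplx w)) + Re (h (cplx w)))).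
      exact: measurable_funD.
    by apply/funext => w; rewrite /= cReD.
  rewrite /disc_measurable (_ : _ \o _ = (fun w => Im (f (cplx w)) + Im (h (cplx w)))).
    exact: measurable_funD.
  by apply/funext => w; rewrite /= cImD.
move=> w Dw; rewrite ger0_norm ?powR_ge0//.
have M0 : 0 <= M by apply: le_trans (hM w Dw); exact: cabs_ge0.
apply: (@le_trans _ _ (powR (cabs (f w) + M) p)).
  apply: ge0_ler_powR; rewrite ?nnegrE ?addr_ge0 ?cabs_ge0//.
  by apply: le_trans (cabsD _ _) _; rewrite lerD2l hM.
exact: powRD_le (cabs_ge0 _) M0 p0.
Qed.

End BergmanBridge.

(** * First variation at the extremal function *)

Section Variation.
Context {R : realType}.
Implicit Types (k F h : R[i] -> R[i]) (p t : R).

Lemma derivable_wirtinger (u : R[i] -> R[i]) w A : wirtinger u w A 0 -> derivable u w 1.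
Proof.
move=> H; apply: (derivableCP (l := A) _).1 => e /H[d d0 dP]; exists d => // h /dP.
by rewrite mul0r subr0.
Qed.

Lemma holo_disc_comb (a b : R[i]) F h : holo_disc F -> holo_disc h ->
  holo_disc (fun w => a * F w + b * h w).
Proof.
move=> hF hh w Dw.
have H := wirtingerB (wirtingerM (wirtinger_cst a w) (wirtinger_derivable (hF w Dw)))
  (wirtingerM (wirtinger_cst (- b) w) (wirtinger_derivable (hh w Dw))).
have B0 : 0 * F w + a * 0 - (0 * h w + - b * 0) = 0 by ring.
rewrite B0 in H.
apply: derivable_wirtinger; apply: wirtinger_near (ltr01) _ H => x _.
by rewrite mulNr opprK.
Qed.

Lemma cintegrable_conjM (f h : R[i] -> R[i]) (M : R) : cintegrable f -> cmeasurable h ->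
  (forall w, Disc w -> cabs (h w) <= M) -> cintegrable (fun w => h w * conjc (f w)).
Proof. by move=> iff mh hM; apply: cintegrableMr mh hM (cintegrable_conj iff). Qed.

Lemma powR_le1 (x r : R) : 0 <= x -> x <= 1 -> 0 <= r -> powR x r <= 1.
Proof. by move=> x0 x1 r0; have := ge0_ler_powR r0 x0 ler01 x1; rewrite powR1. Qed.

(** Its modulus |F|^(p-1) is at most 1 + |F|^p. *)
Lemma cintegrable_dual_power p F : 1 < p -> holo_disc F -> Lp_integrable p F ->
  cintegrable (fun w => dual_power p (F w)).
Proof.
move=> p1 hF iF.
have pn : 0 < p - 1 by rewrite subr_gt0.
apply: cintegrable_le (disc_integrableD (disc_integrable_cst 1) iF) _.
  apply: disc_measurable_continuous => w Dw.
  by have := continuous_comp (derivable_continuousC (hF w Dw)) (@dual_power_continuous _ _ (F w) p1); apply.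
move=> w _; rewrite cabs_dual_power//; have f0 := cabs_ge0 (F w).
have [f1|/ltW f1] := leP (cabs (F w)) 1.
  apply: (@le_trans _ _ 1); last by rewrite lerDl powR_ge0.
  by apply: powR_le1 => //; exact: ltW.
apply: (@le_trans _ _ (powR (cabs (F w)) p)); last by rewrite lerDr.
by apply: ler_powR => //; lra.
Qed.

Lemma Lp_integrableZ p (a : R[i]) F : 0 <= p -> Lp_integrable p F ->
  Lp_integrable p (fun w => a * F w).
Proof.
move=> p0 iF; have := disc_integrableZ (powR (cabs a) p) iF.
by congr disc_integrable; apply/funext => w; rewrite cabsM powRM ?cabs_ge0.
Qed.

Section Extremal.
Variables (p : R) (k F : R[i] -> R[i]).
Hypotheses (p1 : 1 < p) (Bk : in_Bergman (p / (p - 1)) k) (ext : extremal_function p k F).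

Let p0 : 0 < p. Proof. exact: lt_trans p1. Qed.
Let BF : in_Bergman p F. Proof. by case: ext. Qed.
Let hF : holo_disc F. Proof. by case: BF. Qed.
Let iF : Lp_integrable p F. Proof. exact: Bergman_integrable. Qed.
Let ik : Lp_integrable (p / (p - 1)) k. Proof. exact: Bergman_integrable. Qed.
Let mF : cmeasurable F. Proof. exact: holo_cmeasurable. Qed.
Let mk : cmeasurable k. Proof. by apply: holo_cmeasurable; case: Bk. Qed.
Let q1 : 1 <= p / (p - 1).
Proof. by rewrite ler_pdivlMr ?subr_gt0// mul1r gerBl. Qed.
Let ik1 : cintegrable k.
Proof. by apply: cintegrable_le mk (Lp_integrable1 q1 mk ik) _. Qed.
Let iFk : cintegrable (fun w => F w * conjc (k w)).
Proof. exact: (cintegrable_mulconj p1). Qed.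
Let c := Re_phi k F.
Let c_def : c = pi^-1 * Re (cint (fun w => F w * conjc (k w))). Proof. by []. Qed.

Let normF : pi^-1 * disc_int (fun w => powR (cabs (F w)) p) = 1.
Proof.
(* By its defaults [powR] is also 1 at a negative base, and it is 1 at exponent 0; both cases are
   excluded. *)
case: ext => _ + _; rewrite Bergman_normE// => /eqP; rewrite powR_eq1 => /or3P[/eqP//||].
  rewrite ltNge mulr_ge0 ?invr_ge0 ?pi_ge0//; apply: disc_int_ge0 => w _; exact: powR_ge0.
by rewrite invr_eq0 gt_eqF.
Qed.

(** The function -F is a competitor with value -c. The sign is needed to multiply bounds on the norm
    by [c]. *)
Let c_ge0 : 0 <= c.
Proof.
have hN : holo_disc (fun w => -1 * F w + 0 * F w) by exact: holo_disc_comb.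
have eN : (fun w => -1 * F w + 0 * F w) = (fun w => -1 * F w).
  by apply/funext => w; rewrite mul0r addr0.
rewrite eN in hN.
have iN := Lp_integrableZ (-1) (ltW p0) iF.
have nN : Bergman_norm p (fun w => -1 * F w) = 1.
  rewrite Bergman_normE// (_ : (fun w => _) = (fun w => powR (cabs (F w)) p)).
    by rewrite normF powR1.
  by apply/funext => w; rewrite mulN1r cabsN.
have [_ _ /(_ _ (in_BergmanP hN iN) nN)] := ext.
rewrite Re_phiE (_ : (fun w => _) = (fun w => -1 * (F w * conjc (k w)))); last first.
  by apply/funext => w; rewrite mulrA.
rewrite (cintZ _ iFk) mulN1r cReN mulrN -c_def -/c; lra.
Qed.

Section Direction.
Variables (h : R[i] -> R[i]) (M : R).
Hypotheses (hh : holo_disc h) (hM : forall w, Disc w -> cabs (h w) <= M).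

Let mh : cmeasurable h. Proof. exact: holo_cmeasurable. Qed.
Let M0 : 0 <= M.
Proof. by apply: le_trans (hM (w := 0) _); rewrite ?cabs_ge0// /Disc/= cabs0. Qed.

Let G t w : R[i] := F w + t%:C%C * h w.

Let hG t : holo_disc (G t).
Proof.
have := @holo_disc_comb 1 t%:C%C _ _ hF hh; congr holo_disc.
by apply/funext => w; rewrite mul1r.
Qed.

Let th_bound t w : Disc w -> cabs (t%:C%C * h w) <= `|t| * M.
Proof. by move=> Dw; rewrite cabsM cabs_real ler_wpM2l// hM. Qed.

Let iG t : Lp_integrable p (G t).
Proof.
apply: (Lp_integrableD (h := fun w => t%:C%C * h w) (M := `|t| * M)) => //; first exact: ltW.
  apply: holo_cmeasurable; have := @holo_disc_comb t%:C%C 0 _ _ hh hh; congr holo_disc.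
  by apply/funext => w; rewrite mul0r addr0.
exact: th_bound.
Qed.

(** [I t] is the p-th power of the norm of [G t], and [p * (pi^-1 * Psi t)] is its slope, used only
    through the subgradient bounds [I_ge] and [I_le]. *)
Let I t := pi^-1 * disc_int (fun w => powR (cabs (G t w)) p).
Let Psi t := Re (cint (fun w => h w * conjc (dual_power p (G t w)))).

Let ipsi t : cintegrable (fun w => h w * conjc (dual_power p (G t w))).
Proof. exact: cintegrable_conjM (cintegrable_dual_power p1 (@hG t) (@iG t)) mh hM. Qed.

Let ihk : cintegrable (fun w => h w * conjc (k w)).
Proof. exact: cintegrable_conjM ik1 mh hM. Qed.

Let G0 w : G 0 w = F w.
Proof. by rewrite /G rmorph0 mul0r addr0. Qed.

Let phi_G t : Re_phi k (G t) = c + t * Re_phi k h.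
Proof.
rewrite !Re_phiE c_def (_ : (fun w => _) =
  (fun w => F w * conjc (k w) + t%:C%C * (h w * conjc (k w)))); last first.
  by apply/funext => w; rewrite /G; ring.
rewrite (cintD iFk (@cintegrableZ _ t%:C%C _ ihk)) (cintZ _ ihk) cReD cReM /=; ring.
Qed.

(** With N = I^(1/p), the competitor G / N gives c + t phi(h) <= c N in real parts, and the tangent
    line of the p-th root at 1 gives N <= 1 + (I - 1) / p. *)
Let extremal_ineq t : 0 < I t -> t * Re_phi k h <= c / p * (I t - 1).
Proof.
move=> I0; set N := powR (I t) p^-1.
have N0 : 0 < N by exact: powR_gt0.
have NI : powR N p = I t by rewrite /N -powRrM mulVf ?gt_eqF// powRr1// ltW.
have iN := Lp_integrableZ (N^-1)%:C%C (ltW p0) (iG t).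
have hN : holo_disc (fun w => (N^-1)%:C%C * G t w).
  have := @holo_disc_comb (N^-1)%:C%C 0 _ _ (@hG t) (@hG t); congr holo_disc.
  by apply/funext => w; rewrite mul0r addr0.
have nN : Bergman_norm p (fun w => (N^-1)%:C%C * G t w) = 1.
  rewrite Bergman_normE// (_ : (fun w => _) = (fun w => powR N^-1 p * powR (cabs (G t w)) p)); last first.
    by apply/funext => w; rewrite cabsM cabs_real powRM ?cabs_ge0 ?normr_ge0// ger0_norm// invr_ge0 ltW.
  rewrite disc_intZ; last exact: iG.
  have -> : pi^-1 * (powR N^-1 p * disc_int (fun w => powR (cabs (G t w)) p)) = powR N^-1 p * I t.
    by rewrite /I; ring.
  rewrite -NI -powRM ?invr_ge0 ?(ltW N0)// mulVf ?gt_eqF//.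
  by rewrite !powR1.
have [_ _ /(_ _ (in_BergmanP hN iN) nN)] := ext.
have iGk : cintegrable (fun w => G t w * conjc (k w)).
  have := cintegrableD iFk (@cintegrableZ _ t%:C%C _ ihk).
  by congr cintegrable; apply/funext => w; rewrite /G; ring.
have -> : Re_phi k (fun w => (N^-1)%:C%C * G t w) = N^-1 * Re_phi k (G t).
  rewrite !Re_phiE (_ : (fun w => _) = (fun w => (N^-1)%:C%C * (G t w * conjc (k w)))); last first.
    by apply/funext => w; rewrite mulrA.
  by rewrite (cintZ _ iGk) cReM /=; ring.
rewrite phi_G -/c ler_pdivrMl// => H1.
have := young_power p1 (ltW N0) ler01; rewrite !powR1 NI !mulr1 => H2.
have H3 : N * c <= (I t + (p - 1)) / p * c.
  by apply: ler_wpM2r => //; rewrite ler_pdivlMr// mulrC.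
have : (I t + (p - 1)) / p * c = c + c / p * (I t - 1) by field; rewrite gt_eqF.
lra.
Qed.

(** Subgradient inequality based at F; it ensures that [I t] is positive for small [t]. *)
Let I_ge t : 1 + t * p * (pi^-1 * Psi 0) <= I t.
Proof.
have i1 := disc_integrableZ (t * p) (ipsi 0).1.
have := le_disc_int (disc_integrableD iF i1) (iG t).
rewrite disc_intD// disc_intZ; last exact: (ipsi 0).1.
move=> H; have {}H := H _.
have pi0 : 0 < pi^-1 :> R by rewrite invr_gt0 pi_gt0.
rewrite -normF /I.
have -> : t * p * (pi^-1 * Psi 0) = pi^-1 * (t * p * Psi 0) by ring.
rewrite -mulrDr ler_pM2l//; apply: H => w Dw.
have := dual_power_subgradient (G t w) (F w) p1; rewrite G0.
have -> : G t w - F w = t%:C%C * h w by rewrite /G; ring.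
by rewrite -mulrA cReM /= mul0r subr0 mulrA [p * t]mulrC.
Qed.

(** Subgradient inequality based at [G t]: the slope at the far end bounds the increment from
    above. *)
Let I_le t : I t - 1 <= t * p * (pi^-1 * Psi t).
Proof.
have i1 := disc_integrableZ (- (t * p)) (ipsi t).1.
have := le_disc_int (disc_integrableD (iG t) i1) iF.
rewrite (disc_intD (iG t) i1). rewrite disc_intZ; last exact: (ipsi t).1.
move=> H; have {}H := H _.
have pi0 : 0 < pi^-1 :> R by rewrite invr_gt0 pi_gt0.
rewrite lerBlDr -normF /I.
have -> : t * p * (pi^-1 * Psi t) = pi^-1 * (t * p * Psi t) by ring.
rewrite -mulrDr ler_pM2l// -lerBlDl -mulNr; apply: H => w Dw.
have := dual_power_subgradient (F w) (G t w) p1.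
have -> : F w - G t w = - (t%:C%C * h w) by rewrite /G; ring.
by rewrite mulNr cReN -mulrA cReM /= mul0r subr0 mulrN mulNr mulrA [p * t]mulrC.
Qed.

Let Psi_cvg : (fun n => Psi n.+1%:R^-1) @ \oo --> Psi 0.
Proof.
pose B w := M * (1 + powR (2 : R) p * (powR (cabs (F w)) p + powR M p)).
have iB : disc_integrable B.
  apply: disc_integrableZ; apply: disc_integrableD; first exact: disc_integrable_cst.
  by apply: disc_integrableZ; apply: disc_integrableD iF (disc_integrable_cst _).
have t1 n : n.+1%:R^-1 <= 1 :> R by rewrite invf_le1// ler1n.
have t0 n : 0 < n.+1%:R^-1 :> R by rewrite invr_gt0.
refine (@disc_dominated_convergence R
  (fun n w => Re (h w * conjc (dual_power p (G n.+1%:R^-1 w))))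
  (fun w => Re (h w * conjc (dual_power p (G 0 w)))) B _ iB _ _).2.
- by move=> n; exact: (cintegrable_cmeasurable (ipsi n.+1%:R^-1)).1.
- move=> w Dw; apply/cvgrPdist_le => e e0.
  have hw0 := cabs_ge0 (h w).
  have e1 : 0 < e / (1 + cabs (h w)) by rewrite divr_gt0//; lra.
  have /continuousCP/(_ _ e1)[d d0 dP] := @dual_power_continuous _ _ (F w) p1.
  have d1 : 0 < d / (1 + cabs (h w)) by rewrite divr_gt0//; lra.
  have := near_infty_natSinv_lt (PosNum d1); apply: filterS => n /= nd.
  have Gd : cabs (G n.+1%:R^-1 w - F w) < d.
    rewrite /G addrAC subrr add0r cabsM cabs_real ger0_norm ?(ltW (t0 n))//.
    rewrite ltr_pdivlMr in nd; last lra.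
    by apply: le_lt_trans nd; rewrite ler_pM2l//; lra.
  rewrite G0 distrC; apply: le_trans (Re_dist_le _ _) _.
  have -> : h w * conjc (dual_power p (G n.+1%:R^-1 w)) - h w * conjc (dual_power p (F w)) =
    h w * conjc (dual_power p (G n.+1%:R^-1 w) - dual_power p (F w)) by rewrite rmorphB mulrBr.
  rewrite cabsM cabs_conj; have := dP _ Gd; rewrite ltr_pdivlMr; last lra.
  have := cabs_ge0 (dual_power p (G n.+1%:R^-1 w) - dual_power p (F w)); nra.
- move=> n w Dw; apply: le_trans (Re_le_cabs _) _; rewrite cabsM cabs_conj cabs_dual_power//.
  apply: ler_pM; rewrite ?cabs_ge0 ?powR_ge0 ?hM//.
  set x := cabs _; have x0 : 0 <= x by exact: cabs_ge0.
  have xle : powR x p <= powR (2 : R) p * (powR (cabs (F w)) p + powR M p).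
    apply: le_trans (powRD_le (cabs_ge0 _) M0 (ltW p0)).
    apply: ge0_ler_powR; rewrite ?nnegrE ?addr_ge0 ?cabs_ge0 ?(ltW p0)//.
    apply: le_trans (cabsD _ _) _; rewrite lerD2l; apply: le_trans (th_bound _ Dw) _.
    by rewrite ger0_norm ?(ltW (t0 n))// ler_piMl.
  have [x1|/ltW x1] := leP x 1.
    apply: (@le_trans _ _ 1); last by rewrite lerDl mulr_ge0 ?addr_ge0 ?powR_ge0.
    by apply: powR_le1 => //; rewrite subr_ge0 ltW.
  apply: (@le_trans _ _ (powR x p)); first by apply: ler_powR => //; lra.
  by apply: le_trans xle _; rewrite lerDr.
Qed.

(** Combine [extremal_ineq] with [I_le], divide by t > 0 and let t tend to 0 along 1/(n+1). *)
Lemma extremal_variation_le :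
  Re_phi k h <= c * (pi^-1 * Re (cint (fun w => h w * conjc (dual_power p (F w))))).
Proof.
have -> : Re (cint (fun w => h w * conjc (dual_power p (F w)))) = Psi 0.
  by congr (Re (cint _)); apply/funext => w; rewrite G0.
have H : (fun n => c * (pi^-1 * Psi n.+1%:R^-1)) @ \oo --> c * (pi^-1 * Psi 0).
  by apply: cvgM; [exact: cvg_cst|apply: cvgM; [exact: cvg_cst|exact: Psi_cvg]].
apply: (cvgr_to_ge H).
(* For t < 1 / K the lower bound of [I_ge] is positive, so the competitor can be normalized. *)
set K := 1 + p * `|pi^-1 * Psi 0|.
have K0 : 0 < K by rewrite ltr_pwDl// mulr_ge0// ltW.
have Ki : 0 < K^-1 by rewrite invr_gt0.
have := near_infty_natSinv_lt (PosNum Ki); apply: filterS => n /= nK.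
set t := n.+1%:R^-1 in nK *; have t0 : 0 < t by rewrite invr_gt0.
have I0 : 0 < I t.
  apply: lt_le_trans (I_ge t).
  have tK : t * K < 1 by rewrite -ltr_pdivlMr// div1r.
  have := ler_norm (- (pi^-1 * Psi 0)); rewrite normrN => H1.
  have : - (t * p * (pi^-1 * Psi 0)) <= t * (p * `|pi^-1 * Psi 0|).
    by rewrite -mulrA -mulrN ler_pM2l// -mulrN ler_pM2l.
  have : t * (p * `|pi^-1 * Psi 0|) <= t * K by rewrite ler_pM2l// lerDr.
  lra.
have A1 := extremal_ineq I0.
have A2 : c / p * (I t - 1) <= c / p * (t * p * (pi^-1 * Psi t)).
  by apply: ler_wpM2l (I_le t); rewrite divr_ge0// ltW.
rewrite -(ler_pM2l t0); apply: le_trans A1 _; apply: le_trans A2 _.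
set P := pi^-1 * Psi t.
by apply: le_of_eq; field; rewrite gt_eqF.
Qed.

End Direction.

(** Both sides are complex linear in [h]. The real-part inequality for the multiples 1, -1, i and -i
    of [h] forces equality of both components. *)
Lemma extremal_variation h (M : R) : holo_disc h -> (forall w, Disc w -> cabs (h w) <= M) ->
  cint (fun w => h w * conjc (k w)) =
  (Re_phi k F)%:C%C * cint (fun w => h w * conjc (dual_power p (F w))).
Proof.
move=> hh hM.
have pi0 : 0 < pi^-1 :> R by rewrite invr_gt0 pi_gt0.
have bound (a : R[i]) w : Disc w -> cabs (a * h w) <= cabs a * M.
  by move=> Dw; rewrite cabsM ler_wpM2l ?cabs_ge0// hM.
have ha (a : R[i]) : holo_disc (fun w => a * h w).
  have := @holo_disc_comb a 0 _ _ hh hh; congr holo_disc.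
  by apply/funext => w; rewrite mul0r addr0.
have mh := holo_cmeasurable hh.
have ihk : cintegrable (fun w => h w * conjc (k w)) by exact: cintegrable_conjM ik1 mh hM.
have ihd : cintegrable (fun w => h w * conjc (dual_power p (F w))).
  exact: cintegrable_conjM (cintegrable_dual_power p1 hF iF) mh hM.
have le_dir (a : R[i]) : Re (a * cint (fun w => h w * conjc (k w))) <=
    c * Re (a * cint (fun w => h w * conjc (dual_power p (F w)))).
  have := extremal_variation_le (ha a) (bound a); rewrite Re_phiE mulrCA ler_pM2l//.
  rewrite -(cintZ _ ihk) -(cintZ _ ihd); congr (Re (cint _) <= c * Re (cint _)).
    by apply/funext => w; rewrite mulrA.
  by apply/funext => w; rewrite mulrA.
rewrite -/c; move: le_dir.
move: (cint (fun w => h w * conjc (k w))) (cint (fun w => h w * conjc (dual_power p (F w)))).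
move=> [a b] [a' b'] le_dir; apply/eqP; rewrite eq_complex cReM cImM /= mul0r subr0 mul0r addr0.
have H1 := le_dir (Complex 1 0); have H2 := le_dir (Complex (-1) 0).
have H3 := le_dir (Complex 0 1); have H4 := le_dir (Complex 0 (-1)).
move: H1 H2 H3 H4; rewrite !cReM /= => H1 H2 H3 H4.
by apply/andP; split; apply/eqP/le_anti/andP; split; lra.
Qed.

(** The direction is w |-> (1 - conj z * w)^(-2), the conjugate of the kernel, holomorphic and
    bounded on the disc. Conjugating the variation identity and applying [reproducing] to [k] gives
    the formula. *)
Lemma extremal_representation z : Disc z ->
  (@disc_area R)%:C%C * k z =
  (Re_phi k F)%:C%C * cint (fun w => inv_kernel z w ^+ 2 * dual_power p (F w)).
Proof.
move=> Dz.
have [hk _] := Bk.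
rewrite -(reproducing hk (cintegrable_cabs ik1) Dz).
have hb w : Disc w -> cabs (conjc (inv_kernel z w ^+ 2)) <= (1 - cabs z)^-1 ^+ 2.
  by move=> Dw; rewrite cabs_conj inv_kernelX_bound.
have hh : holo_disc (fun w => conjc (inv_kernel z w ^+ 2)).
  have H : holo_disc (fun w => (1 - conjc z * w) ^- 2) by move=> w Dw; exact: derivable_conj_kernel.
  by move: H; congr holo_disc; apply/funext => w; rewrite conj_kernel2E.
have := extremal_variation hh hb.
have conjE (f : R[i] -> R[i]) : cintegrable f ->
   cint (fun w => conjc (inv_kernel z w ^+ 2) * conjc (f w)) =
   conjc (cint (fun w => inv_kernel z w ^+ 2 * f w)).
  move=> iff; rewrite -cint_conj; last exact: cintegrable_kernelX.
  by apply: eq_cint => w _; rewrite -conjcM.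
rewrite !conjE//; last exact: cintegrable_dual_power.
by move=> /(congr1 conjc); rewrite conjcM !conjcK conjc_real.
Qed.

End Extremal.
End Variation.

(** * Estimates of kernel integrals *)

Section PowerIntegrals.
Context {R : realType}.
Notation mu := (@lebesgue_measure R).
Implicit Types (x y s a c e r A : R).

Lemma powR_continuous c x : 0 < x -> {for x, continuous (fun s : R => powR s c)}.
Proof.
move=> x0; apply: differentiable_continuous; apply/derivable1_diffP.
by apply: derivable_powR; rewrite in_itv/= x0.
Qed.

Lemma integral_powR c x y : 0 < x -> x <= y -> c + 1 != 0 ->
  (\int[mu]_(s in `[x, y]) (powR s c)%:E = ((powR y (c + 1) - powR x (c + 1)) / (c + 1))%:E)%E.
Proof.
move=> x0; rewrite le_eqVlt => /predU1P[<- _|xy c1].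
  by rewrite set_itv1 integral_set1 subrr mul0r.
have pos s : x <= s -> 0 < s by exact: lt_le_trans.
have cF s : 0 < s -> {for s, continuous (fun s : R => (c + 1)^-1 * powR s (c + 1))}.
  move=> s0; apply: (@continuousM _ _ (fun=> (c + 1)^-1) (fun s => powR s (c + 1)) s).
    exact: cst_continuous.
  exact: powR_continuous.
rewrite (@continuous_FTC2 _ _ (fun s => (c + 1)^-1 * powR s (c + 1)))//.
- by rewrite -EFinB; congr EFin; ring.
- apply/continuous_in_subspaceT => s; rewrite inE/= in_itv/= => /andP[xs _].
  exact: powR_continuous (pos _ xs).
- split.
  + move=> s; rewrite in_itv/= => /andP[xs _]; apply: derivableM => //.
    by apply: derivable_powR; rewrite in_itv/= (pos _ (ltW xs)).
  + by apply: cvg_at_right_filter; exact: cF.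
  + by apply: cvg_at_left_filter; apply: cF; exact: lt_trans xy.
- move=> s; rewrite in_itv/= => /andP[xs _]; have s0 := pos _ (ltW xs).
  have H := is_derive1_powR (c + 1) s0.
  rewrite derive1E deriveZ/=; last by case: H.
  rewrite (derive_val (is_derive := H)) /GRing.scale/=.
  have -> : c + 1 - 1 = c by ring.
  by rewrite mulrA mulVf// mul1r.
Qed.

Lemma measurable_powR_itv (D : set R) c : measurable_fun (D : set (measurableTypeR R)) (EFin \o (fun s : R => powR s c)).
Proof. by apply/measurable_EFinP; apply: measurable_funTS; exact: measurable_powR. Qed.

(** The integrand is unbounded at 0, so the interval is exhausted by [A/(n+1), A], with monotone
    convergence. *)
Lemma integral_powR0_le a A : 0 <= a -> a < 1 -> 0 < A ->
  (\int[mu]_(s in `]0%R, A]) (powR s (- a))%:E <= (powR A (1 - a) / (1 - a))%:E)%E.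
Proof.
move=> a0 a1 A0; have a10 : 0 < 1 - a by rewrite subr_gt0.
pose J n : set (measurableTypeR R) := `[(A / n.+1%:R), A]%classic.
have nJ : nondecreasing_seq J.
  move=> m n mn; rewrite subsetEset => s; rewrite /J/= !in_itv/= => /andP[s1 ->]; rewrite andbT.
  by apply: le_trans s1; rewrite ler_pM2l// lef_pV2 ?posrE// ler_nat.
have UJ : \bigcup_n J n = `]0%R, A]%classic.
  apply/seteqP; split => s /=.
    move=> [n _]; rewrite /J/= !in_itv/= => /andP[s1 ->]; rewrite andbT.
    by apply: lt_le_trans s1; rewrite divr_gt0.
  rewrite in_itv/= => /andP[s0 sA].
  have [n _ nd] := near_infty_natSinv_lt (PosNum (divr_gt0 s0 A0)).
  exists n => //; rewrite /J/= in_itv/= sA andbT.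
  by have := nd n (leqnn n); rewrite /= ltr_pdivlMr// mulrC => /ltW.
have := @ge0_nondecreasing_set_cvg_integral _ _ _ J (EFin \o (fun s : R => powR s (- a))) mu nJ
  (fun n => measurable_itv _) (fun n => @measurable_powR_itv _ _) _.
rewrite UJ => H; have {}H := H _.
have cv := H ltac:(by move=> n s _; rewrite lee_fin powR_ge0).
rewrite -(cvg_lim _ cv)//; apply: lime_le; first by apply/cvg_ex; eexists; exact: cv.
apply: nearW => n.
rewrite [X in (X <= _)%E](_ : _ = ((powR A (1 - a) - powR (A / n.+1%:R) (1 - a)) / (1 - a))%:E); last first.
  have -> : 1 - a = - a + 1 by ring.
  apply: integral_powR; first by rewrite divr_gt0.
    by rewrite ler_pdivrMr// ler_peMr ?(ltW A0)// ler1n.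
  by rewrite addrC gt_eqF.
by rewrite lee_fin ler_pM2r ?invr_gt0// gerBl powR_ge0.
Qed.

Lemma ge0_integral_cover d (T : measurableType d) (m : {measure set T -> \bar R})
    (A B C : set T) (f : T -> R) : measurable A -> measurable B -> measurable C ->
  C `<=` A `|` B -> measurable_fun setT f -> (forall x : T, 0 <= f x) ->
  (\int[m]_(x in C) (f x)%:E <= \int[m]_(x in A) (f x)%:E + \int[m]_(x in B) (f x)%:E)%E.
Proof.
move=> mA mB mC CAB mf f0.
have mE (D : set T) : measurable_fun D (fun x : T => (f x)%:E).
  by apply/measurable_EFinP; exact: (measurable_funTS mf).
have fE (D : set T) (x : T) : D x -> (0 <= (f x)%:E)%E by move=> _; rewrite lee_fin.
have mBA : measurable (B `\` A) by exact: measurableD.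
apply: (@le_trans _ _ (\int[m]_(x in A `|` B `\` A) (f x)%:E)%E).
  apply: ge0_subset_integral; [exact: mC|exact: measurableU|exact: mE|exact: fE|].
  by move=> x /CAB[Ax|Bx]; [left|have [Ax|Ax] := pselect (A x); [left|right]].
rewrite (ge0_integral_setU m mA mBA (mE _) (@fE _)).
  by apply: leeD2l; apply: ge0_subset_integral; [exact: mBA|exact: mB|exact: mE|exact: fE|move=> x []].
by apply/disj_setPS => x [Ax [_]].
Qed.

(** Split at s = A. Below, the maximum is constant and a < 1 gives integrability at 0; above, the
    integrand is s^(-a-e), integrable at infinity. Hence the bound does not depend on [r]. *)
Lemma integral_powR_max_le a e r A : 0 <= a -> a < 1 -> 1 < a + e -> 0 <= e -> 0 < A ->
  (\int[mu]_(s in `]0%R, r]) (powR s (- a) * powR (Num.max A s) (- e))%:E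
    <= (((1 - a)^-1 + (a + e - 1)^-1) * powR A (1 - a - e))%:E)%E.
Proof.
move=> a0 a1 ae e0 A0; have a10 : 0 < 1 - a by rewrite subr_gt0.
have ae0 : 0 < a + e - 1 by rewrite subr_gt0.
pose f s := powR s (- a) * powR (Num.max A s) (- e).
have mf : measurable_fun (setT : set (measurableTypeR R)) f.
  apply: measurable_funM; first exact: measurable_powR.
  apply: (measurableT_comp (measurable_powR _)).
  by apply: measurable_maxr; [exact: measurable_cst|exact: measurable_id].
have f0 s : 0 <= f s by rewrite mulr_ge0// powR_ge0.
pose B := Num.max A r.
have AB : A <= B by rewrite le_max lexx.
apply: (le_trans (@ge0_integral_cover _ _ mu `]0, A] `[A, B] _ f _ _ _ _ mf f0)) => //.
  move=> s; rewrite /= !in_itv/= => /andP[s0 sr].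
  by have [sA|/ltW sA] := leP s A; [left; rewrite s0|right; rewrite sA /B le_max sr orbT].
rewrite mulrDl EFinD; apply: leeD.
  have -> : (\int[mu]_(s in `]0%R, A]) (f s)%:E =
      (powR A (- e))%:E * \int[mu]_(s in `]0%R, A]) (powR s (- a))%:E)%E.
    have k0 : (0 <= (powR A (- e))%:E)%E by rewrite lee_fin powR_ge0.
    rewrite -(@ge0_integralZl _ _ _ mu _ (measurable_itv _) _ (@measurable_powR_itv _ (- a)) _ _ k0).
      apply: eq_integral => s; rewrite inE/= in_itv/= => /andP[s0 sA].
      by rewrite /f max_l// -EFinM mulrC.
    by move=> s _; rewrite lee_fin powR_ge0.
  have H := lee_wpmul2l (ltac:(by rewrite lee_fin powR_ge0) : (0 <= (powR A (- e))%:E)%E)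
    (integral_powR0_le a0 a1 A0).
  apply: le_trans H _; rewrite -EFinM lee_fin.
  have -> : powR A (1 - a - e) = powR A (1 - a) * powR A (- e).
    by rewrite -powRD ?(gt_eqF A0) ?implybT.
  by apply: le_of_eq; ring.
have -> : (\int[mu]_(s in `[A, B]) (f s)%:E = \int[mu]_(s in `[A, B]) (powR s (- a - e))%:E)%E.
  apply: eq_integral => s; rewrite inE/= in_itv/= => /andP[sA _].
  have s0 : 0 < s := lt_le_trans A0 sA.
  by rewrite /f max_r// powRD ?(gt_eqF s0) ?implybT.
have E1 : - a - e + 1 = - (a + e - 1) by ring.
rewrite integral_powR//; last by rewrite E1 oppr_eq0 gt_eqF.
rewrite E1 (_ : 1 - a - e = - (a + e - 1)); last by ring.
rewrite lee_fin invrN mulrN -mulNr opprB mulrC ler_pM2l ?invr_gt0//.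
by rewrite gerBl powR_ge0.
Qed.

(** By uniqueness of Lebesgue measure: a reflection maps half-open intervals to half-open intervals
    of the same length, open at the other end. *)
Lemma lebesgue_measure_flip c (D : set R) : measurable D ->
  mu ((fun x => c - x) @^-1` D) = mu D.
Proof.
move=> mD.
have mphi : measurable_fun (setT : set (measurableTypeR R)) (fun x : R => c - x : measurableTypeR R).
  by apply: measurable_funB; [exact: measurable_cst|exact: measurable_id].
pose phi : {mfun measurableTypeR R >-> measurableTypeR R} :=
  HB.pack (fun x : R => c - x : measurableTypeR R) (isMeasurableFun.Build _ _ _ _ _ mphi).
apply/esym; rewrite -[RHS]/(pushforward mu phi D).
apply: lebesgue_measure_unique => //= _ [[a b]] _ <-.
rewrite /pushforward (_ : phi @^-1` _ = `[c - b, c - a[%classic); last first.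
  apply/seteqP; split => x; rewrite /preimage/= !in_itv/=; lra.
rewrite !lebesgue_measure_itv/= !lte_fin (_ : (c - b < c - a) = (a < b)); last by rewrite ltrD2l ltrN2.
by case: ifP => // _; rewrite -!EFinB; congr EFin; ring.
Qed.

Lemma ge0_integral_flip c (D : set (measurableTypeR R)) (f : R -> R) : measurable D ->
  measurable_fun (setT : set (measurableTypeR R)) f -> (forall x, 0 <= f x) ->
  (\int[mu]_(x in ((fun x => (c - x)%R) @^-1` D)) (f (c - x)%R)%:E = \int[mu]_(x in D) (f x)%:E)%E.
Proof.
move=> mD mf f0.
have mphi : measurable_fun (setT : set (measurableTypeR R)) (fun x : R => c - x : measurableTypeR R).
  by apply: measurable_funB; [exact: measurable_cst|exact: measurable_id].
have := @ge0_integral_pushforward _ _ (measurableTypeR R) (measurableTypeR R) R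
  (fun x : R => c - x : measurableTypeR R) mphi mu D (EFin \o f) mD.
move=> <-.
- by apply: eq_measure_integral => A mA _; exact: lebesgue_measure_flip.
- by apply/measurable_EFinP; exact: (measurable_funTS mf).
- by move=> x _; rewrite /= lee_fin.
Qed.

(** A translation is the composition of two reflections. *)
Lemma ge0_integral_shift c (D : set (measurableTypeR R)) (f : R -> R) : measurable D ->
  measurable_fun (setT : set (measurableTypeR R)) f -> (forall x, 0 <= f x) ->
  (\int[mu]_(x in ((fun x => (x + c)%R) @^-1` D)) (f (x + c)%R)%:E = \int[mu]_(x in D) (f x)%:E)%E.
Proof.
move=> mD mf f0; rewrite -(ge0_integral_flip c mD mf f0).
have mE : measurable (((fun x : R => c - x) @^-1` D) : set (measurableTypeR R)).
  rewrite -[X in measurable X]setTI.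
  have mphi : measurable_fun (setT : set (measurableTypeR R)) (fun x : R => c - x : measurableTypeR R).
    by apply: measurable_funB; [exact: measurable_cst|exact: measurable_id].
  exact: mphi.
have mg : measurable_fun (setT : set (measurableTypeR R)) (fun x : R => f (c - x)).
  apply: (measurableT_comp mf).
  by apply: measurable_funB; [exact: measurable_cst|exact: measurable_id].
rewrite -(ge0_integral_flip 0 mE mg (fun x => f0 _)).
have fE : (fun x => c - (0 - x)) = (fun x => x + c) by apply/funext => x; ring.
have -> : (fun x : R => 0 - x) @^-1` ((fun x : R => c - x) @^-1` D) = (fun x => x + c) @^-1` D.
  by rewrite -fE.
by apply: eq_integral => x _; congr (f _)%:E; ring.
Qed.

(** Each distance [s] is attained once on either side of [a], whence the factor 2. *)
Lemma integral_dist_le (g : R -> R) a r :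
  measurable_fun (setT : set (measurableTypeR R)) g -> (forall x, 0 <= g x) ->
  (\int[mu]_(x in [set x : R | (0 < `|x - a| <= r)%R]) (g `|x - a|%R)%:E
   <= 2%:E * \int[mu]_(s in `]0%R, r]) (g s)%:E)%E.
Proof.
move=> mg g0.
have mabs : measurable_fun (setT : set (measurableTypeR R)) (fun x : R => `|x - a|).
  apply: (measurableT_comp (@normr_measurable _ setT)).
  by apply: measurable_funB; [exact: measurable_id|exact: measurable_cst].
have mga : measurable_fun (setT : set (measurableTypeR R)) (fun x : R => g `|x - a|).
  exact: (measurableT_comp mg mabs).
have mC : measurable ([set x | 0 < `|x - a| <= r] : set (measurableTypeR R)).
  rewrite (_ : [set x | _] = (fun x => `|x - a|) @^-1` `]0, r]); last first.
    by apply/seteqP; split => x; rewrite /= in_itv.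
  by rewrite -[X in measurable X]setTI; exact: mabs.
apply: (le_trans (@ge0_integral_cover _ _ mu `[a - r, a[ `]a, a + r] _ _ _ _ mC _ mga (fun x => g0 _))) => //.
  move=> x /= /andP[x0 xr]; rewrite !in_itv/=.
  move: xr; rewrite ler_norml => /andP[x1 x2].
  have [xa|ax|xa] := ltgtP x a; [left; lra|right; lra|].
  by move: x0; rewrite xa subrr normr0 ltxx.
have m0r : measurable (`]0, r]%classic : set (measurableTypeR R)) by [].
rewrite (mule_natl _ 2) mule2n; apply: leeD.
  rewrite -(ge0_integral_flip a m0r mg g0) (_ : _ @^-1` _ = `[a - r, a[%classic); last first.
    by apply/seteqP; split => x; rewrite /= !in_itv/=; lra.
  apply: le_of_eq; apply: eq_integral => x.
  rewrite inE/= in_itv/= => /andP[_ xa]; rewrite ler0_norm ?opprB//; lra.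
rewrite -(ge0_integral_shift (- a) m0r mg g0) (_ : _ @^-1` _ = `]a, a + r]%classic); last first.
  by apply/seteqP; split => x; rewrite /= !in_itv/=; lra.
apply: le_of_eq; apply: eq_integral => x.
rewrite inE/= in_itv/= => /andP[xa _]; rewrite ger0_norm//; lra.
Qed.

Lemma integral_boundary_dist_le (g : R -> R) X :
  measurable_fun (setT : set (measurableTypeR R)) g -> (forall x, 0 <= g x) -> 
  (\int[mu]_(x in `](- X)%R, X[) (g (X - `|x|)%R)%:E
   <= 2%:E * \int[mu]_(s in `]0%R, X]) (g s)%:E)%E.
Proof.
move=> mg g0.
have mabs : measurable_fun (setT : set (measurableTypeR R)) (fun x : R => X - `|x|).
  by apply: measurable_funB; [exact: measurable_cst|exact: normr_measurable].
have mga : measurable_fun (setT : set (measurableTypeR R)) (fun x : R => g (X - `|x|)).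
  exact: (measurableT_comp mg mabs).
apply: (le_trans (@ge0_integral_cover _ _ mu `](- X), 0] `[0, X[ _ _ _ _ _ _ mga (fun x => g0 _))) => //.
  by move=> x /=; rewrite !in_itv/= => /andP[x1 x2]; have [x0|/ltW x0] := leP x 0; [left|right]; lra.
have m0r : measurable (`]0, X]%classic : set (measurableTypeR R)) by [].
rewrite (mule_natl _ 2) mule2n; apply: leeD.
  rewrite -(ge0_integral_shift X m0r mg g0) (_ : _ @^-1` _ = `](- X), 0]%classic); last first.
    by apply/seteqP; split => x; rewrite /= !in_itv/=; lra.
  apply: le_of_eq; apply: eq_integral => x.
  by rewrite inE/= in_itv/= => /andP[_ xa]; rewrite ler0_norm ?opprK// addrC.
rewrite -(ge0_integral_flip X m0r mg g0) (_ : _ @^-1` _ = `[0, X[%classic); last first.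
  by apply/seteqP; split => x; rewrite /= !in_itv/=; lra.
apply: le_of_eq; apply: eq_integral => x.
by rewrite inE/= in_itv/= => /andP[xa _]; rewrite ger0_norm.
Qed.

End PowerIntegrals.

Section PlaneTonelli.
Context {R : realType}.
Notation mu := (@lebesgue_measure R).
Notation leb2 := (@leb2 R).
Notation T1 := (measurableTypeR R).
Notation T2 := (measurableTypeR R * measurableTypeR R)%type.

Lemma tonelli_le_snd (f : R * R -> R) (B : R -> R) (V : \bar R) :
  measurable_fun (setT : set T2) f -> (forall w, 0 <= f w) ->
  measurable_fun (setT : set T1) B ->
  (forall y, \int[mu]_x (f (x, y))%:E <= (B y)%:E)%E ->
  (\int[mu]_y (B y)%:E <= V)%E -> (\int[leb2]_w (f w)%:E <= V)%E.
Proof.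
move=> mf f0 mB fB BV.
have mfE : measurable_fun (setT : set T2) (EFin \o f) by apply/measurable_EFinP.
have f0E (w : T2) : (0 <= (EFin \o f) w)%E by rewrite lee_fin.
have -> : (\int[leb2]_w (f w)%:E = \int[mu]_y \int[mu]_x (f (x, y))%:E)%E.
  have E1 := @fubini_tonelli1 _ _ _ _ R mu mu (EFin \o f) mfE f0E.
  have E2 := @fubini_tonelli _ _ _ _ R mu mu (EFin \o f) mfE f0E.
  exact: etrans E1 E2.
apply: le_trans BV; apply: ge0_le_integral => //.
- by move=> y _; apply: integral_ge0 => x _; rewrite lee_fin.
- exact: (@measurable_fun_fubini_tonelli_G _ _ _ _ R mu (EFin \o f) mfE f0E).
- exact/measurable_EFinP.
Qed.

Lemma tonelli_le_fst (f : R * R -> R) (B : R -> R) (V : \bar R) :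
  measurable_fun (setT : set T2) f -> (forall w, 0 <= f w) ->
  measurable_fun (setT : set T1) B ->
  (forall x, \int[mu]_y (f (x, y))%:E <= (B x)%:E)%E ->
  (\int[mu]_x (B x)%:E <= V)%E -> (\int[leb2]_w (f w)%:E <= V)%E.
Proof.
move=> mf f0 mB fB BV.
have mfE : measurable_fun (setT : set T2) (EFin \o f) by apply/measurable_EFinP.
have f0E (w : T2) : (0 <= (EFin \o f) w)%E by rewrite lee_fin.
have -> : (\int[leb2]_w (f w)%:E = \int[mu]_x \int[mu]_y (f (x, y))%:E)%E.
  exact: (@fubini_tonelli1 _ _ _ _ R mu mu (EFin \o f) mfE f0E).
apply: le_trans BV; apply: ge0_le_integral => //.
- by move=> y _; apply: integral_ge0 => x _; rewrite lee_fin.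
- exact: (@measurable_fun_fubini_tonelli_F _ _ _ _ R mu (EFin \o f) mfE f0E).
- exact/measurable_EFinP.
Qed.

Lemma measurable_max_dist (d a c : R) :
  measurable_fun (setT : set T1) (fun x : R => powR (Num.max d `|x - a|) c).
Proof.
apply: (measurableT_comp (measurable_powR _)).
apply: measurable_maxr; first exact: measurable_cst.
apply: (measurableT_comp (@normr_measurable _ setT)).
by apply: measurable_funB; [exact: measurable_id|exact: measurable_cst].
Qed.

(** The case without the singular factor (a = 0) of [integral_powR_max_le], with distances up to 2.
    The point x = a is split off as a null set. *)
Lemma integral_max_dist_le (d a b : R) : 0 < d -> 0 < b -> `|a| <= 1 ->
  (\int[mu]_(x in `[(-1)%R, 1%R]) (powR (Num.max d `|x - a|) (- (1 + b)))%:E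
   <= (2 * (1 + b^-1) * powR d (- b))%:E)%E.
Proof.
move=> d0 b0 a1.
pose g s : R := powR s (- 0) * powR (Num.max d s) (- (1 + b)).
have gE s : g s = powR (Num.max d s) (- (1 + b)) by rewrite /g oppr0 powRr0 mul1r.
have mg : measurable_fun (setT : set T1) g.
  apply: measurable_funM; first exact: measurable_powR.
  apply: (measurableT_comp (measurable_powR _)).
  by apply: measurable_maxr; [exact: measurable_cst|exact: measurable_id].
have g0 s : 0 <= g s by rewrite mulr_ge0// powR_ge0.
have mabs : measurable_fun (setT : set T1) (fun x : R => `|x - a|).
  apply: (measurableT_comp (@normr_measurable _ setT)).
  by apply: measurable_funB; [exact: measurable_id|exact: measurable_cst].
have mC : measurable ([set x | 0 < `|x - a| <= 2] : set T1).
  rewrite (_ : [set x | _] = (fun x => `|x - a|) @^-1` `]0, 2]); last first.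
    by apply/seteqP; split => x; rewrite /= in_itv.
  by rewrite -[X in measurable X]setTI; exact: mabs.
have H1 := @integral_powR_max_le R 0 (1 + b) 2 d (lexx 0) ltr01 ltac:(lra) ltac:(lra) d0.
have H2 := integral_dist_le a 2 mg g0.
have H3 := @ge0_integral_cover R _ _ mu [set x | 0 < `|x - a| <= 2] [set a] `[-1, 1] _ mC
  (measurable_set1 _) (measurable_itv _) _ (measurable_max_dist d a (- (1 + b)))
  (fun x => powR_ge0 _ _).
apply: le_trans (H3 _) _.
  move=> x /=; rewrite in_itv/= => /andP[x1 x2].
  have [->|xa] := eqVneq x a; [by right|left].
  rewrite normr_gt0 subr_eq0 xa/=; move: a1; rewrite !ler_norml; lra.
rewrite integral_set1 adde0.
have -> : (\int[mu]_(x in [set x : R | (0 < `|x - a| <= 2)%R]) (powR (Num.max d `|x - a|) (- (1 + b)))%:E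
  = \int[mu]_(x in [set x : R | (0 < `|x - a| <= 2)%R]) (g `|x - a|)%:E)%E.
  by apply: eq_integral => x _; rewrite gE.
apply: le_trans H2 _.
have -> : (2 * (1 + b^-1) * powR d (- b)) = 2 * (((1 - 0)^-1 + (0 + (1 + b) - 1)^-1) * powR d (1 - 0 - (1 + b))).
  rewrite subr0 invr1 add0r (_ : 1 + b - 1 = b); last ring.
  by rewrite (_ : 1 - (1 + b) = - b) ?mulrA//; ring.
by rewrite EFinM; apply: lee_wpmul2l => //; rewrite lee_fin.
Qed.

End PlaneTonelli.

Section KernelEstimates.
Context {R : realType}.
Notation mu := (@lebesgue_measure R).
Notation leb2 := (@leb2 R).
Notation T1 := (measurableTypeR R).
Notation T2 := (measurableTypeR R * measurableTypeR R)%type.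
Implicit Types z : R[i].

(** From |1 - z conj w|^2 - |w - z|^2 = (1 - |z|^2)(1 - |w|^2). *)
Lemma kernel_ge_dist z (w : R[i]) : Disc z -> Disc w -> cabs (w - z) <= cabs (1 - z * conjc w).
Proof.
move=> Dz Dw; rewrite -ler_sqr ?nnegrE ?cabs_ge0// -subr_ge0.
have z1 : cabs z ^+ 2 <= 1 by rewrite expr_le1 ?cabs_ge0// ltW.
have w1 : cabs w ^+ 2 <= 1 by rewrite expr_le1 ?cabs_ge0// ltW.
have -> : cabs (1 - z * conjc w) ^+ 2 - cabs (w - z) ^+ 2 =
    (1 - cabs z ^+ 2) * (1 - cabs w ^+ 2).
  by case: z {Dz z1} => a b; case: w {Dw w1} => x y; rewrite !sqr_cabs /=; ring.
by rewrite mulr_ge0// subr_ge0.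
Qed.

Lemma kernel_ge_max z (w : R[i]) : Disc z -> Disc w ->
  Num.max (1 - cabs z) `|Re w - Re z| <= cabs (1 - z * conjc w) /\
  Num.max (1 - cabs z) `|Im w - Im z| <= cabs (1 - z * conjc w).
Proof.
move=> Dz Dw; have H := kernel_ge_dist Dz Dw; have H2 := kernel_lower_l z Dw.
by rewrite !ge_max H2 !(le_trans _ H) ?Re_dist_le ?Im_dist_le.
Qed.

Lemma measurable_comp_fst (g : R -> R) : measurable_fun (setT : set T1) g ->
  measurable_fun (setT : set T2) (fun w : R * R => g w.1).
Proof. by move=> mg; apply: (measurableT_comp mg); exact: measurable_fst. Qed.

Lemma measurable_comp_snd (g : R -> R) : measurable_fun (setT : set T1) g ->
  measurable_fun (setT : set T2) (fun w : R * R => g w.2).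
Proof. by move=> mg; apply: (measurableT_comp mg); exact: measurable_snd. Qed.

Lemma measurable_indic_itv (a b : R) : measurable_fun (setT : set T1) (\1_`[a, b] : R -> R).
Proof. exact: measurable_indic. Qed.

Lemma integral_indicM (D : set T1) (g : R -> R) : measurable D ->
  (\int[mu]_x (g x * \1_D x)%:E = \int[mu]_(x in D) (g x)%:E)%E.
Proof.
move=> mD; rewrite [RHS]integral_mkcond; apply: eq_integral => x _.
rewrite /patch indicE; case: ifPn => xD; first by rewrite mulr1.
by rewrite mulr0.
Qed.

Lemma disc_int_le (g : R[i] -> R) (f : R * R -> R) (V : R) : 
  disc_integrable g -> measurable_fun (setT : set T2) f -> (forall w, 0 <= f w) ->
  (forall w : R * R, DiscR2 w -> 0 <= g (cplx w) <= f w) ->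
  (\int[leb2]_w (f w)%:E <= V%:E)%E -> disc_int g <= V.
Proof.
move=> ig mf f0 gf fV; have mD := @measurable_DiscR2 R.
rewrite -lee_fin /disc_int /Rintegral fineK; last by apply: integrable_fin_num ig.
apply: le_trans fV; apply: (@le_trans _ _ (\int[leb2]_(w in @DiscR2 R) (f w)%:E)%E).
  apply: ge0_le_integral => //.
  - by move=> w /gf /andP[g0 _]; rewrite lee_fin.
  - by apply/measurable_EFinP; exact: (disc_integrable_measurable ig).
  - by apply/measurable_EFinP; exact: (measurable_funTS mf).
  - by move=> w /gf /andP[_ gfw]; rewrite lee_fin.
apply: ge0_subset_integral => //.
- by apply/measurable_EFinP.
- by move=> w _; rewrite lee_fin.
Qed.

(* Since |1 - z conj w| dominates both coordinate distances, the planar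
   integral is bounded by a product of one-dimensional ones. *)
Lemma disc_int_kernel3_le z : Disc z ->
  disc_int (fun w => cabs (inv_kernel z w) ^+ 3) <= 36 / (1 - cabs z).
Proof.
move=> Dz; have d0 : 0 < 1 - cabs z by rewrite subr_gt0.
have half0 : 0 < 2^-1 :> R by [].
set d := 1 - cabs z in d0 *.
have az : `|Re z| <= 1 by apply: le_trans (Re_le_cabs z) (ltW Dz).
have bz : `|Im z| <= 1 by apply: le_trans (Im_le_cabs z) (ltW Dz).
(* The cube is shared equally between the coordinates, each with exponent 3/2 = 1 + b for b = 1/2.
   This gives 2 (1 + 1/b) = 6 per coordinate, and 36 for the product. *)
pose u (c x : R) := powR (Num.max d `|x - c|) (- (1 + 2^-1)).
have mu_ c : measurable_fun (setT : set T1) (fun x => u c x * \1_`[-1, 1] x).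
  by apply: measurable_funM; [exact: measurable_max_dist|exact: measurable_indic_itv].
have u0 c x : 0 <= u c x * \1_`[-1, 1] x by rewrite mulr_ge0 ?powR_ge0// indicE.
have uI c : `|c| <= 1 -> (\int[mu]_x (u c x * \1_`[(-1)%R, 1%R] x)%:E <= (6 * powR d (- 2^-1))%:E)%E.
  move=> c1; rewrite integral_indicM//.
  have := integral_max_dist_le d0 half0 c1; rewrite invrK.
  by have -> : 2 * (1 + 2) = 6 :> R by ring.
pose f (w : R * R) := (u (Re z) w.1 * \1_`[-1, 1] w.1) * (u (Im z) w.2 * \1_`[-1, 1] w.2).
have mf : measurable_fun (setT : set T2) f.
  by apply: measurable_funM; [exact: (measurable_comp_fst (mu_ _))|exact: (measurable_comp_snd (mu_ _))].
have f0 w : 0 <= f w by exact: mulr_ge0.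
have iK : disc_integrable (fun w => cabs (inv_kernel z w) ^+ 3).
  have := cintegrable_cabs (cintegrable_kernel 3 Dz).
  by congr disc_integrable; apply/funext => w; rewrite cabsX.
apply: (disc_int_le iK mf f0).
  move=> [x y] Dw; have [H1 H2] := kernel_ge_max Dz Dw.
  rewrite exprn_ge0 ?cabs_ge0//=.
  have [x1 y1] : \1_`[(-1 : R), 1] x = 1 :> R /\ \1_`[(-1 : R), 1] y = 1 :> R.
    by split; rewrite indicE mem_set//= in_itv/= -ler_norml ltW//;
      apply: le_lt_trans Dw; [exact: (Re_le_cabs (cplx (x, y)))|exact: (Im_le_cabs (cplx (x, y)))].
  rewrite /f /= x1 y1 !mulr1 cabsV /u.
  set m1 := Num.max _ _ in H1 *; set m2 := Num.max _ _ in H2 *.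
  have m10 : 0 < m1 by rewrite lt_max d0.
  have m20 : 0 < m2 by rewrite lt_max d0.
  set K := cabs _ in H1 H2 *; have K0 : 0 < K := lt_le_trans m10 H1.
  have -> : K^-1 ^+ 3 = powR K (- (1 + 2^-1)) * powR K (- (1 + 2^-1)).
    rewrite -powRD ?(gt_eqF K0) ?implybT//.
    have -> : - (1 + 2^-1) + - (1 + 2^-1) = - 3%:R :> R by field.
    by rewrite powR_invn ?(ltW K0)// exprVn.
  have dec m : 0 < m -> m <= K -> powR K (- (1 + 2^-1)) <= powR m (- (1 + 2^-1)).
    move=> m0 mK; rewrite !powRN lef_pV2 ?posrE ?powR_gt0//.
    by apply: ge0_ler_powR; rewrite ?nnegrE// ltW.
  by apply: ler_pM; rewrite ?powR_ge0 ?dec.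
have -> : 36 / d = (6 * powR d (- 2^-1)) * (6 * powR d (- 2^-1)).
  have -> : 6 * powR d (- 2^-1) * (6 * powR d (- 2^-1)) = 36 * (powR d (- 2^-1) * powR d (- 2^-1)) by ring.
  rewrite -powRD ?(gt_eqF d0) ?implybT//; have -> : - 2^-1 + - 2^-1 = - 1 :> R by field.
  by rewrite powR_inv1// ltW.
have c0 : 0 <= 6 * powR d (- 2^-1) by rewrite mulr_ge0 ?powR_ge0.
apply: (tonelli_le_snd (B := fun y => 6 * powR d (- 2^-1) * (u (Im z) y * \1_`[-1, 1] y))) => //.
- by apply: measurable_funM; [exact: measurable_cst|exact: mu_].
- move=> y; rewrite /f /=.
  have -> : (\int[mu]_x (u (Re z) x * \1_`[(-1)%R, 1%R] x * (u (Im z) y * \1_`[(-1)%R, 1%R] y))%:E =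
     (u (Im z) y * \1_`[(-1)%R, 1%R] y)%:E * \int[mu]_x (u (Re z) x * \1_`[(-1)%R, 1%R] x)%:E)%E.
    rewrite -(@ge0_integralZl _ _ _ mu setT measurableT (EFin \o (fun x => u (Re z) x * \1_`[-1, 1] x))).
    + by apply: eq_integral => x _; rewrite -EFinM mulrC.
    + by apply/measurable_EFinP; exact: mu_.
    + by move=> x _; rewrite lee_fin.
    + by rewrite lee_fin.
  rewrite [leRHS](_ : _ = (u (Im z) y * \1_`[(-1)%R, 1%R] y)%:E * (6 * powR d (- 2^-1))%:E)%E; last first.
    by rewrite -EFinM mulrC.
  by apply: lee_wpmul2l; [rewrite lee_fin|exact: uI].
- have -> : (\int[mu]_y (6 * powR d (- 2^-1) * (u (Im z) y * \1_`[(-1)%R, 1%R] y))%:E =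
     (6 * powR d (- 2^-1))%:E * \int[mu]_y (u (Im z) y * \1_`[(-1)%R, 1%R] y)%:E)%E.
    rewrite -(@ge0_integralZl _ _ _ mu setT measurableT (EFin \o (fun y => u (Im z) y * \1_`[-1, 1] y))).
    + by apply: eq_integral => x _; rewrite -EFinM.
    + by apply/measurable_EFinP; exact: mu_.
    + by move=> x _; rewrite lee_fin.
    + by rewrite lee_fin.
  by rewrite [leRHS]EFinM; apply: lee_wpmul2l; [rewrite lee_fin|exact: uI].
Qed.

End KernelEstimates.

Section WeightedKernel.
Context {R : realType}.
Notation mu := (@lebesgue_measure R).
Notation leb2 := (@leb2 R).
Notation T1 := (measurableTypeR R).
Notation T2 := (measurableTypeR R * measurableTypeR R)%type.

Lemma powRN_le (x y c : R) : 0 <= c -> 0 < x -> x <= y -> powR y (- c) <= powR x (- c).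
Proof.
move=> c0 x0 xy; have y0 := lt_le_trans x0 xy.
rewrite !powRN lef_pV2 ?posrE ?powR_gt0//.
by apply: ge0_ler_powR; rewrite ?nnegrE// ltW.
Qed.

(* Where |y| <= |x|, both 1 - |w|^2 and 1 - |w| are comparable to the distance
   from x to the end of the horizontal chord of the disc through w. *)
Lemma weighted_kernel_pointwise (a A x y K : R) : 0 < a -> 0 < A ->
  x ^+ 2 + y ^+ 2 < 1 -> `|y| <= `|x| -> A <= K ->
  (1 - (x ^+ 2 + y ^+ 2)) / 2 <= K ->
  powR (1 - (x ^+ 2 + y ^+ 2)) (- a) * K^-1 ^+ 2 <=
  (16 * powR 2 a) * (powR (Num.sqrt (1 - y ^+ 2) - `|x|) (- a)
    * powR (Num.max A (Num.sqrt (1 - y ^+ 2) - `|x|)) (- 2)).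
Proof.
move=> a0 A0 xy yx AK rK.
set X := Num.sqrt _; set t := `|x| in yx *.
have t0 : 0 <= t by exact: normr_ge0.
have tx : t ^+ 2 = x ^+ 2 by rewrite real_normK// num_real.
have yt : y ^+ 2 <= t ^+ 2.
  by rewrite -(real_normK (num_real y)) ler_sqr ?nnegrE.
have X2 : X ^+ 2 = 1 - y ^+ 2 by rewrite sqr_sqrtr; lra.
have X0 : 0 <= X by exact: sqrtr_ge0.
have tX : t < X by rewrite -ltr_sqr ?nnegrE// X2 tx; lra.
(* Since |y| <= |x| inside the disc, y^2 < 1/2. Hence X + t lies between 1/2 and 2, and 1 - |w|^2 =
   s (X + t) is comparable to [s]. *)
have Xh : 1 / 2 <= X by rewrite -ler_sqr ?nnegrE// X2; nra.
set s := X - t; have s0 : 0 < s by rewrite subr_gt0.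
have rE : 1 - (x ^+ 2 + y ^+ 2) = s * (X + t) by rewrite /s -subr_sqr X2 tx; ring.
have rs : s / 2 <= 1 - (x ^+ 2 + y ^+ 2).
  by rewrite rE ler_pM2l//; lra.
have H1 : powR (1 - (x ^+ 2 + y ^+ 2)) (- a) <= powR 2 a * powR s (- a).
  apply: le_trans (powRN_le (ltW a0) _ rs) _; first by rewrite divr_gt0.
  rewrite powRM ?(ltW s0) ?invr_ge0// mulrC; apply: ler_wpM2r; first exact: powR_ge0.
  by rewrite -powR_inv1// -powRrM mulN1r opprK.
set m := Num.max A s; have m0 : 0 < m by rewrite lt_max A0.
(* [K] dominates [A], and also half of 1 - |w|^2, which is at least s/4. Squaring gives the constant
   16. *)
have mK : m / 4 <= K by rewrite ler_pdivrMr// ge_max; apply/andP; split; lra.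
have K0 : 0 < K by apply: lt_le_trans mK; rewrite divr_gt0.
have H2 : K^-1 ^+ 2 <= 16 * powR m (- 2).
  have -> : 16 * powR m (- 2) = (m / 4)^-1 ^+ 2.
    by rewrite powR_invn ?(ltW m0)//; field; rewrite gt_eqF.
  by apply: lerXn2r; rewrite ?nnegrE ?invr_ge0 ?divr_ge0 ?(ltW m0) ?(ltW K0)// lef_pV2// posrE divr_gt0.
have -> : 16 * powR 2 a * (powR s (- a) * powR m (- 2)) =
  (powR 2 a * powR s (- a)) * (16 * powR m (- 2)) by ring.
by apply: ler_pM; rewrite ?powR_ge0 ?exprn_ge0 ?invr_ge0 ?(ltW K0).
Qed.

Section Chord.
Variables (a d b : R).
Hypotheses (a0 : 0 < a) (a1 : a < 1) (d0 : 0 < d) (b1 : `|b| <= 1).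

Let X (y : R) := Num.sqrt (1 - y ^+ 2).
Let A (y : R) := Num.max d `|y - b|.
Let g (y s : R) : R := powR s (- a) * powR (Num.max (A y) s) (- 2).

(** The majorant of [weighted_kernel_pointwise], restricted to the disc: sqrt(1 - y^2) - |x| is the
    distance to the nearer end of the horizontal chord at height y. *)
Definition chord_weight (w : R * R) : R :=
  powR (Num.sqrt (1 - w.2 ^+ 2) - `|w.1|) (- a) *
  powR (Num.max (Num.max d `|w.2 - b|) (Num.sqrt (1 - w.2 ^+ 2) - `|w.1|)) (- 2) *
  \1_(@DiscR2 R) w.

Lemma chord_weight_ge0 w : 0 <= chord_weight w.
Proof. by rewrite /chord_weight indicE !mulr_ge0 ?powR_ge0. Qed.

Let chordE (x y : R) : chord_weight (x, y) = g y (X y - `|x|) * \1_(@DiscR2 R) (x, y).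
Proof. by []. Qed.

Let A_gt0 y : 0 < A y. Proof. by rewrite lt_max d0. Qed.

Lemma measurable_chord_weight : measurable_fun (setT : set T2) chord_weight.
Proof.
have mX : measurable_fun (setT : set T2) (fun w : R * R => Num.sqrt (1 - w.2 ^+ 2) - `|w.1|).
  apply: measurable_funB.
    apply: (@measurable_comp_snd _ (fun y => Num.sqrt (1 - y ^+ 2))).
    apply: (measurableT_comp (continuous_measurable_fun (@sqrt_continuous R))).
    apply: measurable_funB; first exact: measurable_cst.
    by apply: measurable_funX; exact: measurable_id.
  exact: (@measurable_comp_fst _ _ (@normr_measurable R setT)).
have mA : measurable_fun (setT : set T2) (fun w : R * R => Num.max d `|w.2 - b|).
  apply: (@measurable_comp_snd _ (fun y => Num.max d `|y - b|)).
  apply: measurable_maxr; first exact: measurable_cst.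
  apply: (measurableT_comp (@normr_measurable _ setT)).
  by apply: measurable_funB; [exact: measurable_id|exact: measurable_cst].
apply: measurable_funM; last exact: (measurable_indic measurable_DiscR2).
apply: measurable_funM; first exact: (measurableT_comp (measurable_powR _) mX).
apply: (measurableT_comp (measurable_powR _)); exact: measurable_maxr.
Qed.

Let a_gt1 : 1 < a + 2.
Proof. by apply: (@lt_trans _ _ 2); rewrite ?ltr1n// ltrDr. Qed.

Let Kc : R := 2 * ((1 - a)^-1 + (a + 2 - 1)^-1).
Let Kc0 : 0 <= Kc.
Proof.
rewrite /Kc; apply: mulr_ge0 => //; apply: addr_ge0; rewrite invr_ge0 ?subr_ge0 ?(ltW a1)//.
exact: ltW.
Qed.

(** On the chord at height [y] the variable is the distance to the end, each value of which occurs
    on both halves; [integral_powR_max_le] with e = 2 gives the power 1 - a - 2 = -(1 + a) of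
    [A y]. *)
Let inner y : (\int[mu]_x (chord_weight (x, y))%:E <=
  (Kc * (powR (A y) (- (1 + a)) * \1_`[(-1)%R, 1%R] y))%:E)%E.
Proof.
have mg : measurable_fun (setT : set T1) (g y).
  apply: measurable_funM; first exact: measurable_powR.
  apply: (measurableT_comp (measurable_powR _)).
  by apply: measurable_maxr; [exact: measurable_cst|exact: measurable_id].
have g0 s : 0 <= g y s by rewrite mulr_ge0// powR_ge0.
have [y1|y1] := ltP (y ^+ 2) 1; last first.
  rewrite (_ : (\int[mu]_x _)%E = 0%E); first by rewrite lee_fin; apply: mulr_ge0 Kc0 _; apply: mulr_ge0 (powR_ge0 _ _) _; rewrite indicE.
  apply: integral0_eq => x _.
  rewrite chordE indicE memNset ?mulr0// /DiscR2/Disc/= => xy.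
  have : cabs (cplx (x, y)) ^+ 2 < 1 by rewrite expr_lt1 ?cabs_ge0.
  by rewrite sqr_cabs /=; have := sqr_ge0 x; lra.
have X0 : 0 < X y by rewrite sqrtr_gt0 subr_gt0.
have -> : (\int[mu]_x (chord_weight (x, y))%:E =
    \int[mu]_(x in `](- X y)%R, (X y)%R[) (g y (X y - `|x|))%:E)%E.
  rewrite -[RHS]integral_indicM//; apply: eq_integral => x _; rewrite chordE; congr (_ * _)%:E.
  rewrite !indicE; congr (_ %:R); congr nat_of_bool; apply/idP/idP; rewrite !inE /DiscR2/Disc/= in_itv/= -ltr_norml.
    move=> xy; have : cabs (cplx (x, y)) ^+ 2 < 1 by rewrite expr_lt1 ?cabs_ge0.
    rewrite sqr_cabs /= => H; rewrite -ltr_sqr ?nnegrE ?(ltW X0)//.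
    rewrite real_normK ?num_real// /X sqr_sqrtr; lra.
  move=> xX; rewrite -(expr_lt1 (n := 2)) ?cabs_ge0// sqr_cabs/=.
  have : `|x| ^+ 2 < X y ^+ 2 by rewrite ltr_sqr ?nnegrE ?(ltW X0).
  by rewrite real_normK ?num_real// /X sqr_sqrtr; lra.
apply: le_trans (integral_boundary_dist_le (X y) mg g0) _.
have H := @integral_powR_max_le R a 2 (X y) (A y) (ltW a0) a1 a_gt1 (ler0n _ 2) (A_gt0 y).
have ind1 : \1_`[(-1)%R, 1%R] y = 1 :> R.
  rewrite indicE mem_set//= in_itv/= -ler_norml -(expr_le1 (n := 2))//.
  by rewrite real_normK ?num_real// ltW.
apply: (@le_trans _ _ (2%:E * (((1 - a)^-1 + (a + 2 - 1)^-1) * powR (A y) (1 - a - 2))%:E)%E).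
  by apply: lee_wpmul2l => //; rewrite lee_fin.
rewrite -EFinM lee_fin ind1 mulr1 /Kc mulrA.
by rewrite (_ : 1 - a - 2 = - (1 + a)) //; ring.
Qed.

Let V : R := Kc * (2 * (1 + a^-1) * powR d (- a)).

Let outer : (\int[mu]_y (Kc * (powR (A y) (- (1 + a)) * \1_`[(-1)%R, 1%R] y))%:E <= V%:E)%E.
Proof.
have m1 : measurable_fun (setT : set T1) (fun y => powR (A y) (- (1 + a)) * \1_`[(-1)%R, 1%R] y).
  by apply: measurable_funM; [exact: measurable_max_dist|exact: measurable_indic_itv].
have -> : (\int[mu]_y (Kc * (powR (A y) (- (1 + a)) * \1_`[(-1)%R, 1%R] y))%:E =
   Kc%:E * \int[mu]_y (powR (A y) (- (1 + a)) * \1_`[(-1)%R, 1%R] y)%:E)%E.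
  rewrite -(@ge0_integralZl _ _ _ mu setT measurableT
     (EFin \o (fun y => powR (A y) (- (1 + a)) * \1_`[(-1)%R, 1%R] y))).
  - by apply: eq_integral => y _; rewrite -EFinM.
  - exact/measurable_EFinP.
  - by move=> y _; rewrite lee_fin mulr_ge0 ?powR_ge0// indicE.
  - by rewrite lee_fin.
rewrite integral_indicM// [leRHS]EFinM; apply: lee_wpmul2l; first by rewrite lee_fin.
exact: integral_max_dist_le.
Qed.

Let mB : measurable_fun (setT : set T1) (fun y => Kc * (powR (A y) (- (1 + a)) * \1_`[(-1)%R, 1%R] y)).
Proof.
apply: measurable_funM; first exact: measurable_cst.
by apply: measurable_funM; [exact: measurable_max_dist|exact: measurable_indic_itv].
Qed.

Lemma integral_chord_weight_le : (\int[leb2]_w (chord_weight w)%:E <=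
  (2 * ((1 - a)^-1 + (a + 2 - 1)^-1) * (2 * (1 + a^-1) * powR d (- a)))%:E)%E.
Proof. exact: tonelli_le_snd measurable_chord_weight chord_weight_ge0 mB inner outer. Qed.

Lemma measurable_chord_weight_swap :
  measurable_fun (setT : set T2) (fun w => chord_weight (w.2, w.1)).
Proof.
apply: (measurableT_comp measurable_chord_weight).
by apply: measurable_fun_pair; [exact: measurable_snd|exact: measurable_fst].
Qed.

Lemma integral_chord_weight_swap_le : (\int[leb2]_w (chord_weight (w.2, w.1))%:E <=
  (2 * ((1 - a)^-1 + (a + 2 - 1)^-1) * (2 * (1 + a^-1) * powR d (- a)))%:E)%E.
Proof.
exact: tonelli_le_fst measurable_chord_weight_swap (fun w => chord_weight_ge0 _) mB inner outer.
Qed.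

End Chord.

(** The Forelli-Rudin estimate for a negative power of the weight. The disc is covered by the
    regions |y| <= |x| and |x| <= |y|, treated with horizontal and vertical chords respectively. *)
Lemma weighted_kernel_le (a : R) : 0 < a -> a < 1 -> exists2 C : R, 0 <= C &
  forall z : R[i], Disc z ->
  (\int[leb2]_(w in @DiscR2 R) (powR (boundary_defect (cplx w)) (- a)
     * cabs (inv_kernel z (cplx w)) ^+ 2)%:E <= (C * powR (boundary_defect z) (- a))%:E)%E.
Proof.
move=> a0 a1; pose V0 := 2 * ((1 - a)^-1 + (a + 2 - 1)^-1) * (2 * (1 + a^-1)).
pose K0 := 16 * powR (2 : R) a.
have K00 : 0 <= K0 by rewrite mulr_ge0// powR_ge0.
have V00 : 0 <= V0.
  apply: mulr_ge0; apply: mulr_ge0 => //; apply: addr_ge0 => //; rewrite invr_ge0; lra.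
have c2 : 0 <= 2 * (K0 * V0) by apply: mulr_ge0 => //; exact: mulr_ge0.
exists (2 * (K0 * V0) * powR 2 a); first exact: mulr_ge0 c2 (powR_ge0 _ _).
move=> z Dz; set d := 1 - cabs z; have d0 : 0 < d by rewrite subr_gt0.
have az : `|Re z| <= 1 by apply: le_trans (Re_le_cabs z) (ltW Dz).
have bz : `|Im z| <= 1 by apply: le_trans (Im_le_cabs z) (ltW Dz).
pose f1 w := chord_weight a d (Im z) w.
pose f2 (w : R * R) := chord_weight a d (Re z) (w.2, w.1).
pose f w := K0 * (f1 w + f2 w).
have m1 : measurable_fun (setT : set T2) f1 by exact: measurable_chord_weight.
have m2 : measurable_fun (setT : set T2) f2 by exact: measurable_chord_weight_swap.
have p1 w : 0 <= f1 w by exact: chord_weight_ge0.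
have p2 w : 0 <= f2 w by exact: chord_weight_ge0.
have mf : measurable_fun (setT : set T2) f.
  by apply: measurable_funM; [exact: measurable_cst|exact: measurable_funD].
have fle : (\int[leb2]_w (f w)%:E <= (2 * (K0 * V0) * powR d (- a))%:E)%E.
  have -> : (\int[leb2]_w (f w)%:E = K0%:E * (\int[leb2]_w (f1 w)%:E + \int[leb2]_w (f2 w)%:E))%E.
    rewrite -(@ge0_integralD _ _ _ leb2 setT measurableT (EFin \o f1) (EFin \o f2)).
    - rewrite -(@ge0_integralZl _ _ _ leb2 setT measurableT (fun w => (EFin \o f1) w + (EFin \o f2) w)%E).
      + by apply: eq_integral => w _; rewrite /= -EFinD -EFinM.
      + by apply: emeasurable_funD; exact/measurable_EFinP.
      + by move=> w _; rewrite /= -EFinD lee_fin addr_ge0.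
      + by rewrite lee_fin.
    - by move=> w _; rewrite lee_fin.
    - exact/measurable_EFinP.
    - by move=> w _; rewrite lee_fin.
    - exact/measurable_EFinP.
  have -> : (2 * (K0 * V0) * powR d (- a))%:E = (K0%:E * ((V0 * powR d (- a))%:E + (V0 * powR d (- a))%:E))%E.
    by rewrite -EFinD -EFinM; congr EFin; ring.
  apply: lee_wpmul2l; first by rewrite lee_fin.
  have VE : V0 * powR d (- a) = 2 * ((1 - a)^-1 + (a + 2 - 1)^-1) * (2 * (1 + a^-1) * powR d (- a)).
    by rewrite /V0; ring.
  rewrite VE; apply: leeD; first exact: integral_chord_weight_le.
  exact: integral_chord_weight_swap_le.
(* Passing from 1 - |z| to 1 - |z|^2 <= 2 (1 - |z|) costs the factor 2^a. *)
have rz : powR d (- a) <= powR 2 a * powR (boundary_defect z) (- a).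
  have r0 : 0 < boundary_defect z by rewrite subr_gt0 expr_lt1 ?cabs_ge0.
  have rd : boundary_defect z / 2 <= d.
    by rewrite /boundary_defect /d; have := cabs_ge0 z; have : cabs z < 1 by []; nra.
  apply: le_trans (powRN_le (ltW a0) _ rd) _; first by rewrite divr_gt0.
  rewrite powRM ?(ltW r0) ?invr_ge0// mulrC; apply: ler_wpM2r; first exact: powR_ge0.
  by rewrite -powR_inv1// -powRrM mulN1r opprK.
apply: (@le_trans _ _ (2 * (K0 * V0) * powR d (- a))%:E); last first.
  by rewrite lee_fin -[leRHS]mulrA; exact: ler_wpM2l c2 _ _ rz.
apply: le_trans fle.
have pw w : DiscR2 w -> powR (boundary_defect (cplx w)) (- a) * cabs (inv_kernel z (cplx w)) ^+ 2 <= f w.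
  case: w => x y Dw; have [H1 H2] := kernel_ge_max Dz Dw.
  have H3 := kernel_lower_r (cplx (x, y)) Dz.
  set K := cabs (1 - _) in H1 H2 H3.
  have cw : cabs (cplx (x, y)) < 1 by [].
  have c0 := cabs_ge0 (cplx (x, y)).
  have xy : x ^+ 2 + y ^+ 2 < 1.
    by rewrite -[X in X < _](sqr_cabs (cplx (x, y))) expr_lt1.
  have rE : boundary_defect (cplx (x, y)) = 1 - (x ^+ 2 + y ^+ 2) by rewrite /boundary_defect sqr_cabs.
  have rK : (1 - (x ^+ 2 + y ^+ 2)) / 2 <= K.
    by apply: le_trans H3; rewrite -rE /boundary_defect; nra.
  have i1 : \1_(@DiscR2 R) (x, y) = 1 :> R by rewrite indicE mem_set.
  have i2 : \1_(@DiscR2 R) (y, x) = 1 :> R.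
    rewrite indicE mem_set// /DiscR2/Disc/= -(expr_lt1 (n := 2)) ?cabs_ge0// sqr_cabs/=.
    by rewrite addrC.
  rewrite /inv_kernel cabsV -/K rE.
  have [yx|/ltW yx] := leP `|y| `|x|.
    have m0 : 0 < Num.max d `|y - Im z| by rewrite lt_max d0.
    apply: le_trans (weighted_kernel_pointwise a0 m0 xy yx H2 rK) _.
    by rewrite /f ler_wpM2l// /f1 /chord_weight /= i1 mulr1 lerDl.
  have m0 : 0 < Num.max d `|x - Re z| by rewrite lt_max d0.
  rewrite [x ^+ 2 + _]addrC in xy rK *.
  apply: le_trans (weighted_kernel_pointwise a0 m0 xy yx H1 rK) _.
  by rewrite /f ler_wpM2l// /f2 /chord_weight /= i2 mulr1 lerDr.
have mD := @measurable_DiscR2 R.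
have mrho : disc_measurable (fun w : R[i] => powR (boundary_defect w) (- a)).
  apply: disc_measurable_powR; apply: measurable_funB; first exact: measurable_cst.
  apply: measurable_funX; apply: (@disc_measurable_cabs _ (fun w => w)).
  by apply: disc_measurable_continuous => w _; exact: ccont_id.
have mK : disc_measurable (fun w : R[i] => cabs (inv_kernel z w) ^+ 2).
  apply: measurable_funX; apply: (@disc_measurable_cabs _ (inv_kernel z)).
  by apply: disc_measurable_continuous => w Dw; exact: inv_kernel_continuous.
apply: (@le_trans _ _ (\int[leb2]_(w in @DiscR2 R) (f w)%:E)%E).
  apply: ge0_le_integral => //.
  - by move=> w _; rewrite lee_fin mulr_ge0 ?powR_ge0// exprn_ge0// cabs_ge0.
  - by apply/measurable_EFinP; exact: (measurable_funM mrho mK).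
  - by apply/measurable_EFinP; exact: (measurable_funTS mf).
apply: (@ge0_subset_integral _ _ _ leb2 _ setT mD measurableT (EFin \o f)).
- by apply/measurable_EFinP; exact: mf.
- by move=> w _; rewrite lee_fin; apply: mulr_ge0 K00 _; exact: addr_ge0.
- by [].
Qed.

End WeightedKernel.

(** * Schur's test for the Bergman projection *)

(* The library's sigma-finiteness instance for [m1 \x m2] is shadowed by its
   instance for subprobabilities, hence this renamed copy of [leb2]. *)
Section SigmaFinitePlane.
Context {R : realType}.
Notation mu := (@lebesgue_measure R).

Let leb2_sigma_finite : sigma_finite setT (@leb2 R).
Proof.
have /sigma_finiteP[F [TF ndF Foo]] := sigma_finiteT mu.
exists (fun n => F n `*` F n).
  rewrite -setXTT TF predeqE => -[x y]; split.
    move=> [/= [n _ Fnx] [k _ Gky]]; exists (maxn n k) => //; split.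
    - by move: x Fnx; exact/subsetPset/ndF/leq_maxl.
    - by move: y Gky; exact/subsetPset/ndF/leq_maxr.
  by move=> [n _ []/= ? ?]; split; exists n.
move=> k; have [? ?] := Foo k; split; first exact: measurableX.
by rewrite /leb2 product_measure1E// lte_mul_pinfty// ge0_fin_numE.
Qed.

Definition plane_measure : set (measurableTypeR R * measurableTypeR R) -> \bar R := @leb2 R.
HB.instance Definition _ := Measure.on plane_measure.
HB.instance Definition _ := Measure_isSigmaFinite.Build _ _ _ plane_measure leb2_sigma_finite.

End SigmaFinitePlane.

Section Schur.
Context {R : realType}.
Notation mu := (@lebesgue_measure R).
Notation leb2 := (@leb2 R).
Notation T2 := (measurableTypeR R * measurableTypeR R)%type.

Lemma cabs_inv_kernelC (z w : R[i]) : cabs (inv_kernel z w) = cabs (inv_kernel w z).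
Proof. by rewrite !cabsV -cabs_conj -conj_kernelE mulrC. Qed.

Lemma boundary_defect_gt0 (z : R[i]) : Disc z -> 0 < boundary_defect z.
Proof. by move=> Dz; rewrite subr_gt0 expr_lt1 ?cabs_ge0. Qed.

Lemma boundary_defect_le1 (z : R[i]) : boundary_defect z <= 1.
Proof. by rewrite gerBl sqr_ge0. Qed.

Lemma measurable_boundary_defect : disc_measurable (@boundary_defect R).
Proof.
apply: measurable_funB; first exact: measurable_cst.
apply: measurable_funX; apply: (@disc_measurable_cabs _ (fun w => w)).
by apply: disc_measurable_continuous => w _; exact: ccont_id.
Qed.

Lemma measurable_cabs_inv_kernelX (z : R[i]) n : Disc z ->
  disc_measurable (fun w => cabs (inv_kernel z w) ^+ n).
Proof.
move=> Dz; apply: measurable_funX; apply: (@disc_measurable_cabs _ (inv_kernel z)).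
by apply: disc_measurable_continuous => w Dw; exact: inv_kernel_continuous.
Qed.

Lemma disc_integrable_kernelM (z : R[i]) n (g : R[i] -> R) : Disc z -> disc_integrable g ->
  disc_integrable (fun w => cabs (inv_kernel z w) ^+ n * g w).
Proof.
move=> Dz ig.
have i2 := disc_integrableZ ((1 - cabs z)^-1 ^+ n) (integrable_norm ig : disc_integrable (fun w => `|g w|)).
apply: disc_integrable_le i2 _.
  exact: (measurable_funM (measurable_cabs_inv_kernelX n Dz) (disc_integrable_measurable ig)).
move=> w Dw; rewrite normrM ler_wpM2r// ger0_norm ?exprn_ge0 ?cabs_ge0//.
by rewrite -cabsX inv_kernelX_bound.
Qed.

Lemma disc_integral_integrable (g : R[i] -> R) (V : R) : disc_measurable g ->
  (forall w, Disc w -> 0 <= g w) ->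
  (\int[leb2]_(w in @DiscR2 R) (g (cplx w))%:E <= V%:E)%E ->
  disc_integrable g /\ disc_int g <= V.
Proof.
move=> mg g0 gV.
have ig : disc_integrable g.
  apply/integrableP; split; first exact/measurable_EFinP.
  apply: le_lt_trans (ltry V); apply: le_trans gV.
  apply: le_of_eq; apply: eq_integral => w /set_mem Dw /=.
  by rewrite ger0_norm// g0.
split=> //; rewrite -lee_fin /disc_int /Rintegral fineK//.
by apply: integrable_fin_num ig; exact: measurable_DiscR2.
Qed.

Variables (q : R) (f : R[i] -> R).
Hypotheses (q1 : 1 < q) (mf : disc_measurable f) (f0 : forall w, 0 <= f w).
Hypotheses (fi : disc_integrable f) (fq : disc_integrable (fun w => powR (f w) q)).

Let q0 : 0 < q. Proof. exact: lt_trans q1. Qed.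
(** [a] and [b] are 1/q and 1/q' with q' conjugate to q: the exponents q'/(q q') and q/(q q') that
    the test function rho^(-1/(q q')) produces. Both lie strictly between 0 and 1. *)
Let a : R := q^-1.
Let b : R := 1 - q^-1.
Let a0 : 0 < a. Proof. by rewrite invr_gt0. Qed.
Let a1 : a < 1. Proof. by rewrite invf_lt1. Qed.
Let b0 : 0 < b. Proof. by rewrite subr_gt0 invf_lt1. Qed.
Let b1 : b < 1. Proof. by rewrite gtrBl invr_gt0. Qed.

Notation rho := (@boundary_defect R).
Let H (w : R[i]) : R := powR (f w) q * powR (rho w) b.

Let iH : disc_integrable H.
Proof.
apply: disc_integrable_le fq _.
  exact: measurable_funM (disc_measurable_powR q mf) (disc_measurable_powR b measurable_boundary_defect).
move=> w Dw; rewrite /H ger0_norm ?mulr_ge0 ?powR_ge0// ler_piMr ?powR_ge0//.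
by apply: powR_le1; rewrite ?boundary_defect_le1// ltW// boundary_defect_gt0.
Qed.

Let H_ge0 w : 0 <= H w. Proof. by rewrite mulr_ge0 ?powR_ge0. Qed.

(* Hoelder's inequality for the measure rho^(-a) |1 - z conj w|^(-2), in the
   form of the tangent line inequality at the point L / N. *)
Let schur_pointwise : exists2 C : R, 0 <= C & forall z, Disc z ->
  powR (disc_int (fun w => cabs (inv_kernel z w) ^+ 2 * f w)) q <=
  C * powR (rho z) (- b) * disc_int (fun w => cabs (inv_kernel z w) ^+ 2 * H w).
Proof.
have [C C0 HC] := weighted_kernel_le a0 a1.
have C10 : 0 < C + 1 by lra.
exists (powR (C + 1) (q - 1)); first exact: powR_ge0.
move=> z Dz; have rz := boundary_defect_gt0 Dz.
set L := disc_int (fun w => _ * f w); set M := disc_int (fun w => _ * H w).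
(* [C + 1] instead of [C], so that [N] is positive and can be divided by. *)
set N := (C + 1) * powR (rho z) (- a).
have N0 : 0 < N by rewrite mulr_gt0// powR_gt0.
have L0 : 0 <= L by apply: disc_int_ge0 => w _; rewrite mulr_ge0// exprn_ge0// cabs_ge0.
pose x0 := L / N; have x00 : 0 <= x0 by rewrite divr_ge0// ltW.
pose g w := cabs (inv_kernel z w) ^+ 2 * f w.
pose h w := powR (rho w) (- a) * cabs (inv_kernel z w) ^+ 2.
have mh : disc_measurable h.
  exact: (measurable_funM (disc_measurable_powR (- a) measurable_boundary_defect)
    (measurable_cabs_inv_kernelX 2 Dz)).
have h0 w : Disc w -> 0 <= h w by rewrite mulr_ge0 ?powR_ge0// exprn_ge0// cabs_ge0.
have [ih hN] := disc_integral_integrable mh h0 (HC z Dz).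
have {}hN : disc_int h <= N.
  by apply: le_trans hN _; rewrite /N ler_wpM2r ?powR_ge0// lerDl.
have ig : disc_integrable g by exact: disc_integrable_kernelM.
have iM : disc_integrable (fun w => cabs (inv_kernel z w) ^+ 2 * H w) by exact: disc_integrable_kernelM.
have pt w : Disc w -> q * powR x0 (q - 1) * g w <=
    cabs (inv_kernel z w) ^+ 2 * H w + (q - 1) * powR x0 q * h w.
  move=> Dw; have rw := boundary_defect_gt0 Dw.
  (* Young for f rho^a against [x0], multiplied by [h]. On the left rho^a rho^(-a) = 1 leaves [g];
     on the right (rho^a)^q = rho and rho rho^(-a) = rho^b give [H]. *)
  have Y := young_power q1 (mulr_ge0 (f0 w) (powR_ge0 (rho w) a)) x00.
  have := ler_wpM2r (h0 w Dw) Y; rewrite mulrDl /h.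
  have E1 : powR (rho w) a * powR (rho w) (- a) = 1.
    by rewrite -powRD ?(gt_eqF rw) ?implybT// subrr powRr0.
  have -> : q * (f w * powR (rho w) a * powR x0 (q - 1)) * (powR (rho w) (- a) * cabs (inv_kernel z w) ^+ 2)
     = q * powR x0 (q - 1) * g w * (powR (rho w) a * powR (rho w) (- a)) by rewrite /g; ring.
  rewrite E1 mulr1 => /le_trans; apply; rewrite lerD2r /H.
  rewrite powRM ?powR_ge0// -powRrM /a mulVf ?gt_eqF// powRr1 ?(ltW rw)//.
  have -> : powR (rho w) b = rho w * powR (rho w) (- q^-1).
    by rewrite /b -[X in X * _](powRr1 (ltW rw)) -powRD ?(gt_eqF rw) ?implybT.
  by apply: le_of_eq; ring.
have := le_disc_int (disc_integrableZ (q * powR x0 (q - 1)) ig)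
  (disc_integrableD iM (disc_integrableZ ((q - 1) * powR x0 q) ih)) pt.
rewrite (disc_intZ _ ig) (disc_intD iM (disc_integrableZ _ ih)) (disc_intZ _ ih) -/L -/M => HL.
have q10 : 0 <= (q - 1) * powR x0 q by rewrite mulr_ge0 ?powR_ge0// subr_ge0 ltW.
have H2 := ler_wpM2l q10 hN.
have E2 : powR x0 q = powR x0 (q - 1) * x0.
  by rewrite [RHS]mulrC mulr_powRB1.
have E3 : x0 * N = L by rewrite /x0 divfK// gt_eqF.
(* With x0 = L / N the term (q - 1) x0^q N equals (q - 1) x0^(q-1) L and is absorbed on the left,
   leaving the coefficient q - (q - 1) = 1. *)
have H3 : powR x0 (q - 1) * L <= M.
  have E4 : (q - 1) * powR x0 q * N = (q - 1) * (powR x0 (q - 1) * L).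
    by rewrite E2 -E3; ring.
  rewrite E4 in H2; move: HL H2; rewrite -/(disc_int g) /g -/L; lra.
have E5 : powR x0 (q - 1) = powR L (q - 1) / powR N (q - 1).
  rewrite /x0 powRM ?invr_ge0 ?(ltW N0)//; congr (_ * _).
  by rewrite -powR_inv1 ?(ltW N0)// -powRrM mulN1r powRN.
have N1 : 0 < powR N (q - 1) by rewrite powR_gt0.
rewrite -(mulr_powRB1 L0 q0).
(* The exponents match because a (q - 1) = b. *)
have -> : powR (C + 1) (q - 1) * powR (rho z) (- b) = powR N (q - 1).
  rewrite /N powRM ?powR_ge0 ?(ltW C10)// -powRrM; congr (_ * powR _ _).
  by rewrite /a /b; field; rewrite gt_eqF.
rewrite mulrC -[leRHS]mulrC -ler_pdivrMr//; apply: le_trans H3.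
by rewrite E5; apply: le_of_eq; ring.
Qed.

(** Integrate the q-th power of the pointwise bound, exchange the integrals by Tonelli, and apply
    the weighted kernel estimate once more, now in z and with exponent [b]. *)
Lemma bergman_schur (k : R[i] -> R[i]) (K : R) : cmeasurable k -> 0 <= K ->
  (forall z, Disc z -> cabs (k z) <= K * disc_int (fun w => cabs (inv_kernel z w) ^+ 2 * f w)) ->
  Lp_integrable q k.
Proof.
move=> mk K0 kK; have [C C0 HC] := schur_pointwise.
have [C2 C20 HC2] := weighted_kernel_le b0 b1.
have mD := @measurable_DiscR2 R.
pose r : T2 -> R := (fun z => powR (rho (cplx z)) (- b)) \_ (@DiscR2 R).
pose h : T2 -> R := (fun w => H (cplx w)) \_ (@DiscR2 R).
(* |1 - z conj w|^2 as a polynomial in the four real coordinates, which makes joint measurability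
   evident. [r] and [h] carry the restriction to the disc. *)
pose P (zw : T2 * T2) : R :=
  (1 - (zw.1.1 * zw.2.1 + zw.1.2 * zw.2.2)) ^+ 2 + (zw.1.2 * zw.2.1 - zw.1.1 * zw.2.2) ^+ 2.
have PE (z w : R * R) : powR (P (z, w)) (- 1) = cabs (inv_kernel (cplx z) (cplx w)) ^+ 2.
  rewrite powR_inv1 ?addr_ge0 ?sqr_ge0// cabsV exprVn sqr_cabs /P /=.
  by congr (_^-1); ring.
pose K' := powR K q * C.
have K'0 : 0 <= K' by rewrite mulr_ge0// powR_ge0.
pose Phi (zw : T2 * T2) : R := K' * (r zw.1 * (h zw.2 * powR (P zw) (- 1))).
have mr : measurable_fun (setT : set T2) r.
  by apply/(measurable_restrictT _ mD); exact: disc_measurable_powR measurable_boundary_defect.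
have mh : measurable_fun (setT : set T2) h.
  by apply/(measurable_restrictT _ mD); exact: disc_integrable_measurable iH.
have r0 z : 0 <= r z by rewrite /r /patch; case: ifP => _ //; exact: powR_ge0.
have h0 w : 0 <= h w by rewrite /h /patch; case: ifP.
have mP : measurable_fun (setT : set (T2 * T2)) P.
  have m1 : measurable_fun (setT : set (T2 * T2)) (fun zw : T2 * T2 => zw.1.1).
    exact: (measurableT_comp measurable_fst measurable_fst).
  have m2 : measurable_fun (setT : set (T2 * T2)) (fun zw : T2 * T2 => zw.1.2).
    exact: (measurableT_comp measurable_snd measurable_fst).
  have m3 : measurable_fun (setT : set (T2 * T2)) (fun zw : T2 * T2 => zw.2.1).
    exact: (measurableT_comp measurable_fst measurable_snd).
  have m4 : measurable_fun (setT : set (T2 * T2)) (fun zw : T2 * T2 => zw.2.2).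
    exact: (measurableT_comp measurable_snd measurable_snd).
  apply: measurable_funD; apply: measurable_funX; apply: measurable_funB.
  - exact: measurable_cst.
  - by apply: measurable_funD; exact: measurable_funM.
  - exact: measurable_funM.
  - exact: measurable_funM.
have mPhi : measurable_fun (setT : set (T2 * T2)) (EFin \o Phi).
  apply/measurable_EFinP; apply: measurable_funM; first exact: measurable_cst.
  apply: measurable_funM; first exact: (measurableT_comp mr measurable_fst).
  apply: measurable_funM; first exact: (measurableT_comp mh measurable_snd).
  exact: (measurableT_comp (measurable_powR _) mP).
have Phi0 (zw : T2 * T2) : (0 <= (EFin \o Phi) zw)%E.
  by rewrite lee_fin; apply: mulr_ge0 K'0 _; apply: mulr_ge0 (r0 _) _; apply: mulr_ge0 (h0 _) (powR_ge0 _ _).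
have mkq : disc_measurable (fun z => powR (cabs (k z)) q).
  by apply: disc_measurable_powR; exact: disc_measurable_cabs.
have innerw (z : R * R) : DiscR2 z ->
    ((powR (cabs (k (cplx z))) q)%:E <= \int[leb2]_w (Phi (z, w))%:E)%E.
  move=> Dz.
  have -> : (\int[leb2]_w (Phi (z, w))%:E = (K' * r z)%:E *
      \int[leb2]_(w in @DiscR2 R) (cabs (inv_kernel (cplx z) (cplx w)) ^+ 2 * H (cplx w))%:E)%E.
    rewrite [X in (_ * X)%E]integral_mkcond.
    rewrite -(@ge0_integralZl _ _ _ leb2 setT measurableT).
    - apply: eq_integral => w _; rewrite /Phi /= PE /h /patch; case: ifP => _.
        by rewrite -EFinM; congr EFin; ring.
      by rewrite mule0 mul0r !mulr0.
    - apply/(measurable_restrictT _ mD); apply/measurable_EFinP.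
      exact: (disc_integrable_measurable (disc_integrable_kernelM 2 Dz iH)).
    - by move=> w _; rewrite /patch; case: ifP => // _; rewrite lee_fin mulr_ge0// exprn_ge0// cabs_ge0.
    - by rewrite lee_fin mulr_ge0.
  have iM := disc_integrable_kernelM 2 Dz iH.
  have -> : (\int[leb2]_(w in @DiscR2 R) (cabs (inv_kernel (cplx z) (cplx w)) ^+ 2 * H (cplx w))%:E =
     (disc_int (fun w => cabs (inv_kernel (cplx z) w) ^+ 2 * H w))%:E)%E.
    by rewrite /disc_int /Rintegral fineK//; apply: integrable_fin_num iM.
  rewrite -EFinM lee_fin; have L0 : 0 <= disc_int (fun w => cabs (inv_kernel (cplx z) w) ^+ 2 * f w).
    by apply: disc_int_ge0 => w _; rewrite mulr_ge0// exprn_ge0// cabs_ge0.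
  apply: (@le_trans _ _ (powR (K * disc_int (fun w => cabs (inv_kernel (cplx z) w) ^+ 2 * f w)) q)).
    by apply: ge0_ler_powR; rewrite ?nnegrE ?cabs_ge0 ?mulr_ge0 ?(ltW q0)//; exact: kK.
  rewrite powRM// /K' -!mulrA; apply: ler_wpM2l; first exact: powR_ge0.
  rewrite /r /patch mem_set// mulrA; exact: HC.
(* The factor rho^(-b) from the kernel estimate cancels the rho^b in [H], leaving f^q. *)
have innerz (w : R * R) : (\int[leb2]_z (Phi (z, w))%:E <=
    (K' * C2)%:E * ((fun w => (powR (f (cplx w)) q)%:E) \_ (@DiscR2 R)) w)%E.
  rewrite [leRHS](_ : _ = (K' * C2 * ((fun w => powR (f (cplx w)) q) \_ (@DiscR2 R)) w)%:E); last first.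
    by rewrite /patch; case: ifP => _; rewrite -EFinM.
  have [Dw|nDw] := pselect (DiscR2 w); last first.
    rewrite integral0_eq; last first.
      by move=> z _; rewrite /Phi /h /patch /= memNset// mul0r !mulr0.
    by rewrite /patch memNset// mulr0.
  have -> : (\int[leb2]_z (Phi (z, w))%:E = (K' * H (cplx w))%:E *
      \int[leb2]_(z in @DiscR2 R) (powR (rho (cplx z)) (- b) * cabs (inv_kernel (cplx w) (cplx z)) ^+ 2)%:E)%E.
    rewrite [X in (_ * X)%E]integral_mkcond.
    rewrite -(@ge0_integralZl _ _ _ leb2 setT measurableT).
    - apply: eq_integral => z _; rewrite /Phi /= PE /h /r /patch (mem_set Dw) cabs_inv_kernelC; case: ifP => _.
        by rewrite -EFinM; congr EFin; ring.
      by rewrite mule0 mul0r !mulr0.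
    - apply/(measurable_restrictT _ mD); apply/measurable_EFinP.
      exact: (measurable_funM (disc_measurable_powR (- b) measurable_boundary_defect)
        (measurable_cabs_inv_kernelX 2 Dw)).
    - by move=> z _; rewrite /patch; case: ifP => // _; rewrite lee_fin mulr_ge0 ?powR_ge0// exprn_ge0// cabs_ge0.
    - by rewrite lee_fin mulr_ge0.
  apply: (@le_trans _ _ ((K' * H (cplx w))%:E * (C2 * powR (rho (cplx w)) (- b))%:E)%E).
    by apply: lee_wpmul2l; [rewrite lee_fin mulr_ge0|exact: HC2].
  have rw := boundary_defect_gt0 Dw.
  rewrite -EFinM lee_fin /patch mem_set// /H.
  have -> : K' * (powR (f (cplx w)) q * powR (rho (cplx w)) b) * (C2 * powR (rho (cplx w)) (- b)) =
    K' * C2 * powR (f (cplx w)) q * (powR (rho (cplx w)) b * powR (rho (cplx w)) (- b)) by ring.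
  by rewrite -powRD ?(gt_eqF rw) ?implybT// subrr powRr0 mulr1.
have fin : (\int[leb2]_(z in @DiscR2 R) (powR (cabs (k (cplx z))) q)%:E <=
    (K' * C2 * disc_int (fun w => powR (f w) q))%:E)%E.
  apply: (@le_trans _ _ (\int[leb2]_z \int[leb2]_w (Phi (z, w))%:E)%E).
    rewrite integral_mkcond; apply: ge0_le_integral => //.
    - by move=> z _; rewrite /patch; case: ifP => // _; rewrite lee_fin powR_ge0.
    - by apply/(measurable_restrictT _ mD); exact/measurable_EFinP.
    - exact: (@measurable_fun_fubini_tonelli_F _ _ T2 T2 R (@plane_measure R) (EFin \o Phi) mPhi Phi0).
    - move=> z _; rewrite /patch; case: ifPn => [/set_mem|_]; first exact: innerw.
      by apply: integral_ge0 => w _; exact: Phi0.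
  have -> : (\int[leb2]_z \int[leb2]_w (Phi (z, w))%:E = \int[leb2]_w \int[leb2]_z (Phi (z, w))%:E)%E.
    exact: (@fubini_tonelli _ _ T2 T2 R (@plane_measure R) (@plane_measure R) (EFin \o Phi) mPhi Phi0).
  have mfq : measurable_fun (setT : set T2) ((fun w => (powR (f (cplx w)) q)%:E) \_ (@DiscR2 R)).
    by apply/(measurable_restrictT _ mD); apply/measurable_EFinP; exact: disc_measurable_powR mf.
  apply: (@le_trans _ _ (\int[leb2]_w ((K' * C2)%:E * ((fun w => (powR (f (cplx w)) q)%:E) \_ (@DiscR2 R)) w))%E).
    apply: ge0_le_integral => //.
    - by move=> w _; apply: integral_ge0 => z _; exact: Phi0.
    - exact: (@measurable_fun_fubini_tonelli_G _ _ T2 T2 R (@plane_measure R) (EFin \o Phi) mPhi Phi0).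
    - exact: measurable_funeM.
  rewrite (@ge0_integralZl _ _ _ leb2 setT measurableT _ mfq); last 2 first.
  - by move=> w _; rewrite /patch; case: ifP => // _; rewrite lee_fin powR_ge0.
  - by rewrite lee_fin mulr_ge0.
  rewrite -integral_mkcond [leRHS]EFinM /disc_int /Rintegral fineK//.
  by apply: integrable_fin_num fq.
have [//] := disc_integral_integrable mkq (fun z _ => powR_ge0 _ _) fin.
Qed.

End Schur.

Section ExtremalRegularity.
Context {R : realType}.
Variables (p : R) (k F : R[i] -> R[i]).
Hypotheses (p1 : 1 < p) (Bk : in_Bergman (p / (p - 1)) k) (ext : extremal_function p k F).

Let BF : in_Bergman p F. Proof. by case: ext. Qed.

Lemma extremal_dual_integrable : cintegrable (fun w => dual_power p (F w)).
Proof. by have [hF _] := BF; exact: cintegrable_dual_power (Bergman_integrable BF). Qed.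

Lemma extremal_kernel_bound z : Disc z ->
  cabs (k z) <= 2 * `|Re_phi k F| / (@disc_area R) *
    disc_int (fun w => cabs (inv_kernel z w) ^+ 2 * powR (cabs (F w)) (p - 1)).
Proof.
move=> Dz; have A0 := @disc_area_gt0 R; have iG := extremal_dual_integrable.
have H := congr1 (@cabs R) (extremal_representation p1 Bk ext Dz).
move: H; rewrite !cabsM !cabs_real (gtr0_norm A0) => H.
have B := cabs_cint_le (cintegrable_kernelX 2 Dz iG)
  (cintegrable_cabs (cintegrable_kernelX 2 Dz iG)) (fun w _ => lexx _).
rewrite -(ler_pM2l A0) H.
apply: le_trans (ler_wpM2l (normr_ge0 _) B) _.
apply: le_of_eq.
have -> : disc_int (fun w => cabs (inv_kernel z w ^+ 2 * dual_power p (F w))) =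
  disc_int (fun w => cabs (inv_kernel z w) ^+ 2 * powR (cabs (F w)) (p - 1)).
  by apply: eq_disc_int => w _; rewrite cabsM cabsX cabs_dual_power.
by field; rewrite gt_eqF.
Qed.

(** |F|^(p-1) is in L^q1 exactly because F is in L^((p-1) q1), and [extremal_kernel_bound] dominates
    [k] by its transform with the positive kernel. *)
Lemma extremal_regularity q1 : 1 < q1 -> in_Bergman ((p - 1) * q1) F -> in_Bergman q1 k.
Proof.
move=> q1' Bq; have [hk _] := Bk; have A0 := @disc_area_gt0 R.
have iG : disc_integrable (fun w => powR (cabs (F w)) (p - 1)).
  have := cintegrable_cabs extremal_dual_integrable.
  by congr disc_integrable; apply/funext => w; rewrite cabs_dual_power.
have iGq : disc_integrable (fun w => powR (powR (cabs (F w)) (p - 1)) q1).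
  have := Bergman_integrable Bq; rewrite /Lp_integrable.
  by congr disc_integrable; apply/funext => w; rewrite powRrM.
apply: (in_BergmanP hk).
apply: (@bergman_schur _ q1 (fun w => powR (cabs (F w)) (p - 1)) q1'
  (disc_integrable_measurable iG) _ iG iGq _ (2 * `|Re_phi k F| / (@disc_area R))).
- by move=> w; exact: powR_ge0.
- exact: (holo_cmeasurable hk).
- by apply: divr_ge0 (mulr_ge0 _ (normr_ge0 _)) (ltW A0).
- move=> z; exact: extremal_kernel_bound.
Qed.

End ExtremalRegularity.

(** * Bloch bounds *)

Section UniformContinuity.
Context {R : realType}.
Implicit Types (f : R[i] -> R[i]) (v w z : R[i]).

(** Bisection of the square [-1, 1]^2. The property confines only [z] to the square while [w] ranges
    over the whole closed disc near [z], so the four quarters combine by minima and maxima, with no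
    condition across common edges. *)
Lemma cDisc_uniform_bounded f (e : R) : 0 < e ->
  (forall z, cDisc z -> forall e : R, 0 < e -> exists2 d : R, 0 < d &
    forall w, cDisc w -> cabs (w - z) < d -> cabs (f w - f z) < e) ->
  exists d M : R, [/\ 0 < d, forall z, cDisc z -> cabs (f z) <= M &
    forall z w, cDisc z -> cDisc w -> cabs (w - z) < d -> cabs (f w - f z) <= e].
Proof.
move=> e0 cf.
pose P (x y s : R) := exists d M : R, [/\ 0 < d,
  forall z, cDisc z -> x <= Re z <= x + s -> y <= Im z <= y + s -> cabs (f z) <= M &
  forall z w, cDisc z -> x <= Re z <= x + s -> y <= Im z <= y + s ->
    cDisc w -> cabs (w - z) < d -> cabs (f w - f z) <= e].
have {}cf : P (-1) (-1) 2.
  apply: cousin_square => //.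
  - move=> x y s s0 [d1 [M1 [d10 H1 K1]]] [d2 [M2 [d20 H2 K2]]] [d3 [M3 [d30 H3 K3]]] [d4 [M4 [d40 H4 K4]]].
    pose d := Num.min (Num.min d1 d2) (Num.min d3 d4).
    pose M := Num.max (Num.max M1 M2) (Num.max M3 M4).
    have [dd1 dd2 dd3 dd4] : [/\ d <= d1, d <= d2, d <= d3 & d <= d4].
      by split; rewrite /d !ge_min lexx ?orbT.
    have [MM1 MM2 MM3 MM4] : [/\ M1 <= M, M2 <= M, M3 <= M & M4 <= M].
      by split; rewrite /M !le_max lexx ?orbT.
    exists d, M; split; first by rewrite /d !lt_min d10 d20 d30 d40.
    + move=> z Dz /andP[x1 x2] /andP[y1 y2].
      have [xl|/ltW xl] := leP (Re z) (x + s / 2);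
        have [yl|/ltW yl] := leP (Im z) (y + s / 2).
      * by apply: le_trans MM1; apply: H1; rewrite // ?x1 ?y1.
      * by apply: le_trans MM3; apply: H3; rewrite // ?x1 ?yl//=; lra.
      * by apply: le_trans MM2; apply: H2; rewrite // ?xl ?y1//=; lra.
      * by apply: le_trans MM4; apply: H4; rewrite // ?xl ?yl//=; lra.
    + move=> z w Dz /andP[x1 x2] /andP[y1 y2] Dw zw.
      have [xl|/ltW xl] := leP (Re z) (x + s / 2);
        have [yl|/ltW yl] := leP (Im z) (y + s / 2).
      * by apply: K1; rewrite // ?x1 ?y1// (lt_le_trans zw).
      * by apply: K3; rewrite // ?x1 ?yl ?(lt_le_trans zw)//=; lra.
      * by apply: K2; rewrite // ?xl ?y1 ?(lt_le_trans zw)//=; lra.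
      * by apply: K4; rewrite // ?xl ?yl ?(lt_le_trans zw)//=; lra.
  - move=> x0 y0 _ _; pose v : R[i] := Complex x0 y0.
    have near x y (s : R) z : x <= x0 <= x + s -> y <= y0 <= y + s ->
        x <= Re z <= x + s -> y <= Im z <= y + s -> cabs (z - v) <= s + s.
      move=> /andP[a1 a2] /andP[b1 b2] /andP[c1 c2] /andP[d1 d2].
      apply: le_trans (cabs_le_ReIm _) _; rewrite cReD cReN cImD cImN /=.
      by apply: lerD; rewrite ler_norml; apply/andP; split; lra.
    have [Dv|nDv] := pselect (cDisc v).
      have [d d0 dP] := cf v Dv (e / 2) (divr_gt0 e0 (ltr0Sn _ 1)).
      (* Two points of a square of side below d/4 that contains [v] are close: |z - v| <= 2 s < d/2,
         and |w - z| < d/2 then gives |w - v| < d. *)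
      exists (d / 4); first by rewrite divr_gt0.
      move=> x y s /andP[s0 sd] xx yy; exists (d / 2), (cabs (f v) + e / 2); split; first by rewrite divr_gt0.
      + move=> z Dz xz yz; have zv := near x y s z xx yy xz yz.
        have {}zv : cabs (z - v) < d by lra.
        have := cabsD (f z - f v) (f v); rewrite subrK; have := dP z Dz zv; lra.
      + move=> z w Dz xz yz Dw wz; have zv := near x y s z xx yy xz yz.
        have wv : cabs (w - v) < d.
          by have := cabsD (w - z) (z - v); rewrite addrA subrK; lra.
        have {}zv : cabs (z - v) < d by lra.
        have := cabsB (f w - f v) (f z - f v).
        have -> : f w - f v - (f z - f v) = f w - f z by ring.
        have := dP z Dz zv; have := dP w Dw wv; lra.
    have v1 : 1 < cabs v by rewrite ltNge; apply/negP.
    (* A square this small around an outer point [v] misses the closed disc, so the property is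
       vacuous and any witnesses do. *)
    exists ((cabs v - 1) / 4); first by rewrite divr_gt0// subr_gt0.
    move=> x y s /andP[s0 sd] xx yy; exists 1, 0.
    have no z : cDisc z -> x <= Re z <= x + s -> y <= Im z <= y + s -> False.
      move=> Dz xz yz; have zv := near x y s z xx yy xz yz.
      have z1 : cabs z <= 1 := Dz.
      by have := lerB_cabs v z; rewrite cabs_distC; lra.
    by split => // [z /no H /H {}H /H|z w /no H /H {}H /H].
have sq (z : R[i]) : cDisc z -> -1 <= Re z <= -1 + 2 /\ -1 <= Im z <= -1 + 2.
  move=> z1; have : cabs z <= 1 := z1.
  have := Re_le_cabs z; have := Im_le_cabs z.
  by move=> /ler_normlP[? ?] /ler_normlP[? ?] ?; split; apply/andP; split; lra.
have [d [M [d0 HM Hd]]] := cf; exists d, M; split => //.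
- by move=> z Dz; have [? ?] := sq z Dz; exact: HM.
- by move=> z w Dz Dw; have [? ?] := sq z Dz; exact: Hd.
Qed.

End UniformContinuity.

Section KernelTransform.
Context {R : realType}.
Implicit Types (f k : R[i] -> R[i]) (w z : R[i]).

(** Half of the complex derivative in [z] of [inv_kernel z w ^+ 2 * f w]. *)
Definition dkernel f z w : R[i] := conjc w * (inv_kernel z w ^+ 3 * f w).

Lemma cabs_dkernel_le f z w : Disc w -> cabs (dkernel f z w) <= cabs (inv_kernel z w) ^+ 3 * cabs (f w).
Proof.
move=> Dw; rewrite /dkernel cabsM [X in _ * X]cabsM cabsX cabs_conj ler_piMl ?(ltW Dw)//.
by rewrite mulr_ge0 ?exprn_ge0 ?cabs_ge0.
Qed.

Lemma cintegrable_dkernel f z : Disc z -> cintegrable f -> cintegrable (dkernel f z).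
Proof.
move=> Dz iff; apply: (cintegrableMr (M := 1)) (cintegrable_kernelX 3 Dz iff).
  by apply: disc_measurable_continuous => w _; apply: ccont_conj; exact: ccont_id.
by move=> w Dw; rewrite cabs_conj ltW.
Qed.

(** Differentiation under the integral: [kernel_taylor] with a = conj w and c = 1 - |z| bounds the
    remainder uniformly in [w]. *)
Lemma derive_kernel_transform f k z : cintegrable f ->
  (forall z, Disc z -> k z = cint (fun w => inv_kernel z w ^+ 2 * f w)) -> Disc z ->
  'D_1 k z = 2 * cint (dkernel f z).
Proof.
move=> iff kE Dz; pose c := 1 - cabs z; have c0 : 0 < c by rewrite subr_gt0.
pose B := disc_int (fun w => cabs (f w)).
have B0 : 0 <= B by apply: disc_int_ge0 => w _; exact: cabs_ge0.
have iB : disc_integrable (fun w => cabs (f w)) := cintegrable_cabs iff.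
apply: (derivableCP (l := _) _).2 => e e0.
(* The first bound keeps z + h in the disc and meets the condition of [kernel_taylor]. In the
   second, 16 is 8 from the Taylor bound times 2 from [cabs_cint_le]; [B + 1] is positive. *)
pose d := Num.min (c / 2) (e / (16 / c ^+ 4 * (B + 1))).
have K0 : 0 < 16 / c ^+ 4 * (B + 1).
  by apply: mulr_gt0; [rewrite divr_gt0// exprn_gt0|rewrite ltr_wpDl].
exists d; first by rewrite /d lt_min !divr_gt0.
move=> h; rewrite /d lt_min => /andP[/ltW h1 /ltW h2].
have Dzh : Disc (z + h).
  by apply: le_lt_trans (cabsD _ _) _; move: h1 c0; rewrite /c; lra.
rewrite (kE _ Dz) (kE _ Dzh).
have i1 := cintegrable_kernelX 2 Dz iff; have i2 := cintegrable_kernelX 2 Dzh iff.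
have i3 := cintegrableZ (2 * h) (cintegrable_dkernel Dz iff).
rewrite [_ * h]mulrAC -(cintZ _ (cintegrable_dkernel Dz iff)) -(cintB i2 i1).
rewrite -(cintB (cintegrableB i2 i1) i3).
apply: le_trans (cabs_cint_le (cintegrableB (cintegrableB i2 i1) i3)
  (disc_integrableZ (8 / c ^+ 4 * cabs h ^+ 2) iB) _) _.
  move=> w Dw.
  have -> : inv_kernel (z + h) w ^+ 2 * f w - inv_kernel z w ^+ 2 * f w - 2 * h * dkernel f z w =
    ((1 - conjc w * (z + h)) ^- 2 - (1 - conjc w * z) ^- 2 - 2 * conjc w / (1 - conjc w * z) ^+ 3 * h) * f w.
    by rewrite /dkernel /inv_kernel [conjc w * (z + h)]mulrC [conjc w * z]mulrC !exprVn; ring.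
  rewrite cabsM ler_wpM2r ?cabs_ge0//; apply: kernel_taylor => //.
    by rewrite cabs_conj ltW.
  by rewrite mulrC; exact: kernel_lower_l.
rewrite (disc_intZ _ iB) -/B.
have -> : 2 * (8 / c ^+ 4 * cabs h ^+ 2 * B) = cabs h * (16 / c ^+ 4 * B) * cabs h by ring.
apply: ler_wpM2r; first exact: cabs_ge0.
move: h2; rewrite ler_pdivlMr//; apply: le_trans.
apply: ler_wpM2l; first exact: cabs_ge0.
by apply: ler_wpM2l; [rewrite divr_ge0// exprn_ge0// ltW|rewrite lerDl].
Qed.

Lemma cint_dkernel1 z : Disc z -> cint (dkernel (fun=> 1) z) = 0.
Proof.
move=> Dz; have H : forall z, Disc z -> (fun=> (@disc_area R)%:C%C) z =
    cint (fun w => inv_kernel z w ^+ 2 * (fun=> 1) w).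
  by move=> x Dx; rewrite -(cint_kernel Dx); apply: eq_cint => w _; rewrite mulr1.
have := derive_kernel_transform (cintegrable_cst 1) H Dz.
by rewrite derive_cst => /esym/eqP; rewrite mulf_eq0 pnatr_eq0 => /eqP.
Qed.

End KernelTransform.

Section BlochBounds.
Context {R : realType}.
Implicit Types (f k : R[i] -> R[i]) (w z : R[i]).

Lemma disc_integrable_kernel3 z : Disc z -> disc_integrable (fun w => cabs (inv_kernel z w) ^+ 3).
Proof.
move=> Dz; have := cintegrable_cabs (cintegrable_kernel 3 Dz).
by congr disc_integrable; apply/funext => w; rewrite cabsX.
Qed.

Lemma boundary_defect_le z : Disc z -> boundary_defect z <= 2 * (1 - cabs z).
Proof.
by move=> Dz; have z1 : cabs z < 1 := Dz; have := cabs_ge0 z; rewrite /boundary_defect; nra.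
Qed.

(** The constant is 2 * 2 * 2 * 36: from the derivative of the kernel, from [cabs_cint_le], from 1 -
    |z|^2 <= 2 (1 - |z|), and from [disc_int_kernel3_le]. *)
Lemma kernel_transform_Bloch f k (M : R) : cintegrable f ->
  (forall z, Disc z -> k z = cint (fun w => inv_kernel z w ^+ 2 * f w)) ->
  (forall w, Disc w -> cabs (f w) <= M) ->
  forall z, Disc z -> (1 - cabs z ^+ 2) * cabs ('D_1 k z) <= 288 * M.
Proof.
move=> iff kE fM z Dz; have d0 : 0 < 1 - cabs z by rewrite subr_gt0.
have M0 : 0 <= M by apply: le_trans (fM z Dz); exact: cabs_ge0.
have i3 := disc_integrable_kernel3 Dz.
rewrite (derive_kernel_transform iff kE Dz) cabsM cabs2.
have pt w : Disc w -> cabs (dkernel f z w) <= M * cabs (inv_kernel z w) ^+ 3.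
  move=> Dw; apply: le_trans (cabs_dkernel_le f z Dw) _.
  by rewrite [leLHS]mulrC ler_wpM2r ?exprn_ge0 ?cabs_ge0// fM.
have H := cabs_cint_le (cintegrable_dkernel Dz iff) (disc_integrableZ M i3) pt.
rewrite (disc_intZ _ i3) in H.
have H3 := ler_wpM2l M0 (disc_int_kernel3_le Dz).
have {}H : cabs (cint (dkernel f z)) <= 72 * M / (1 - cabs z).
  by apply: le_trans H _; rewrite -mulrA; move: H3; rewrite mulrA [36 / _]mulrC; lra.
move: H; rewrite ler_pdivlMr// => H.
have := ler_wpM2r (cabs_ge0 (cint (dkernel f z))) (boundary_defect_le Dz).
by rewrite /boundary_defect; lra.
Qed.

(* Differentiating [cint_kernel] shows that the derivative kernel has integral
   zero, so that [f w] may be replaced by [f w - f z] in the formula for [k']. *)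
Lemma kernel_transform_little_Bloch f k (M e d : R) : cintegrable f ->
  (forall z, Disc z -> k z = cint (fun w => inv_kernel z w ^+ 2 * f w)) ->
  0 < d -> (forall w, Disc w -> cabs (f w) <= M) ->
  (forall z w, Disc z -> Disc w -> cabs (w - z) < d -> cabs (f w - f z) <= e) ->
  forall z, Disc z -> (1 - cabs z ^+ 2) * cabs ('D_1 k z) <=
    288 * e + 16 * M * (@disc_area R) / d ^+ 3 * (1 - cabs z).
Proof.
move=> iff kE d0 fM fe z Dz; have c0 : 0 < 1 - cabs z by rewrite subr_gt0.
have M0 : 0 <= M by apply: le_trans (fM z Dz); exact: cabs_ge0.
have e0 : 0 <= e by apply: le_trans (fe z z Dz Dz _); rewrite ?subrr ?cabs0.
have i3 := disc_integrable_kernel3 Dz.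
have ic : cintegrable (fun w => f w - f z * 1) := cintegrableB iff (cintegrableZ (f z) (cintegrable_cst 1)).
have E : cint (dkernel f z) = cint (dkernel (fun w => f w - f z * 1) z).
  have i1 := cintegrable_dkernel Dz (cintegrable_cst 1).
  transitivity (cint (dkernel f z) - cint (fun w => f z * dkernel (fun=> 1) z w)).
    by rewrite (cintZ _ i1) cint_dkernel1// mulr0 subr0.
  rewrite -(cintB (cintegrable_dkernel Dz iff) (cintegrableZ _ i1)).
  by apply: eq_cint => w _; rewrite /dkernel; ring.
rewrite (derive_kernel_transform iff kE Dz) cabsM cabs2 E.
have ib : disc_integrable (fun w => e * cabs (inv_kernel z w) ^+ 3 + 2 * M / d ^+ 3) :=
  disc_integrableD (disc_integrableZ e i3) (disc_integrable_cst _).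
have pt w : Disc w -> cabs (dkernel (fun w => f w - f z * 1) z w) <=
    e * cabs (inv_kernel z w) ^+ 3 + 2 * M / d ^+ 3.
  move=> Dw; apply: le_trans (cabs_dkernel_le _ z Dw) _; rewrite mulr1.
  have p0 : 0 <= cabs (inv_kernel z w) ^+ 3 by rewrite exprn_ge0// cabs_ge0.
  (* Near [z] the oscillation of [f] is at most [e]. Far from it |1 - z conj w| >= |w - z| >= d
     keeps the kernel bounded, so that part is killed by the factor 1 - |z|. *)
  have [near|far] := ltP (cabs (w - z)) d.
    apply: (@le_trans _ _ (e * cabs (inv_kernel z w) ^+ 3)).
      by rewrite [leLHS]mulrC ler_wpM2r// fe.
    by rewrite lerDl mulr_ge0 ?invr_ge0 ?exprn_ge0 ?mulr_ge0// ltW.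
  apply: (@le_trans _ _ (2 * M / d ^+ 3)); last by rewrite lerDr mulr_ge0.
  rewrite [leLHS]mulrC; apply: ler_pM; rewrite ?cabs_ge0//.
    by have := cabsB (f w) (f z); have := fM w Dw; have := fM z Dz; lra.
  rewrite -exprVn; apply: lerXn2r; rewrite ?nnegrE ?cabs_ge0 ?invr_ge0 ?(ltW d0)//.
  have H := kernel_ge_dist Dz Dw.
  by rewrite cabsV lef_pV2 ?posrE ?(lt_le_trans d0)// (le_trans far).
have := cabs_cint_le (cintegrable_dkernel Dz ic) ib pt.
rewrite (disc_intD (disc_integrableZ e i3) (disc_integrable_cst _)) (disc_intZ _ i3) disc_int_cst.
set X := cabs (cint _); set N := 2 * M / d ^+ 3 * _ => HX.
have H3 := ler_wpM2l e0 (disc_int_kernel3_le Dz).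
have {}HX : X <= 72 * e / (1 - cabs z) + 2 * N.
  by apply: le_trans HX _; rewrite -[72 * e / _]mulrA; move: H3; rewrite [36 / _]mulrC mulrA; lra.
have {}HX : X * (1 - cabs z) <= 72 * e + 2 * N * (1 - cabs z).
  by have := ler_wpM2r (ltW c0) HX; rewrite mulrDl divfK// gt_eqF.
have X0 : 0 <= X := cabs_ge0 _.
have := ler_wpM2r X0 (boundary_defect_le Dz).
have -> : 16 * M * disc_area / d ^+ 3 * (1 - cabs z) = 8 * (N * (1 - cabs z)) by rewrite /N; ring.
by rewrite /boundary_defect; lra.
Qed.

End BlochBounds.

Section ExtremalBloch.
Context {R : realType}.
Variables (p : R) (k F : R[i] -> R[i]).
Hypotheses (p1 : 1 < p) (Bk : in_Bergman (p / (p - 1)) k) (ext : extremal_function p k F).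

Let C : R[i] := ((@disc_area R)^-1 * Re_phi k F)%:C%C.
Let f w := C * dual_power p (F w).

Let fi : cintegrable f.
Proof. exact: cintegrableZ (extremal_dual_integrable p1 ext). Qed.

Let kE z : Disc z -> k z = cint (fun w => inv_kernel z w ^+ 2 * f w).
Proof.
move=> Dz; have A0 : (@disc_area R)%:C%C != 0.
  by rewrite -cabs_gt0 cabs_real gtr0_norm disc_area_gt0.
apply: (mulfI A0); rewrite (extremal_representation p1 Bk ext Dz).
have -> : cint (fun w => inv_kernel z w ^+ 2 * f w) =
    C * cint (fun w => inv_kernel z w ^+ 2 * dual_power p (F w)).
  rewrite -(cintZ _ (cintegrable_kernelX 2 Dz (extremal_dual_integrable p1 ext))).
  by apply: eq_cint => w _; rewrite /f; ring.
rewrite mulrA -rmorphM /= mulrA divff ?mul1r//.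
by rewrite gt_eqF// disc_area_gt0.
Qed.

Lemma extremal_Bloch : in_Hinfty F -> in_Bloch k.
Proof.
move=> [_ [M FM]]; split; first by case: Bk.
exists (288 * (cabs C * powR M (p - 1))).
apply: kernel_transform_Bloch fi kE _ => w Dw.
rewrite /f cabsM cabs_dual_power//; apply: ler_wpM2l; first exact: cabs_ge0.
have FMw := FM w Dw; have M0 : 0 <= M := le_trans (cabs_ge0 _) FMw.
have p10 : 0 <= p - 1 by rewrite subr_ge0 ltW.
exact: (ge0_ler_powR p10 (cabs_ge0 (F w)) M0 FMw).
Qed.

Lemma extremal_little_Bloch : extends_continuously_cdisc F -> in_little_Bloch k.
Proof.
move=> [G [cG GF]]; split; first by case: Bk.
(* The extension of [f] to the closed disc, continuous there because [dual_power p] is continuous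
   everywhere, also at zeros of [G]. *)
pose g w := C * dual_power p (G w).
have gf w : Disc w -> g w = f w by move=> Dw; rewrite /g /f GF.
have sD (z : R[i]) : Disc z -> cDisc z by move=> Dz; exact: ltW Dz.
have cg z : cDisc z -> forall e : R, 0 < e -> exists2 d : R, 0 < d &
    forall w, cDisc w -> cabs (w - z) < d -> cabs (g w - g z) < e.
  move=> Dz e e0.
  have /continuousCP/(_ e e0)[d1 d10 H1] :
      {for G z, continuous (fun x => C * dual_power p x)}.
    by apply: ccontM; [exact: ccont_cst|exact: dual_power_continuous].
  have /subspace_continuousP/(_ z Dz) cGz := cG.
  have /cGz /nbhsCP[d d0 H2] : nbhs (G z) [set y | cabs (y - G z) < d1] by apply/nbhsCP; exists d1.
  by exists d => // w Dw wz; apply: H1; exact: H2.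
move=> e e0; pose e' := e / (2 * 288).
have e'0 : 0 < e' by apply: (divr_gt0 e0); rewrite mulr_gt0 ?ltr0n.
have [d [M [d0 gM gd]]] := cDisc_uniform_bounded e'0 cg.
have fM w : Disc w -> cabs (f w) <= M by move=> Dw; rewrite -(gf _ Dw); exact/gM/sD.
have fd z w : Disc z -> Disc w -> cabs (w - z) < d -> cabs (f w - f z) <= e'.
  by move=> Dz Dw; rewrite -(gf _ Dz) -(gf _ Dw); apply: gd; exact: sD.
have H := kernel_transform_little_Bloch fi kE d0 fM fd.
pose K := 16 * M * (@disc_area R) / d ^+ 3 + 1.
have M0 : 0 <= M by apply: le_trans (fM 0 _); rewrite ?cabs_ge0// /Disc/= cabs0.
have K0 : 0 <= 16 * M * (@disc_area R) / d ^+ 3.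
  by rewrite divr_ge0 ?mulr_ge0 ?exprn_ge0// ltW// disc_area_gt0.
have K1 : 0 < K by rewrite /K ltr_wpDl.
(* Beyond this radius the term carrying 1 - |z| is at most e/2, and [e'] was chosen so that 288 e' =
   e/2. The radius may be negative, which the definition allows. *)
exists (1 - e / 2 / K); split; first by rewrite ltrBlDr ltrDl !divr_gt0.
move=> z Dz rz; apply: le_trans (H z Dz) _.
have rz' : (1 - cabs z) * K <= e / 2 by rewrite -ler_pdivlMr//; lra.
have c0 : 0 < 1 - cabs z by rewrite subr_gt0.
move: rz'; rewrite /K mulrDr mulr1 /e'; move: K0; set N := 16 * M * _ / _ => K0.
by rewrite [N * _]mulrC; lra.
Qed.

End ExtremalBloch.

Unset Implicit Arguments.

Theorem theorem5p1 (R : realType) (p : R) (k F : R[i] -> R[i]) :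
  1 < p ->
  in_Bergman (p / (p - 1)) k ->
  (exists z, Disc z /\ k z != 0) ->
  extremal_function p k F ->
  [/\ (forall q1 : R, 1 < q1 -> in_Bergman ((p - 1) * q1) F -> in_Bergman q1 k),
      (in_Hinfty F -> in_Bloch k) &
      (extends_continuously_cdisc F -> in_little_Bloch k)].
Proof.
move=> p1 Bk _ ext; split; first exact: extremal_regularity p1 Bk ext.
- exact: extremal_Bloch p1 Bk ext.
- exact: extremal_little_Bloch p1 Bk ext.
Qed.
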